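(* Let $\mathbb{K}$ be an algebraically closed field of characteristic zero and let $X$ be a toric variety over $\mathbb{K}$ with an additive action $\mathbb{G}_a^m\times X\to X$. Then the action $G\times\mathbb{A}^n\to\mathbb{A}^n$ of the group $G=H\times\mathbb{G}_a^m$ associated with this additive action is linearizable if and only if $X$ is a big open subset of a product of projective spaces.
   Context: $\mathbb{G}_a$ is the additive group of $\mathbb{K}$. A variety $X$ is toric if it is irreducible, normal and admits an action of an algebraic torus with an open orbit. An additive action on an irreducible variety $X$ is a regular faithful action $\mathbb{G}_a^m\times X\to X$ with an open orbit. If $X$ admits an additive action, then every invertible regular function on $X$ is constant and the divisor class group $\mathrm{Cl}(X)$ is a free finitely generated abelian group. For toric $X$, the Cox ring $R(X)=\bigoplus_{[D]\in\mathrm{Cl}(X)}H^0(X,D)$ is then a polynomial ring graded by $\mathrm{Cl}(X)$. The grading defines a linear action of the characteristic torus $H:=\mathrm{Spec}(\mathbb{K}[\mathrm{Cl}(X)])$ on the total coordinate space $\mathbb{A}^n:=\mathrm{Spec}(R(X))$. There is a canonically defined $H$-invariant open subset $U\subseteq\mathbb{A}^n$, whose complement is a union of coordinate subspaces of codimension at least $2$, together with a good quotient $p\colon U\to X$ by $H$, called the characteristic space (Cox construction). The additive action $\mathbb{G}_a^m\times X\to X$ lifts to an action of $\mathbb{G}_a^m$ on $\mathbb{A}^n$ which commutes with the $H$-action, preserves $U$, and makes $p$ equivariant. This gives an action of the commutative group $G:=H\times\mathbb{G}_a^m$ on $\mathbb{A}^n$ with an open orbit, called the action associated with the given additive action. An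 action $G\times\mathbb{A}^n\to\mathbb{A}^n$ of a linear algebraic group $G$ is linearizable if the image of $G$ in the group $\mathrm{Aut}(\mathbb{A}^n)$ of automorphisms of the variety $\mathbb{A}^n$ is conjugate in $\mathrm{Aut}(\mathbb{A}^n)$ to a subgroup of the group $\mathrm{GL}_n(\mathbb{K})$ of linear transformations. A toric variety $X$ is a big open subset of a toric variety $X'$ if $X$ is isomorphic to an open toric (i.e. torus-invariant) subset $W\subseteq X'$ such that $\mathrm{codim}_{X'}(X'\setminus W)\ge 2$. *)

(* Defs.v *)
From HB Require Import structures.
From mathcomp Require Import all_boot all_order all_algebra.
From mathcomp Require Import boolp classical_sets functions cardinality.
From mathcomp Require Import topology_structure initial_topology.
From mathcomp Require Import subtype_topology.
From mathcomp Require Import -(notations) mpoly.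

Set Implicit Arguments.
Unset Strict Implicit.
Unset Printing Implicit Defensive.

Import Order.TTheory GRing.Theory Num.Theory.

Local Open Scope classical_set_scope.
Local Open Scope ring_scope.

(* Built on MathComp and on the classical sets and topology of MathComp-Analysis.

   Varieties over an algebraically closed field are treated classically, as
   "K-spaces": a topological space of (closed) points with, for
   each open set, the K-valued functions regular on it.  A function defined on
   an open W is represented by a total function, of which only the values on W
   matter; [regular] is meaningful on open sets only. *)

Record kspace (K : fieldType) := KSpace {
  carrier :> topologicalType;
  regular : set carrier -> set (carrier -> K) }.

Section Spaces.
Variable K : fieldType.
Implicit Types X Y : kspace K.

(* [V] is not required to lie in [W]: this one condition expresses that
   regularity only depends on the values on [W], restricts to smaller open
   sets, and is local. *)
Definition sheaf_of_functions X := forall (W : set X) (f : X -> K), open W ->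
  (regular W f <-> forall x, W x -> exists V g,
    [/\ open V, V x, regular V g & forall y, V y -> W y -> f y = g y]).

Definition morphism X Y (f : X -> Y) :=
  continuous f /\
  forall V g, open V -> regular V g -> regular (f @^-1` V) (g \o f).

Definition isomorphic X Y := exists (f : X -> Y) (g : Y -> X),
  [/\ morphism f, morphism g, cancel f g & cancel g f].

Definition restrict X (A : set X) : kspace K := @KSpace K (set_type A)
  (fun W f => forall x, W x -> exists V g,
    [/\ open V, V (set_val x), regular V g &
        forall y, W y -> V (set_val y) -> f y = g (set_val y)]).

Definition morphism_on X Y (A : set X) (f : X -> Y) :=
  @morphism (restrict A) Y (f \o set_val).

(* Affine space: 'rV[K]_n with the Zariski topology. *)

Definition peval n (P : mpoly n K) (z : 'rV[K]_n) : K := meval (z 0) P.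

Definition affine_pts n : Type := 'rV[K]_n.

HB.instance Definition _ n := Choice.on (affine_pts n).

Definition affine_basic n : set (set (affine_pts n)) :=
  [set W | exists P, W = [set z | peval P z != 0]].

HB.instance Definition _ n :=
  @isSubBaseTopological.Build (affine_pts n) _ (@affine_basic n) id.

Definition affine_space n : kspace K := @KSpace K (affine_pts n)
  (fun W f => forall x, W x -> exists P Q, peval Q x != 0 /\
    forall y, W y -> peval Q y != 0 -> f y = peval P y / peval Q y).

(* Projective space: lines in K^(n+1). The value of a form at a line L is only
   used through its vanishing, or through quotients of forms of equal degree;
   neither depends on the nonzero vector [vpick L] of L at which it is taken. *)

Definition projective_pts n : Type :=
  {L : {vspace 'rV[K]_n.+1} | \dim L == 1%N}.

HB.instance Definition _ n := Choice.on (projective_pts n).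

Definition feval n (F : mpoly n.+1 K) (L : projective_pts n) : K :=
  peval F (vpick (val L)).

Definition homogeneous_form n d (F : mpoly n K) := 
  forall m, m \in msupp F -> mdeg m = d.

Definition projective_basic n : set (set (projective_pts n)) :=
  [set W | exists d F, homogeneous_form d F /\ W = [set L | feval F L != 0]].

HB.instance Definition _ n :=
  @isSubBaseTopological.Build (projective_pts n) _ (@projective_basic n) id.

Definition projective_space n : kspace K := @KSpace K (projective_pts n)
  (fun W f => forall x, W x -> exists d F G,
    [/\ homogeneous_form d F, homogeneous_form d G, feval G x != 0 &
        forall y, W y -> feval G y != 0 -> f y = feval F y / feval G y]).

(* Product of varieties; its topology is finer than the product topology. *)

Definition tensor X Y (U : set X) (V : set Y) : set (X * Y -> K) :=
  [set h | exists N (a : 'I_N -> X -> K) (b : 'I_N -> Y -> K),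
    [/\ forall i, regular U (a i), forall i, regular V (b i) &
        forall z, h z = \sum_i a i z.1 * b i z.2]].

Definition prod_pts X Y : Type := (X * Y)%type.

HB.instance Definition _ X Y := Choice.on (prod_pts X Y).

Definition prod_basic X Y : set (set (prod_pts X Y)) :=
  [set W | exists U V h, [/\ open U, open V, tensor U V h &
    W = [set z | [/\ U z.1, V z.2 & h z != 0]]]].

HB.instance Definition _ X Y :=
  @isSubBaseTopological.Build (prod_pts X Y) _ (@prod_basic X Y) id.

Definition product X Y : kspace K := @KSpace K (prod_pts X Y)
  (fun W f => forall x, W x -> exists U V a b,
    [/\ open U, open V, U x.1 & V x.2] /\
    [/\ tensor U V a, tensor U V b, b x != 0 &
        forall y, W y -> U y.1 -> V y.2 -> b y != 0 -> f y = a y / b y]).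

(* P^{n_1} x ... x P^{n_k}, a point if k = 0. *)
Definition product_of_projective_spaces (dims : seq nat) : kspace K :=
  foldr (fun n Y => product (projective_space n) Y) (affine_space 0) dims.

(* Varieties *)

Definition affine_open X (V : set X) := open V /\
  exists k (Z : set (affine_space k)),
    closed Z /\ isomorphic (restrict V) (restrict Z).

Definition variety X := [/\ sheaf_of_functions X,
  exists N (V : 'I_N -> set X),
    (forall i, affine_open (V i)) /\ (forall x, exists i, V i x) &
  closed [set z : product X X | z.1 = z.2]].

Definition irreducible (T : topologicalType) (A : set T) := A !=set0 /\
  forall C1 C2, closed C1 -> closed C2 ->
    A `<=` C1 `|` C2 -> A `<=` C1 \/ A `<=` C2.

Definition irreducible_closed (T : topologicalType) (A : set T) :=
  closed A /\ irreducible A.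

(* For A irreducible closed: there is a chain A < A_1 < ... < A_k of
   irreducible closed sets. *)
Fixpoint chain_above (T : topologicalType) k (A : set T) : Prop :=
  if k is k'.+1 then
    exists B, [/\ irreducible_closed B, A `<` B & chain_above k' B]
  else True.

(* C is closed; the codimension of the empty set is infinite. *)
Definition codim_ge (T : topologicalType) k (C : set T) :=
  forall A, irreducible_closed A -> A `<=` C -> chain_above k A.

Definition regular_at X (x : X) (f : X -> K) :=
  exists V, [/\ open V, V x & regular V f].

(* On an irreducible variety, the field K(X) consists of the functions that
   satisfy [rational], modulo [rational_eq], with pointwise operations. *)

Definition rational X (f : X -> K) :=
  exists V, [/\ open V, V !=set0 & regular V f].

Definition rational_eq X (f g : X -> K) :=
  exists V, [/\ open V, V !=set0 & forall x, V x -> f x = g x].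

(* The local rings of X are integrally closed in K(X). *)
Definition normal_variety X := forall (x : X) (f : X -> K) d (c : 'I_d -> X -> K),
  rational f -> (forall i, regular_at x (c i)) ->
  rational_eq (fun y => f y ^+ d + \sum_i c i y * f y ^+ i) (fun=> 0) ->
  exists g, regular_at x g /\ rational_eq f g.

(* Actions. An algebraic group is given by a set G of points of an affine space
   with its group law; actions are curried and total, but constrained on G
   only. *)

Definition is_action (S T : Type) (G : set S) (one : S) (mul : S -> S -> S)
    (act : S -> T -> T) :=
  (forall x, act one x = x) /\
  forall g h x, G g -> G h -> act (mul g h) x = act g (act h x).

Definition regular_action k (G : set (affine_space k)) X
    (act : 'rV_k -> X -> X) :=
  @morphism (product (restrict G) X) X (fun z => act (set_val z.1) z.2).

Definition open_orbit S (G : set S) X (act : S -> X -> X) :=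
  exists x, open [set act g x | g in G].

(* Points of the algebraic torus of dimension d. *)
Definition torus d : set (affine_space d) := [set t | forall j, t 0 j != 0].

Definition torus_mul d (s t : 'rV[K]_d) : 'rV[K]_d := \row_j (s 0 j * t 0 j).

Definition torus_action d X (tau : 'rV[K]_d -> X -> X) :=
  is_action (@torus d) (const_mx 1) (@torus_mul d) tau /\
  regular_action (@torus d) tau.

Definition toric_variety X :=
  [/\ variety X, irreducible [set: X], normal_variety X &
      exists d tau, @torus_action d X tau /\ open_orbit (@torus d) tau].

(* Regular action of the vector group G_a^m. *)
Definition vector_group_action m X (alpha : 'rV[K]_m -> X -> X) :=
  is_action setT 0 +%R alpha /\
  @morphism (product (affine_space m) X) X (fun z => alpha z.1 z.2).

Definition additive_action m X (alpha : 'rV[K]_m -> X -> X) :=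
  [/\ vector_group_action alpha,
      forall g, (forall x, alpha g x = x) -> g = 0 &
      open_orbit setT alpha].

(* X' is meant to be a toric variety. *)
Definition big_open_subset X X' :=
  exists d (tau : 'rV[K]_d -> X' -> X'),
    [/\ torus_action tau, open_orbit (@torus d) tau &
    exists W : set X',
      [/\ open W, forall t x, torus t -> W x -> W (tau t x),
          codim_ge 2 (~` W) & isomorphic X (restrict W)]].

(* Weil divisors on a normal variety *)

Definition prime_divisor X (Z : set X) :=
  [/\ irreducible_closed Z, chain_above 1 Z & ~ chain_above 2 Z].

(* t is a uniformizer of the discrete valuation ring O_{X,Z}: it is regular near
   the generic point of Z and generates the ideal of the germs vanishing on Z. *)
Definition uniformizer X (Z V : set X) (t : X -> K) :=
  [/\ open V, Z `&` V !=set0, regular V t, forall x, Z x -> V x -> t x = 0 &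
    forall V1 g, open V1 -> Z `&` V1 !=set0 -> regular V1 g ->
      (forall x, Z x -> V1 x -> g x = 0) ->
      exists V2 h, [/\ open V2, V2 `<=` V1 `&` V, Z `&` V2 !=set0,
        regular V2 h & forall x, V2 x -> g x = h x * t x]].

Definition has_order X (Z : set X) (f : X -> K) (k : int) :=
  exists V t u, [/\ uniformizer Z V t, regular V u, forall x, V x -> u x != 0 &
    rational_eq f (fun x => u x * t x ^ k)].

(* Order of f in K(X)* along the prime divisor Z. *)
Definition ord X (Z : set X) (f : X -> K) : int := xget 0 (has_order Z f).

Definition divisor X (D : set X -> int) :=
  finite_set [set Z | D Z != 0] /\ forall Z, D Z != 0 -> prime_divisor Z.

Definition lin_equiv X (D E : set X -> int) := exists f : X -> K,
  [/\ rational f, ~ rational_eq f (fun=> 0) &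
      forall Z, prime_divisor Z -> D Z = E Z + ord Z f].

Definition comb X r (D : 'I_r -> set X -> int) (a : 'rV[int]_r) : set X -> int :=
  fun Z => \sum_j a 0 j * D j Z.

(* The classes of the D_j form a basis of Cl(X), whence Cl(X) = Z^r. *)
Definition Cl_basis X r (D : 'I_r -> set X -> int) :=
  (forall j, divisor (D j)) /\
  forall E, divisor E -> exists! a, lin_equiv E (comb D a).

(* H^0(V, O(D)) as a subset of K(X), for V nonempty. *)
Definition sections X (V : set X) (D : set X -> int) (f : X -> K) :=
  rational f /\ (rational_eq f (fun=> 0) \/
    forall Z, prime_divisor Z -> Z `&` V !=set0 -> 0 <= ord Z f + D Z).

(* Cox rings and characteristic spaces *)

(* P is homogeneous of degree a if the i-th variable has degree w i. *)
Definition whomog n r (w : 'I_n -> 'rV[int]_r) (a : 'rV[int]_r) (P : mpoly n K) :=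
  forall m : multinom n, m \in msupp P -> \sum_i w i *+ m i = a.

(* Diagonal action of the torus Spec K[Z^r] on K^n defined by this grading. *)
Definition grading_action n r (w : 'I_n -> 'rV[int]_r) (t : 'rV[K]_r)
    (z : affine_space n) : affine_space n :=
  \row_i ((\prod_j t 0 j ^ w i 0 j) * z 0 i).

(* R(X) is the direct sum over a in Z^r of H^0(X, a_1 D_1 + ... + a_r D_r),
   multiplied in K(X). The substitution x_i |-> s_i is an isomorphism of graded
   algebras from K[x_1, ..., x_n], deg x_i = w i, onto R(X). *)
Definition Cox_coordinates X r (D : 'I_r -> set X -> int) n
    (w : 'I_n -> 'rV[int]_r) (s : 'I_n -> X -> K) :=
  (forall i, sections setT (comb D (w i)) (s i)) /\
  forall a f, sections setT (comb D a) f ->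
    exists! P : mpoly n K,
      whomog w a P /\ rational_eq f (fun x => meval (s ^~ x) P).

(* f in K(X) and h in K(x_1, ..., x_n), homogeneous of degree a, correspond to
   each other in the homogeneous localization of R(X) = K[x_1, ..., x_n]. *)
Definition Cox_fraction X n r (w : 'I_n -> 'rV[int]_r) (s : 'I_n -> X -> K)
    (a : 'rV[int]_r) (h : affine_space n -> K) (f : X -> K) :=
  exists b P Q, [/\ whomog w (a + b) P, whomog w b Q, Q != 0,
    rational_eq h (fun z => peval P z / peval Q z) &
    rational_eq f (fun x => meval (s ^~ x) P / meval (s ^~ x) Q)].

Definition good_quotient n r (act : 'rV[K]_r -> affine_space n -> affine_space n)
    (U : set (affine_space n)) X (p : affine_space n -> X) :=
  [/\ morphism_on U p,
      forall t z, torus t -> U z -> U (act t z) /\ p (act t z) = p z,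
      forall x, exists z, U z /\ p z = x,
      forall V, affine_open V -> affine_open (U `&` p @^-1` V) &
      forall V h, open V -> regular (U `&` p @^-1` V) h ->
        (forall t z, torus t -> U z -> V (p z) -> h (act t z) = h z) ->
        exists f, regular V f /\ forall z, U z -> V (p z) -> h z = f (p z)].

Definition coordinate_subspace n (I : {set 'I_n}) : set (affine_space n) :=
  [set z | forall i, i \in I -> z 0 i = 0].

(* U is the relative spectrum over X of the Cox sheaf, the sheaf with degree a
   part V |-> H^0(V, O(a_1 D_1 + ... + a_r D_r)), with its projection p. *)
Record Cox_construction X := CoxConstruction {
  cox_rank : nat;
  cox_div : 'I_cox_rank -> set X -> int;
  cox_basis : Cl_basis cox_div;
  cox_dim : nat;
  cox_deg : 'I_cox_dim -> 'rV[int]_cox_rank;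
  cox_sec : 'I_cox_dim -> X -> K;
  cox_ring : Cox_coordinates cox_div cox_deg cox_sec;
  cox_space : set (affine_space cox_dim);
  cox_open : open cox_space;
  cox_compl : exists F : {set {set 'I_cox_dim}},
    (forall I, I \in F -> (2 <= #|I|)%N) /\
    ~` cox_space = \bigcup_(I in [set` F]) coordinate_subspace I;
  cox_proj : affine_space cox_dim -> X;
  cox_quot : good_quotient (grading_action cox_deg) cox_space cox_proj;
  cox_proj_compat : forall V f, open V -> V !=set0 -> regular V f ->
    Cox_fraction cox_deg cox_sec 0 (f \o cox_proj) f;
  cox_sheaf : forall V a f, open V -> V !=set0 ->
    (sections V (comb cox_div a) f <->
     exists h, regular (cox_space `&` cox_proj @^-1` V) h /\
               Cox_fraction cox_deg cox_sec a h f) }.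

Arguments cox_deg {X} C i : rename.
Arguments cox_space {X} C z : rename.
Arguments cox_proj {X} C z : rename.

(* The lift of the additive action alpha to the total coordinate space. *)
Definition lifted_action X (C : Cox_construction X) m
    (alpha : 'rV[K]_m -> X -> X)
    (beta : 'rV[K]_m -> affine_space (cox_dim C) -> affine_space (cox_dim C)) :=
  [/\ vector_group_action beta,
      forall g t z, torus t -> beta g (grading_action (cox_deg C) t z) =
                               grading_action (cox_deg C) t (beta g z),
      forall g z, cox_space C z -> cox_space C (beta g z) &
      forall g z, cox_space C z ->
        cox_proj C (beta g z) = alpha g (cox_proj C z)].

(* The action of G = H x G_a^m, defined for t in the torus H. *)
Definition associated_action X (C : Cox_construction X) m
    (beta : 'rV[K]_m -> affine_space (cox_dim C) -> affine_space (cox_dim C))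
    (g : 'rV[K]_(cox_rank C) * 'rV[K]_m) (z : affine_space (cox_dim C)) :=
  grading_action (cox_deg C) g.1 (beta g.2 z).

Definition linearizable S (G : set S) n
    (act : S -> affine_space n -> affine_space n) :=
  exists psi psi' : affine_space n -> affine_space n,
    [/\ morphism psi, morphism psi', cancel psi psi', cancel psi' psi &
    forall g, G g -> exists M : 'M[K]_n,
      M \in unitmx /\ forall z : 'rV[K]_n, psi (act g (psi' z)) = z *m M].

End Spaces.

(* Main.v *)
(** A product of projective spaces is the quotient of an open subset of an affine
    space by a torus that scales blocks of coordinates, and likewise for its open
    subsets.  If the complement has codimension at least 2, the prime divisors
    are the zero loci of the prime multihomogeneous forms, the class group is the
    group of multidegrees and the Cox ring is the polynomial ring.  Comparing it
    with the given Cox coordinates shows that a monomial in the latter with the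
    degree of a variable is a variable, so the lifted action, which respects
    degrees, is linear.

    Conversely, composing psi with the inverse of its Jacobian matrix at the
    fixed point psi^-1(0) makes it equivariant for the characteristic torus H,
    while G_a^m acts by matrices preserving the weight spaces of H.  Each weight
    space carries a nonzero linear form invariant under G_a^m.  A linear
    relation between distinct weights would give two invariant forms of equal
    degree; their quotient is constant on the open orbit, which is impossible.
    Since the weights also generate the class group, the distinct ones form a
    basis of it, and H acts by scaling blocks of coordinates, exactly as for a
    product of projective spaces P.  The characteristic space is contained in
    that of P, with complement of codimension at least 2, and the quotient X is
    the corresponding open subset of P. *)
From HB Require Import structures.
From mathcomp Require Import all_boot all_order all_algebra.
From mathcomp Require Import finmap.
From mathcomp Require Import boolp classical_sets functions cardinality.
From mathcomp Require Import topology_structure initial_topology.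
From mathcomp Require Import subtype_topology.
From mathcomp Require Import -(notations) mpoly.
From mathcomp Require Import fingroup perm zify ring.
Require Import Defs.

Set Implicit Arguments.
Unset Strict Implicit.
Unset Printing Implicit Defensive.

Import Order.TTheory GRing.Theory Num.Theory.

Local Open Scope classical_set_scope.
Local Open Scope ring_scope.

(** * Unique factorization in polynomial rings *)

(** Local sections of the quotient map, part of [presentation], turn questions about the quotient
    into questions about forms in a factorial polynomial ring: prime divisors are prime forms,
    orders are valuations, and irreducible hypersurfaces are the only zero loci whose
    Nullstellensatz is called upon. The Cox construction of X is given abstractly. In one direction
    its coordinates are tied to the blocks only by an isomorphism of graded rings; total degree
    decides there, since a generator of degree 0 would be constant and one of degree at least 2
    would be decomposable. In the other direction the map p is at first only a good quotient; that
    it separates torus orbits and is open on invariant sets is proved by descending suitable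
    invariant functions from affine charts. Invariant linear forms exist because matrix entries
    along a line in the vector group are polynomials, whose leading coefficients are unchanged by
    translation. A constant quotient of invariant forms is impossible because forms of different
    weights involve disjoint coordinates and take arbitrary values independently. *)

Section Divisibility.
Variable R : idomainType.
Implicit Types a b c p q : R.

(** Divisibility in the ring itself; for polynomials over a domain, [dvdp] asks for it only up to a
    nonzero constant factor. *)
Definition divides a b := exists c, b = c * a.

Definition prime_elt p :=
  [/\ p != 0, ~ divides p 1 & forall a b, divides p (a * b) -> divides p a \/ divides p b].

Definition factored a := exists u s,
  [/\ u \is a GRing.unit, forall q, q \in s -> prime_elt q & a = u * \prod_(q <- s) q].

(** The factors are prime, not merely irreducible, so that existence of factorizations already
    entails their uniqueness. *)
Definition is_ufd := forall a, a != 0 -> factored a.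

Lemma divides_refl a : divides a a.
Proof. by exists 1; rewrite mul1r. Qed.

Lemma divides_trans b a c : divides a b -> divides b c -> divides a c.
Proof. by move=> [x ->] [y ->]; exists (y * x); rewrite mulrA. Qed.

Lemma divides_mull a b c : divides a b -> divides a (c * b).
Proof. by move=> [x ->]; exists (c * x); rewrite mulrA. Qed.

Lemma divides_mulr a b c : divides a b -> divides a (b * c).
Proof. by rewrite mulrC; apply: divides_mull. Qed.

Lemma divides_add a b c : divides a b -> divides a c -> divides a (b + c).
Proof. by move=> [x ->] [y ->]; exists (x + y); rewrite mulrDl. Qed.

Lemma divides_sum a (I : Type) (r : seq I) (P : pred I) (F : I -> R) :
  (forall i, P i -> divides a (F i)) -> divides a (\sum_(i <- r | P i) F i).
Proof.
move=> h; elim/big_ind: _ => //; first by exists 0; rewrite mul0r.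
by move=> x y; apply: divides_add.
Qed.

Lemma divides_sub a b c : divides a b -> divides a c -> divides a (b - c).
Proof. by move=> [x ->] [y ->]; exists (x - y); rewrite mulrBl. Qed.

Lemma divides1_unit a : divides a 1 <-> a \is a GRing.unit.
Proof.
split=> [[c e]|ua]; last by exists a^-1; rewrite mulVr.
by apply/unitrP; exists c; rewrite -e mulrC -e.
Qed.

Lemma prime_divides_prod p (s : seq R) :
  prime_elt p -> divides p (\prod_(q <- s) q) -> exists2 q, q \in s & divides p q.
Proof.
move=> [_ pN1 pM]; elim: s => [|a s IH]; rewrite ?big_nil ?big_cons // => /pM[h|/IH[q qs h]].
  by exists a; rewrite ?mem_head.
by exists q; rewrite ?inE ?qs ?orbT.
Qed.

Lemma prime_assoc p q : prime_elt p -> prime_elt q -> divides p q ->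
  exists2 u, u \is a GRing.unit & q = u * p.
Proof.
move=> [p0 pN1 pM] [q0 qN1 qM] [c qE]; exists c => //.
have: divides q (c * p) by exists 1; rewrite mul1r qE.
case/qM=> [[d cE]|[d pE]].
  case: pN1; exists d; apply: (mulfI q0); rewrite mulr1 {1}qE cE mulrA.
  by rewrite (mulrC q d).
apply/divides1_unit; exists d; apply: (mulIf p0).
by rewrite mul1r {1}pE {1}qE mulrA.
Qed.

Lemma factored_mul a b : factored a -> factored b -> factored (a * b).
Proof.
move=> [u [s [uu sp ->]]] [v [t [uv tp ->]]]; exists (u * v), (s ++ t).
split; first by rewrite unitrM uu.
  by move=> q; rewrite mem_cat => /orP[]; auto.
by rewrite big_cat /= mulrACA.
Qed.

Lemma factored_prime p : prime_elt p -> factored p.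
Proof.
move=> pp; exists 1, [:: p]; rewrite big_seq1 mul1r unitr1; split=> // q.
by rewrite inE => /eqP->.
Qed.

Lemma factored_unit u : u \is a GRing.unit -> factored u.
Proof. by move=> uu; exists u, [::]; rewrite big_nil mulr1. Qed.

(* Every other representation of the fraction P/Q is obtained from P0/Q0 by
   multiplying numerator and denominator by the same element. *)
Lemma reduced_fraction P Q : is_ufd -> Q != 0 -> exists P0 Q0,
  [/\ Q0 != 0, P * Q0 = P0 * Q &
      forall P' Q', P' * Q0 = P0 * Q' -> divides Q0 Q'].
Proof.
move=> fR Q_neq0; have [u [s [uu sp QE]]] := fR Q Q_neq0.
move: {2}(size s) (leqnn (size s)) => n; elim: n u s P Q uu sp QE Q_neq0 => [|n IH] u s P Q uu sp QE Q_neq0.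
  rewrite leqn0 size_eq0 => /eqP s0; exists P, Q; split=> // P' Q' _.
  move: QE; rewrite s0 big_nil mulr1 => ->.
  by exists (Q' / u); rewrite divrK.
(* A prime factor common to [P] and [Q] is cancelled, which shortens [s]; without one the fraction
   is already reduced. *)
case: (pselect (exists2 q, q \in s & divides q P)) => [[q qs [P1 PE]]|nq] ss.
  have q0 : q != 0 by case: (sp _ qs).
  have QE1 : Q = (u * \prod_(x <- rem q s) x) * q.
    by rewrite QE (big_rem q) //= mulrAC -mulrA.
  have [|||||P0 [Q0 [h1 h2 h3]]] := IH u (rem q s) P1 (u * \prod_(x <- rem q s) x).
  - by [].
  - by move=> x /mem_rem; apply: sp.
  - by [].
  - by apply: contraNneq Q_neq0 => e; rewrite QE1 e mul0r.
  - by rewrite size_rem // -ltnS (leq_trans _ ss) //; case: (s) qs.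
  exists P0, Q0; split=> //.
  by rewrite PE QE1 mulrAC h2 !mulrA.
exists P, Q; split=> // P' Q' e.
(* The primes of [Q] divide [P * Q'] and none divides [P], so they pass to [Q'] one at a time, with
   multiplicity. *)
have {ss} : forall t, {subset t <= s} -> divides (\prod_(x <- t) x) Q' ->
    forall q, q \in s -> divides (q * \prod_(x <- t) x) (P * Q') ->
    divides (q * \prod_(x <- t) x) Q'.
  move=> t ts [c Q'E] q qs [d]; rewrite {1}Q'E !mulrA => /mulIf h.
  have q0 : \prod_(x <- t) x != 0.
    by rewrite prodf_seq_neq0; apply/allP=> x /ts/sp[].
  have [_ _ qM] := sp _ qs; have /qM[h'|] : divides q (P * c) by exists d; rewrite h.
    by case: nq; exists q.
  by move=> [c' cE]; exists c'; rewrite Q'E cE mulrA.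
move=> key.
have divQ : divides (\prod_(x <- s) x) (P * Q').
  by rewrite -e; apply: divides_mull; rewrite QE; exists u.
have : forall t t', s = t' ++ t -> divides (\prod_(x <- t) x) Q'.
  elim=> [|a t IHt] t' st; first by exists Q'; rewrite big_nil mulr1.
  have sub x : x \in a :: t -> x \in s by rewrite st mem_cat => ->; rewrite orbT.
  rewrite big_cons; apply: key.
  - by move=> x xt; apply: sub; rewrite inE xt orbT.
  - by apply: (IHt (rcons t' a)); rewrite cat_rcons.
  - by apply: sub; rewrite mem_head.
  by apply: divides_trans divQ; rewrite st big_cat big_cons /=; apply: divides_mull; apply: divides_refl.
move=> /(_ s [::] erefl) [c Q'E]; exists (c / u); rewrite Q'E QE.
by rewrite mulrA divrK.
Qed.

End Divisibility.

(** * Gauss's lemma: polynomial rings over factorial domains are factorial *)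

Section GaussLemma.
Variable R : idomainType.
Implicit Types (p : R) (f g h : {poly R}).

Lemma divides_polyC p f : divides p%:P f <-> forall i, divides p f`_i.
Proof.
split=> [[c ->] i|]; first by exists c`_i; rewrite coefMC.
move=> /choice[c cE]; exists (\poly_(i < size f) c i).
apply/polyP=> i; rewrite coefMC coef_poly; case: ltnP => // le.
by rewrite nth_default // mul0r.
Qed.

(** If the first coefficients not divisible by [p] are those of index i in f and j in g, then the
    coefficient of index i + j in the product is not divisible by [p] either. *)
Lemma prime_polyC p : prime_elt p -> prime_elt p%:P.
Proof.
move=> [p0 pN1 pM]; split; rewrite ?polyC_eq0 //.
  by move=> /divides_polyC/(_ 0%N); rewrite coef1.
have first f : ~ divides p%:P f -> exists i,
    ~ divides p f`_i /\ forall j, (j < i)%N -> divides p f`_j.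
  move=> nf; have ex : exists i, `[< ~ divides p f`_i >].
    apply: contrapT => h; apply: nf; apply/divides_polyC => i.
    by apply: contrapT => h'; apply: h; exists i; apply/asboolP.
  case: (ex_minnP ex) => i /asboolP ni mi; exists i; split=> // j ji.
  by apply: contrapT => /asboolP/mi; rewrite leqNgt ji.
move=> f g fg; apply: contrapT => /not_orP[/first[i [ni fi]] /first[j [nj gj]]].
move/divides_polyC/(_ (i + j)%N): fg; rewrite coefM => h.
have ij : (i < (i + j).+1)%N by rewrite ltnS leq_addr.
suff: divides p (f`_i * g`_j) by case/pM.
move: h; rewrite (bigD1 (Ordinal ij)) //= addKn => h.
rewrite -[X in divides p X](addrK (\sum_(k < (i + j).+1 | k != Ordinal ij) f`_k * g`_(i + j - k))).
apply: divides_sub => //; apply: divides_sum => k nk.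
have [ki|ik] := ltnP k i; first by apply/divides_mulr/fi.
apply/divides_mull/gj; rewrite ltn_subLR; last by rewrite -ltnS.
by rewrite ltn_add2r ltn_neqAle ik andbT; apply: contra nk => /eqP e; apply/eqP/val_inj.
Qed.

Definition primitive f := forall p, prime_elt p -> ~ divides p%:P f.

(** Induction on the number of prime factors of the leading coefficient: a constant prime dividing
    [f] divides that coefficient, so removing it removes one factor. *)
Lemma primitive_part f : is_ufd R -> f != 0 ->
  exists c f0, [/\ c != 0, factored c, f = c%:P * f0 & primitive f0].
Proof.
move=> fR f0; have lf0 : lead_coef f != 0 by rewrite lead_coef_eq0.
have [u [s [uu sp lE]]] := fR _ lf0.
move: {2}(size s) (erefl (size s)) => n.
elim: n u s f uu sp f0 lf0 lE => [|n IH] u s f uu sp f0 lf0 lE.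
  move/eqP; rewrite size_eq0 => /eqP s0; exists 1, f.
  rewrite oner_eq0 mul1r; split=> //; first by apply: factored_unit; rewrite unitr1.
  move=> p [p0 pN1 pM] /divides_polyC/(_ (size f).-1); rewrite -lead_coefE lE s0 big_nil mulr1.
  by move=> [c uE]; apply: pN1; exists (u^-1 * c); rewrite -mulrA -uE mulVr.
case: (pselect (primitive f)) => [pf|].
  exists 1, f; rewrite oner_eq0 mul1r; split=> //.
  by apply: factored_unit; rewrite unitr1.
move=> /existsNP[p /not_implyP[pp /contrapT pf]] ss; have [g fE] := pf.
have p0 : p != 0 by case: pp.
have lgE : lead_coef f = lead_coef g * p by rewrite fE lead_coefM lead_coefC.
have up : ~ divides p u.
  move=> [c uE]; case: pp => _ pN1 _; apply: pN1; exists (u^-1 * c).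
  by rewrite -mulrA -uE mulVr.
have : divides p (u * \prod_(q <- s) q) by rewrite -lE lgE; exists (lead_coef g).
case: (pp) => _ _ pM /pM[//|] /(prime_divides_prod pp)[q qs pq].
have [v uv qE] := prime_assoc pp (sp _ qs) pq.
have v0 : v != 0 by apply: contraTneq uv => ->; rewrite unitr0.
have g0 : g != 0 by apply: contraNneq f0 => e; rewrite fE e mul0r.
have [||||||c [f1 [c0 fc gE pf1]]] := IH (u * v) (rem q s) g.
- by rewrite unitrM uu.
- by move=> x /mem_rem; apply: sp.
- by [].
- by rewrite lead_coef_eq0.
- apply: (mulIf p0); rewrite -lgE lE (big_rem q) //= qE.
  by rewrite -!mulrA; congr (_ * (_ * _)); rewrite mulrC.
- by rewrite size_rem // ss.
exists (p * c), f1; split=> //.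
- by rewrite mulf_neq0.
- by apply: factored_mul => //; apply: factored_prime.
by rewrite fE gE polyCM mulrC mulrA.
Qed.

Lemma primitive_mulr f g : primitive (f * g) -> primitive f /\ primitive g.
Proof.
move=> h; split=> p /h hp hf; apply: hp; first exact: divides_mulr.
exact: divides_mull.
Qed.

(** A constant prime remains prime among polynomials, so each factor in [s] can be removed from [f]
    or from [g]. *)
Lemma prime_strip (s : seq R) f g : (forall q, q \in s -> prime_elt q) ->
  forall h, (\prod_(q <- s) q)%:P * h = f * g -> exists f' g' a b,
    [/\ h = f' * g', f = a%:P * f', g = b%:P * g', a != 0 & b != 0].
Proof.
elim: s f g => [|p s IH] f g sp h.
  by rewrite big_nil mul1r => ->; exists f, g, 1, 1; rewrite !mul1r oner_eq0.
rewrite big_cons polyCM -mulrA => e.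
have pp : prime_elt p by apply: sp; rewrite mem_head.
have p0 : p%:P != 0 :> {poly R} by rewrite polyC_eq0; case: pp.
have {}IH := fun f g => IH f g (fun q qs => sp q (mem_behead (s := p :: s) qs)).
have [_ _ /(_ f g)] := prime_polyC pp.
case=> [|[f1 fE]|[g1 gE]]; first by rewrite -e; apply/divides_mulr/divides_refl.
  have [|f' [g' [a [b [hE f1E gE a0 b0]]]]] := IH f1 g h.
    by apply: (mulfI p0); rewrite e fE -mulrA mulrCA.
  exists f', g', (p * a), b; split=> //; last by rewrite mulf_neq0 //; case: pp.
  by rewrite fE f1E polyCM mulrC mulrA.
have [|f' [g' [a [b [hE fE g1E a0 b0]]]]] := IH f g1 h.
  by apply: (mulfI p0); rewrite e gE -(mulrC p%:P) mulrCA.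
exists f', g', a, (p * b); split=> //; last by rewrite mulf_neq0 //; case: pp.
by rewrite gE g1E polyCM mulrC mulrA.
Qed.

(** Clears the constant that a divisibility for [dvdp] leaves behind, at the price of rescaling the
    two factors. *)
Lemma scale_factor c h f g : is_ufd R -> c != 0 -> c%:P * h = f * g -> exists f' g' a b,
    [/\ h = f' * g', f = a%:P * f', g = b%:P * g', a != 0 & b != 0].
Proof.
move=> fR c0; have [u [s [uu sp ->]]] := fR c c0 => e.
have u0 : u != 0 by apply: contraTneq uu => ->; rewrite unitr0.
have [|f' [g' [a [b [hE fE gE a0 b0]]]]] := @prime_strip s (u^-1 *: f) g sp h.
  by rewrite -scalerAl -e -mul_polyC mulrA -polyCM mulrA mulVr ?mul1r.
exists f', g', (u * a), b; split=> //; last by rewrite mulf_neq0.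
by rewrite polyCM -mulrA -fE mul_polyC scalerA divrr ?scale1r.
Qed.

Lemma size_polyC_mul a f : a != 0 -> size (a%:P * f) = size f.
Proof. by move=> a0; rewrite mul_polyC size_scale. Qed.

(** The gcd times some r is a multiple of [f] by a constant. If the prime [f] divides r, the gcd is
    constant; otherwise [f] divides the gcd, and then [g] up to a constant, hence [g]. The
    conclusion gives access to Bezout relations. *)
Lemma prime_coprimep f g : is_ufd R -> prime_elt f -> (1 < size f)%N ->
  ~ divides f g -> coprimep f g.
Proof.
move=> fR pf sf nfg; have [f0 _ fM] := pf.
have nfc c : c != 0 -> ~ divides f c%:P.
  move=> c0 [d e]; have := congr1 (size : {poly R} -> nat) e.
  have d0 : d != 0 by apply: contraNneq c0 => d0; rewrite -polyC_eq0 e d0 mul0r.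
  rewrite size_polyC c0 size_mul //=; move: d0 sf; rewrite -size_poly_gt0. move: (size d) (size f) => x y; lia.
have nf g' : ~ divides f g' -> ~~ (f %| g')%R.
  move=> n; apply/negP => /Pdiv.Idomain.dvdpP [[c r] /= c0 e].
  have : divides f (c *: g') by exists r.
  by rewrite -mul_polyC => /fM[/(nfc _ c0)|].
rewrite coprimep_def; apply/eqP.
have /Pdiv.Idomain.dvdpP [[c r] /= c0 e] := dvdp_gcdl f g.
have d0 : gcdp f g != 0 by rewrite gcdp_eq0 negb_and f0.
have : divides f (r * gcdp f g) by rewrite -e -mul_polyC; apply/divides_mull/divides_refl.
case/fM=> [[r' rE]|h].
  have : gcdp f g * r' = c%:P.
    by apply: (mulIf f0); rewrite mul_polyC e rE -mulrA mulrC.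
  move=> /(congr1 (size : {poly R} -> nat)); rewrite size_polyC c0.
  have r0 : r' != 0.
    apply: contraNneq c0 => r0; move: e; rewrite rE r0 !mul0r => /eqP.
    by rewrite -mul_polyC mulf_eq0 polyC_eq0 (negPf f0) orbF.
  by rewrite size_mul //=; move: d0 r0; rewrite -!size_poly_gt0; move: (size _) (size r') => x y; lia.
have [h' gE] := h; have /negP[] := nf _ nfg.
apply: dvdp_trans (dvdp_gcdr f g); apply/Pdiv.Idomain.dvdpP.
by exists (1, h'); rewrite ?oner_eq0 //= scale1r.
Qed.

Theorem ufd_poly : is_ufd R -> is_ufd {poly R}.
Proof.
move=> fR.
have fC (c : R) : c != 0 -> factored (c%:P : {poly R}).
  move=> c0; have [u [s [uu sp cE]]] := fR _ c0; exists u%:P, (map polyC s); split.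
  - by rewrite poly_unitE size_polyC coefC /= uu (_ : u != 0) //; apply: contraTneq uu => ->; rewrite unitr0.
  - by move=> q /mapP[p /sp pp ->]; apply: prime_polyC.
  by rewrite cE polyCM big_map rmorph_prod.
(* Induction on the degree. A primitive polynomial that is no product of two factors of positive
   degree turns out to be prime. *)
suff main : forall n f, (size f <= n)%N -> f != 0 -> primitive f -> factored f.
  move=> f f0; have [c [f1 [c0 _ fE pf]]] := primitive_part fR f0.
  rewrite fE; apply: factored_mul; first exact: fC.
  by apply: main pf => //; apply: contraNneq f0 => e; rewrite fE e mulr0.
elim=> [|n IH] f; first by rewrite leqn0 size_poly_eq0 => /eqP ->; rewrite eqxx.
move=> sf f0 pf.
have [sf1|sf1] := leqP (size f) 1.
  by rewrite (size1_polyC sf1); apply: fC; rewrite -polyC_eq0 -size1_polyC.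
case: (pselect (exists g h, [/\ f = g * h, (1 < size g)%N & (1 < size h)%N])) => [[g [h [fE sg sh]]]|irr].
  have := pf; rewrite fE => /primitive_mulr[pg ph].
  have [g0 h0] : g != 0 /\ h != 0 by rewrite -!size_poly_gt0 !(ltn_trans _ sg, ltn_trans _ sh).
  move: sf; rewrite fE size_mul // => sf.
  by apply: factored_mul; apply: IH => //; move: sf sg sh; lia.
have irr' g h : f = g * h -> (size g <= 1)%N || (size h <= 1)%N.
  by move=> fE; rewrite leqNgt (leqNgt (size h)) -negb_and; apply/negP=> /andP[? ?]; apply: irr; exists g, h.
(* The constant left by [scale_factor] on [f] is a unit because [f] is primitive, so [dvdp] by [f]
   is genuine divisibility. *)
have lift g : (f %| g)%R -> divides f g.
  move=> /Pdiv.Idomain.dvdpP [[c r] /= c0]; rewrite -mul_polyC => e.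
  have [r' [f' [a [b [gE rE fE a0 b0]]]]] := scale_factor fR c0 e.
  suff ub : b \is a GRing.unit.
    exists (r' * (b^-1)%:P); rewrite gE fE -mulrA; congr (_ * _).
    by rewrite mulrA -polyCM mulVr // mul1r.
  have [u [s [uu sp bE]]] := fR b b0.
  case: s sp bE => [|p s] sp bE; first by rewrite bE big_nil mulr1.
  case: (pf p); first by apply: sp; rewrite mem_head.
  rewrite fE bE big_cons mulrCA !polyCM -mulrA; exact/divides_mulr/divides_refl.
apply: factored_prime; split=> //.
  case=> c /esym e; have := congr1 (size : {poly R} -> nat) e; rewrite size_poly1.
  have c0 : c != 0 by apply: contra_eq_neq e => ->; rewrite mul0r eq_sym oner_eq0.
  by rewrite size_mul //; move: c0 sf1; rewrite -size_poly_gt0; move: (size c) (size f) => x y; lia.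
move=> g h [k e].
have dich g' : (f %| g')%R \/ coprimep f g'.
  rewrite coprimep_def; have /Pdiv.Idomain.dvdpP [[c r] /= c0] := dvdp_gcdl f g'.
  rewrite -mul_polyC => e'.
  have [r' [d' [a [b [fE rE dE a0 b0]]]]] := scale_factor fR c0 e'.
  have d0 : gcdp f g' != 0 by rewrite gcdp_eq0 negb_and f0.
  have /orP[sr|sd] := irr' _ _ fE; last first.
    right; rewrite dE size_polyC_mul // eqn_leq sd size_poly_gt0.
    by apply: contraNneq f0 => z; rewrite fE z mulr0.
  left; apply: dvdp_trans (dvdp_gcdr f g'); apply/Pdiv.Idomain.dvdpP.
  move: fE; rewrite (size1_polyC sr) => fE.
  have r0 : r'`_0 != 0 by apply: contraNneq f0 => z; rewrite fE z mul0r.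
  exists (r'`_0, b%:P); rewrite //= dE fE -mul_polyC.
  by rewrite mulrCA.
case: (dich g) => [/lift|cg]; first by left.
right; apply: lift; rewrite -(Gauss_dvdpr _ cg); apply/Pdiv.Idomain.dvdpP.
by exists (1, k); rewrite ?oner_eq0 //= scale1r.
Qed.

End GaussLemma.

Lemma ufd_iso (R S : idomainType) (f : {rmorphism R -> S}) (g : {rmorphism S -> R}) :
  cancel f g -> cancel g f -> is_ufd S -> is_ufd R.
Proof.
move=> fK gK uS a a0.
have injf := can_inj fK.
have [|u [s [uu sp fE]]] := uS (f a); first by rewrite -(rmorph0 f) (inj_eq injf).
have divE x y : divides x y <-> divides (f x) (f y).
  split=> [[c ->]|[c e]]; first by exists (f c); rewrite rmorphM.
  by exists (g c); apply: injf; rewrite rmorphM gK.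
exists (g u), (map g s); split; first exact: rmorph_unit.
  move=> q /mapP[p /sp [p0 pN1 pM] ->]; split.
  - by rewrite -(inj_eq injf) rmorph0 gK.
  - by rewrite divE gK rmorph1.
  by move=> x y; rewrite !divE rmorphM gK; apply: pM.
by apply: injf; rewrite fE big_map rmorphM rmorph_prod /= gK; congr (_ * _); apply: eq_bigr => i _; rewrite gK.
Qed.

(** * Polynomials in several variables as polynomials in the last one *)

Section MpolyUni.
Variable K : fieldType.

Lemma mpoly_rmorph_ext n (S : pzRingType) (f g : {rmorphism mpoly n K -> S}) :
  (forall c, f (mpolyC n c) = g (mpolyC n c)) ->
  (forall i, f (mpolyX K (mnm1 i)) = g (mpolyX K (mnm1 i))) -> f =1 g.
Proof.
move=> hC hX p; rewrite (mpolyE p) !rmorph_sum; apply: eq_bigr => m _.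
rewrite -mul_mpolyC !rmorphM hC; congr (_ * _).
rewrite mpolyXE_id !rmorph_prod; apply: eq_bigr => i _.
by rewrite !rmorphXn hX.
Qed.

Local Notation wd := (widen_ord (leqnSn _)).

Lemma muniX_max n : muni (mpolyX K (mnm1 (@ord_max n))) = 'X.
Proof.
rewrite muniE msuppX big_seq1 mcoeffX eqxx scale1r mnm1E eqxx expr1.
rewrite (_ : Multinom _ = mnm0) ?mpolyX0 ?scale1r //.
apply/mnmP=> i; rewrite mnmE mnm0E mnm1E eq_sym -val_eqE /= ltn_eqF //.
Qed.

Lemma muniX_widen n (i : 'I_n) :
  muni (mpolyX K (mnm1 (wd i))) = (mpolyX K (mnm1 i))%:P.
Proof.
rewrite muniE msuppX big_seq1 mcoeffX eqxx scale1r mnm1E.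
rewrite -val_eqE /= ltn_eqF // expr0 -mul_polyC mulr1; congr (mpolyX _ _)%:P.
by apply/mnmP=> j; rewrite mnmE !mnm1E -!val_eqE.
Qed.

Definition mpoly_of_poly n (p : {poly mpoly n K}) : mpoly n.+1 K :=
  horner_eval (mpolyX K (mnm1 ord_max)) (map_poly (@mwiden n K) p).

HB.instance Definition _ n := GRing.RMorphism.copy (@mpoly_of_poly n)
  (horner_eval (mpolyX K (mnm1 ord_max)) \o map_poly (@mwiden n K)).

Lemma mpoly_of_polyC n c : @mpoly_of_poly n c%:P = mwiden c.
Proof. by rewrite /mpoly_of_poly /horner_eval map_polyC hornerC. Qed.

Lemma mpoly_of_polyX n : @mpoly_of_poly n 'X = mpolyX K (mnm1 ord_max).
Proof. by rewrite /mpoly_of_poly /horner_eval map_polyX hornerX. Qed.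

Lemma mwidenXU n (i : 'I_n) : mwiden (mpolyX K (mnm1 i)) = mpolyX K (mnm1 (wd i)).
Proof. by rewrite mwidenX mnmwiden1. Qed.

Lemma ord_maxP n (i : 'I_n.+1) : i = ord_max \/ exists j, i = wd j.
Proof.
have [ltin|le] := ltnP i n; [right|left].
  by exists (Ordinal ltin); apply: val_inj.
by apply/val_inj/eqP => /=; rewrite eqn_leq le andbT -ltnS; exact: ltn_ord.
Qed.

Lemma muniK n : cancel (@muni n K) (@mpoly_of_poly n).
Proof.
apply: (mpoly_rmorph_ext (f := @mpoly_of_poly n \o @muni n K) (g := idfun)) => [c|i] /=.
  by rewrite muniC mpoly_of_polyC mwidenC.
have [->|[j ->]] := ord_maxP i; first by rewrite muniX_max mpoly_of_polyX.
by rewrite muniX_widen mpoly_of_polyC mwidenXU.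
Qed.

Lemma mwiden_muni n (p : mpoly n K) : muni (mwiden p) = p%:P.
Proof.
apply: (mpoly_rmorph_ext (f := @muni n K \o @mwiden n K) (g := polyC)) => [c|i] /=.
  by rewrite mwidenC muniC.
by rewrite mwidenXU muniX_widen.
Qed.

Lemma mpoly_of_polyK n : cancel (@mpoly_of_poly n) (@muni n K).
Proof.
move=> p; elim/poly_ind: p => [|p c IH]; first by rewrite !rmorph0.
by rewrite !rmorphD !rmorphM /= IH mpoly_of_polyC mpoly_of_polyX mwiden_muni muniX_max.
Qed.

Lemma meval_muni n (v : 'I_n.+1 -> K) p :
  meval v p = (map_poly (meval (v \o wd)) (muni p)).[v ord_max].
Proof.
apply: (mpoly_rmorph_ext (f := meval v)
  (g := horner_eval (v ord_max) \o map_poly (meval (v \o wd)) \o @muni n K)) => [c|i] /=.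
  by rewrite muniC /horner_eval map_polyC hornerC /= !mevalC.
rewrite mevalXU /horner_eval; have [->|[j ->]] := ord_maxP i.
  by rewrite muniX_max map_polyX hornerX.
by rewrite muniX_widen map_polyC hornerC /= mevalXU.
Qed.

Lemma mpoly0_const (p : mpoly 0 K) : exists c, p = mpolyC 0 c.
Proof.
exists (mcoeff mnm0 p); apply/mpolyP=> m; rewrite mcoeffC.
have -> : m = mnm0 by apply/mnmP=> -[].
by rewrite eqxx mulr1.
Qed.

Theorem ufd_mpoly n : is_ufd (mpoly n K).
Proof.
elim: n => [|n IH]; last first.
  exact: (ufd_iso (f := @muni n K) (g := @mpoly_of_poly n)) (@muniK n) (@mpoly_of_polyK n) (ufd_poly IH).
move=> a a0; have [c aE] := mpoly0_const a; apply: factored_unit.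
have c0 : c != 0 by apply: contraNneq a0 => c0; rewrite aE c0 mpolyC0.
by apply/divides1_unit; exists (mpolyC 0 c^-1); rewrite aE -mpolyCM mulVf.
Qed.

Lemma mpoly_unit_const n (p : mpoly n K) : p \is a GRing.unit -> exists2 c, c != 0 & p = mpolyC n c.
Proof.
rewrite unfold_in /= => /andP[/eqP pE up]; exists (mcoeff mnm0 p) => //.
by apply: contraTneq up => ->; rewrite unitr0.
Qed.

End MpolyUni.

Section InfiniteField.
Variable K : fieldType.
Hypothesis hK : [pchar K] =i pred0.

Lemma natr_inj_pchar0 : injective (fun n : nat => n%:R : K).
Proof.
have h := (pcharf0P K).1 hK.
suff le m n : (m <= n)%N -> m%:R = n%:R :> K -> m = n.
  by move=> m n e; case: (leqP m n) => [|/ltnW] /le; [apply|move=> ->].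
by move=> mn /eqP; rewrite eq_sym -subr_eq0 -natrB // h subn_eq0 => nm; apply/eqP; rewrite eqn_leq mn.
Qed.

Lemma poly_nonroot (p : {poly K}) : p != 0 -> exists x, p.[x] != 0.
Proof.
move=> p0; apply: contrapT => h.
have : (size [seq i%:R : K | i <- iota 0 (size p)] < size p)%N.
  apply: max_poly_roots => //; last by rewrite map_inj_uniq ?iota_uniq //; exact: natr_inj_pchar0.
  by apply/allP => x _; rewrite /root; apply: contrapT => x0; apply: h; exists x; apply/negP.
by rewrite size_map size_iota ltnn.
Qed.

Lemma poly_nonroot_neq0 (p : {poly K}) : p != 0 -> exists2 x, x != 0 & p.[x] != 0.
Proof.
move=> p0; have [|x] := @poly_nonroot ('X * p).
  by rewrite mulf_neq0 ?polyX_eq0.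
by rewrite hornerM hornerX mulf_eq0 negb_or => /andP[x0 px]; exists x.
Qed.

Local Notation wd := (widen_ord (leqnSn _)).

Definition ext_point n (v : 'I_n -> K) (x : K) (i : 'I_n.+1) : K :=
  if unlift ord_max i is Some j then v j else x.

Lemma ext_point_max n (v : 'I_n -> K) x : ext_point v x ord_max = x.
Proof. by rewrite /ext_point unlift_none. Qed.

Lemma ext_point_widen n (v : 'I_n -> K) x : ext_point v x \o wd = v.
Proof.
apply/funext => i; rewrite /ext_point /=.
by rewrite (_ : wd i = lift ord_max i) ?liftK //; apply: val_inj; rewrite /= /bump leqNgt ltn_ord.
Qed.

Lemma meval_ext n (v : 'I_n -> K) x p :
  meval (ext_point v x) p = (map_poly (meval v) (muni p)).[x].
Proof. by rewrite meval_muni ext_point_max ext_point_widen. Qed.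

Lemma mpoly_nonzero n (P : mpoly n K) : P != 0 -> exists v, meval v P != 0.
Proof.
elim: n P => [|n IH] P P0.
  have [c PE] := mpoly0_const P; exists (fun=> 0).
  by rewrite PE mevalC; apply: contraNneq P0 => c0; rewrite PE c0 mpolyC0.
have : lead_coef (muni P) != 0.
  by rewrite lead_coef_eq0 -(rmorph0 (@muni n K)) (inj_eq (can_inj (@muniK _ _))).
move=> /IH[v hv]; have : map_poly (meval v) (muni P) != 0.
  by apply: contraNneq hv => e; rewrite lead_coefE -coef_map e coef0.
by move=> /poly_nonroot[x hx]; exists (ext_point v x); rewrite meval_ext.
Qed.

End InfiniteField.

(** Serves as a resultant: [r] is the constant value of a Bezout combination of [f] and [g], so it
    vanishes under every specialization in which they acquire a common root. *)
Lemma common_root_resultant (R : idomainType) (f g : {poly R}) :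
  is_ufd R -> prime_elt f -> (1 < size f)%N -> ~ divides f g ->
  exists2 r : R, r != 0 & forall (S : comNzRingType) (e : {rmorphism R -> S}) x,
    (map_poly e f).[x] = 0 -> (map_poly e g).[x] = 0 -> e r = 0.
Proof.
move=> uR pf sf nfg.
have /Bezout_coprimepP [[u w] /= e] := prime_coprimep uR pf sf nfg.
have [r r0 rE] : exists2 r, r != 0 & u * f + w * g = r%:P.
  move: e; rewrite -size_poly_eq1 => /eqP s1; exists (u * f + w * g)`_0.
    by rewrite -polyC_eq0 -size1_polyC ?s1 // -size_poly_eq0 s1.
  by rewrite -size1_polyC ?s1.
exists r => // S h x fx gx; have := congr1 (fun p => (map_poly h p).[x]) rE.
by rewrite /= rmorphD !rmorphM /= hornerD !hornerM fx gx !mulr0 addr0 map_polyC hornerC.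
Qed.

(** * The Nullstellensatz for irreducible hypersurfaces *)

Section HypersurfaceNullstellensatz.
Variable K : closedFieldType.
Hypothesis hK : [pchar K] =i pred0.

(* In the main case a Bezout relation u pi + v F = r, with r free of the last
   variable, yields a zero of pi above any point where r and the leading
   coefficient of pi do not vanish, and F does not vanish there. *)
Theorem hypersurface_nullstellensatz n (pi F : mpoly n K) : prime_elt pi ->
  (forall v, meval v pi = 0 -> meval v F = 0) -> divides pi F.
Proof.
move=> pp h; apply: contrapT => nd.
suff [v [v1 v2]] : exists v, meval v pi = 0 /\ meval v F != 0 by rewrite h ?eqxx in v2.
elim: n pi F pp nd {h} => [|n IH] pi F [pi0 piN1 piM] nd.
  have [c piE] := mpoly0_const pi; case: piN1; exists (mpolyC 0 c^-1).
  by rewrite piE -mpolyCM mulVf //; apply: contraNneq pi0 => c0; rewrite piE c0 mpolyC0.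
have injm := can_inj (@muniK K n).
have divE (x y : mpoly n.+1 K) : divides x y <-> divides (muni x) (muni y).
  split=> [[c ->]|[c e]]; first by exists (muni c); rewrite rmorphM.
  by exists (mpoly_of_poly c); apply: injm; rewrite rmorphM /= mpoly_of_polyK.
set f := muni pi; set g := muni F.
have pf : prime_elt f.
  split; first by rewrite -(rmorph0 (@muni n K)) (inj_eq injm).
    by rewrite -(rmorph1 (@muni n K)) -divE.
  have lift (a : {poly mpoly n K}) : exists a', a = muni a'.
    by exists (mpoly_of_poly a); rewrite mpoly_of_polyK.
  move=> a b; have [[a' ->] [b' ->]] := (lift a, lift b).
  rewrite /f => fab; have : divides pi (a' * b') by apply/divE; rewrite muniM.
  by case/piM=> /divE; [left|right].
have nfg : ~ divides f g by rewrite -divE.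
suff [v [x [e1 e2]]] : exists v x, (map_poly (meval v) f).[x] = 0 /\ (map_poly (meval v) g).[x] != 0.
  by exists (ext_point v x); rewrite !meval_ext.
(* If [pi] does not involve the last variable, the induction hypothesis applies to a coefficient of
   [F] that [pi] does not divide. *)
have [sf|sf] := ltnP 1 (size f); last first.
  have [p fE] : exists p, f = p%:P by exists f`_0; apply: size1_polyC.
  rewrite fE in pf nfg *; have [p0 pN1 pM] := pf.
  have [i ni] : exists i, ~ divides p g`_i.
    by apply: contrapT => hh; apply/nfg/divides_polyC => i; apply: contrapT => ?; apply: hh; exists i.
  have pp : prime_elt p.
    split; first by rewrite -polyC_eq0.
      by move=> [c e]; apply: pN1; exists c%:P; rewrite -polyCM -e.
    move=> a b [c e]; case: (pM a%:P b%:P); first by exists c%:P; rewrite -!polyCM e.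
      by move=> /divides_polyC/(_ 0%N); rewrite coefC /=; left.
    by move=> /divides_polyC/(_ 0%N); rewrite coefC /=; right.
  have [v [v1 v2]] := IH p g`_i pp ni.
  have : map_poly (meval v) g != 0 by apply: contraNneq v2 => e; rewrite -coef_map e coef0.
  move=> /(poly_nonroot hK)[x hx]; exists v, x; split=> //.
  by rewrite map_polyC hornerC /= v1.
have [r r0 rE] := common_root_resultant (@ufd_mpoly K n) pf sf nfg.
have lf0 : lead_coef f != 0 by rewrite lead_coef_eq0; case: pf.
have [v] := mpoly_nonzero hK (mulf_neq0 r0 lf0).
rewrite mevalM mulf_eq0 negb_or => /andP[rv lv].
have : size (map_poly (meval v) f) != 1%N by rewrite size_map_poly_id0 // neq_ltn sf orbT.
move=> /closed_rootP[x /rootP xr]; exists v, x; split=> //.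
by apply: contraNneq rv => gx; apply/eqP; exact: (rE _ _ _ xr gx).
Qed.

End HypersurfaceNullstellensatz.

(** * Spaces, affine varieties and products *)

(** The topologies are defined by subbases; each of these is in fact a base, and then openness is a
    condition at single points. *)
Lemma open_fromP (T : choiceType) (b : set (set T)) :
  (forall x, exists2 B, b B & B x) ->
  (forall A B x, b A -> b B -> A x -> B x -> exists C, [/\ b C, C x & C `<=` A `&` B]) ->
  forall W : set T,
  [set \bigcup_(i in D') idfun i | D' in subset^~ (finI_from b idfun)] W <->
  forall x, W x -> exists B, [/\ b B, B x & B `<=` W].
Proof.
move=> bT bI W; split=> [[D' sD' <-] x [A DA Ax]|h].
  have [F Fb FA] := sD' _ DA; rewrite /= in Ax.
  suff [B [bB Bx BF]] : exists B, [/\ b B, B x & B `<=` A].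
    by exists B; split=> // y By; exists A => //; apply: BF.
  have Fx B : B \in F -> B x by move=> BF; move: Ax; rewrite -FA; apply.
  suff [B [bB Bx BF]] : exists B, [/\ b B, B x & forall C, C \in F -> B `<=` C].
    by exists B; split=> // y By; rewrite -FA => C CF; apply: BF.
  have {FA} : forall s : seq (set T), (forall C, C \in s -> C \in F) ->
      exists B, [/\ b B, B x & forall C, C \in s -> B `<=` C].
    elim=> [|C s IH] sF; first by have [B bB Bx] := bT x; exists B.
    have [|B [bB Bx sB]] := IH; first by move=> E Es; apply: sF; rewrite inE Es orbT.
    have CF : C \in F by apply: sF; rewrite mem_head.
    have [E [bE Ex EBC]] := bI C B x (set_mem (Fb _ CF)) bB (Fx _ CF) Bx.
    exists E; split=> // G; rewrite inE => /orP[/eqP->|Gs]; first by move=> y /EBC[].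
    by move=> y /EBC[_ By]; apply: sB Gs _ By.
  by move=> /(_ (enum_fset F) (fun C h => h)).
exists [set B | b B /\ B `<=` W].
  move=> B [bB _]; exists (fset1 B); last first.
    apply/seteqP; split=> [y|y By C].
      by apply; apply/fset1P.
    by rewrite /= => /fset1P ->.
  by move=> C /fset1P ->; apply/mem_set.
apply/seteqP; split=> [x [B [_ BW] Bx]|x Wx]; first exact: BW.
by have [B [bB Bx BW]] := h x Wx; exists B.
Qed.

Lemma open_local (T : topologicalType) (W : set T) :
  (forall x, W x -> exists V, [/\ open V, V x & V `<=` W]) -> open W.
Proof.
move=> h; rewrite openE => x /h [V [oV Vx VW]].
by rewrite /interior nbhsE; exists V.
Qed.

Section Nice.
Variable K : fieldType.
Implicit Types X Y : kspace K.

(** The local properties shared by affine and projective spaces, products, subspaces and varieties.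
    Most of the arguments below rest on them rather than on affine charts. *)
Record nice X : Prop := Nice {
  nice_sheaf : sheaf_of_functions X;
  nice_cst : forall (W : set X) c, open W -> regular W (fun=> c);
  nice_add : forall (W : set X) f g, open W -> regular W f -> regular W g ->
    regular W (fun x => f x + g x);
  nice_mul : forall (W : set X) f g, open W -> regular W f -> regular W g ->
    regular W (fun x => f x * g x);
  nice_inv : forall (W : set X) f, open W -> regular W f ->
    (forall x, W x -> f x != 0) -> regular W (fun x => (f x)^-1);
  nice_open : forall (W : set X) f, open W -> regular W f ->
    open (W `&` [set x | f x != 0]) }.

Section NiceTheory.
Variables (X : kspace K) (nX : nice X).

Lemma regular_local (W : set X) f : open W ->
  (forall x, W x -> exists V g, [/\ open V, V x, regular V g & forall y, V y -> W y -> f y = g y]) ->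
  regular W f.
Proof. by move=> oW h; apply/(nice_sheaf nX f oW). Qed.

Lemma regular_sub (V W : set X) f : open V -> open W -> V `<=` W -> regular W f -> regular V f.
Proof.
move=> oV oW VW rf; apply: regular_local => // x Vx.
by exists W, f; split=> //; apply: VW.
Qed.

Lemma regular_eq (W : set X) f g : open W -> (forall x, W x -> f x = g x) ->
  regular W f -> regular W g.
Proof.
by move=> oW e rf; apply: regular_local => // x Wx; exists W, f; split=> // y Wy _; rewrite e.
Qed.

Lemma regular_sum (W : set X) I (r : seq I) (P : pred I) (F : I -> X -> K) : open W ->
  (forall i, P i -> regular W (F i)) -> regular W (fun x => \sum_(i <- r | P i) F i x).
Proof.
move=> oW h; elim: r => [|i r IH].
  by apply: (regular_eq oW _ (nice_cst nX 0 oW)) => x _; rewrite big_nil.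
have [Pi|/negbTE Pi] := boolP (P i); [have hi := h i Pi|].
  by apply: (regular_eq oW _ (nice_add nX oW hi IH)) => x _; rewrite big_cons Pi.
by apply: (regular_eq oW _ IH) => x _; rewrite big_cons Pi.
Qed.

Lemma regular_prod (W : set X) I (r : seq I) (P : pred I) (F : I -> X -> K) : open W ->
  (forall i, P i -> regular W (F i)) -> regular W (fun x => \prod_(i <- r | P i) F i x).
Proof.
move=> oW h; elim: r => [|i r IH].
  by apply: (regular_eq oW _ (nice_cst nX 1 oW)) => x _; rewrite big_nil.
have [Pi|/negbTE Pi] := boolP (P i); [have hi := h i Pi|].
  by apply: (regular_eq oW _ (nice_mul nX oW hi IH)) => x _; rewrite big_cons Pi.
by apply: (regular_eq oW _ IH) => x _; rewrite big_cons Pi.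
Qed.

Lemma regular_exp (W : set X) f n : open W -> regular W f -> regular W (fun x => f x ^+ n).
Proof.
move=> oW rf; elim: n => [|n IH].
  by apply: (regular_eq oW _ (nice_cst nX 1 oW)) => x _; rewrite expr0.
by apply: (regular_eq oW _ (nice_mul nX oW rf IH)) => x _; rewrite exprS.
Qed.

Lemma regular_div (W : set X) f g : open W -> regular W f -> regular W g ->
  (forall x, W x -> g x != 0) -> regular W (fun x => f x / g x).
Proof. by move=> oW rf rg g0; apply: nice_mul => //; apply: nice_inv. Qed.

Lemma regular_sub_fun (W : set X) f g : open W -> regular W f -> regular W g ->
  regular W (fun x => f x - g x).
Proof.
move=> oW rf rg; apply: (regular_eq oW _ (nice_add nX oW rf (nice_mul nX oW (nice_cst nX (-1) oW) rg))).
by move=> x _; rewrite mulN1r.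
Qed.

Lemma regular_meval n (W : set X) (f : 'I_n -> X -> K) P : open W ->
  (forall i, regular W (f i)) -> regular W (fun x => meval (f ^~ x) P).
Proof.
move=> oW rf; apply: (regular_eq oW (f := fun x => \sum_(m <- msupp P) mcoeff m P * \prod_(i < n) f i x ^+ m i)).
  by move=> x _; rewrite mevalE.
apply: regular_sum => // m _; apply: nice_mul => //; first exact: nice_cst.
by apply: regular_prod => // i _; apply: regular_exp.
Qed.

End NiceTheory.

(** Regular functions on an open subset are total functions on [X]; the value 0 outside [A] is
    arbitrary. *)
Definition extend X (A : set X) (f : restrict A -> K) (x : X) : K :=
  if pselect (A x) is left h then f (SigSub (mem_set h)) else 0.

Lemma extendE X (A : set X) (f : restrict A -> K) (x : restrict A) :
  extend f (set_val x) = f x.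
Proof.
rewrite /extend; case: pselect => [h|[]]; last exact: set_valP.
by congr f; apply: val_inj.
Qed.

Lemma open_restrictP X (A : set X) (W : set (restrict A)) :
  open W <-> exists2 V : set X, open V & set_val @^-1` V = W.
Proof. by split=> -[V oV e]; exists V. Qed.

Lemma open_restrict X (A V : set X) : open V -> open (set_val @^-1` V : set (restrict A)).
Proof. by move=> oV; exists V. Qed.

Lemma nice_restrict X (A : set X) : nice X -> nice (restrict A).
Proof.
move=> nX; split.
- move=> W f oW; split=> [rf x Wx|h x Wx].
    by exists W, f; split.
  have [V [g [oV Vx rg e]]] := h x Wx.
  have [V' [g' [oV' V'x rg' e']]] := rg x Vx.
  have [V2 oV2 V2E] := oV.
  have oVV : open (V' `&` V2) by apply: openI.
  exists (V' `&` V2), g'; split=> //.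
  - by split=> //; move: Vx; rewrite -V2E.
  - by apply: (regular_sub nX) rg' => // y [].
  move=> y Wy [V'y V2y]; have Vy : V y by rewrite -V2E.
  by rewrite e // e'.
- move=> W c oW x Wx; exists setT, (fun=> c); split=> //; first exact: openT.
  by apply: nice_cst => //; apply: openT.
- move=> W f g oW rf rg x Wx.
  have [V [f' [oV Vx rf' e]]] := rf x Wx; have [V' [g' [oV' V'x rg' e']]] := rg x Wx.
  have oVV : open (V `&` V') by apply: openI.
  exists (V `&` V'), (fun y => f' y + g' y); split=> //.
    by apply: nice_add => //; [apply: (regular_sub nX) rf'|apply: (regular_sub nX) rg'] => // y [].
  by move=> y Wy [Vy V'y]; rewrite e // e'.
- move=> W f g oW rf rg x Wx.
  have [V [f' [oV Vx rf' e]]] := rf x Wx; have [V' [g' [oV' V'x rg' e']]] := rg x Wx.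
  have oVV : open (V `&` V') by apply: openI.
  exists (V `&` V'), (fun y => f' y * g' y); split=> //.
    by apply: nice_mul => //; [apply: (regular_sub nX) rf'|apply: (regular_sub nX) rg'] => // y [].
  by move=> y Wy [Vy V'y]; rewrite e // e'.
- move=> W f oW rf f0 x Wx.
  have [V [f' [oV Vx rf' e]]] := rf x Wx.
  have oV' := nice_open nX oV rf'.
  exists (V `&` [set y | f' y != 0]), (fun y => (f' y)^-1); split=> //.
  - by split=> //=; rewrite -e // f0.
  - by apply: nice_inv => // [|y []//]; apply: (regular_sub nX) rf' => // y [].
  by move=> y Wy [Vy _]; rewrite e.
move=> W f oW rf; apply: open_local => x [Wx fx].
have [V [f' [oV Vx rf' e]]] := rf x Wx.
exists (W `&` set_val @^-1` (V `&` [set y | f' y != 0])); split.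
- by apply: openI => //; apply: open_restrict; apply: nice_open.
- by do ![split=> //=]; rewrite -e.
by move=> y [Wy [Vy /= f'y]]; split=> //=; rewrite e.
Qed.

Lemma regular_extend X (A W : set X) (f : restrict A -> K) : nice X -> open A -> open W ->
  regular (set_val @^-1` W : set (restrict A)) f <-> regular (A `&` W) (extend f).
Proof.
move=> nX oA oW; have oAW : open (A `&` W) by apply: openI.
split=> [rf|rf x Wx].
  apply: (regular_local nX) => // x [Ax Wx].
  have [V [g [oV Vx rg e]]] := rf (SigSub (mem_set Ax)) Wx.
  exists V, g; split=> // y Vy [Ay Wy].
  by have := e (SigSub (mem_set Ay)) Wy Vy; rewrite -extendE.
exists (A `&` W), (extend f); split=> //; first by split=> //; apply: set_valP.
by move=> y Wy _; rewrite extendE.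
Qed.

Lemma restrict_regular X (A W : set X) (f : X -> K) : nice X -> open W -> regular W f ->
  regular (set_val @^-1` W : set (restrict A)) (f \o set_val).
Proof. by move=> nX oW rf x Wx; exists W, f; split. Qed.

Lemma nice_isomorphic X Y : isomorphic X Y -> sheaf_of_functions X -> nice Y -> nice X.
Proof.
move=> [f [g [[cf mf] [cg mg] fK gK]]] sX nY.
have oP (W : set X) : open W -> open (g @^-1` W) by move/continuousP: cg; apply.
have oP' (W : set Y) : open W -> open (f @^-1` W) by move/continuousP: cf; apply.
have E W : f @^-1` (g @^-1` W) = W by apply/seteqP; split=> x /=; rewrite fK.
have reg (W : set X) h : open W -> regular W h <-> regular (g @^-1` W) (h \o g).
  move=> oW; split=> [/mg|rh]; first exact.
  have := mf _ _ (oP _ oW) rh; rewrite E; congr (regular W _).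
  by apply/funext=> x /=; rewrite fK.
split=> //.
- by move=> W c oW; apply/reg => //; apply: nice_cst => //; apply: oP.
- move=> W h k oW /(reg _ _ oW) rh /(reg _ _ oW) rk; apply/(reg _ _ oW).
  exact: (nice_add nY (oP _ oW) rh rk).
- move=> W h k oW /(reg _ _ oW) rh /(reg _ _ oW) rk; apply/(reg _ _ oW).
  exact: (nice_mul nY (oP _ oW) rh rk).
- move=> W h oW /(reg _ _ oW) rh h0; apply/(reg _ _ oW).
  by apply: (nice_inv nY (oP _ oW) rh) => x Wx; apply: h0.
move=> W h oW /(reg _ _ oW) rh; have /oP' := nice_open nY (oP _ oW) rh.
rewrite (_ : f @^-1` _ = W `&` [set x | h x != 0]) //.
by apply/seteqP; split=> x /=; rewrite fK.
Qed.

Lemma nice_locally X : sheaf_of_functions X ->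
  (forall x, exists V : set X, [/\ open V, V x & nice (restrict V)]) -> nice X.
Proof.
move=> sX loc.
have rsub (V W : set X) f : open V -> open W -> V `<=` W -> regular W f -> regular V f.
  move=> oV oW VW rf; apply/(sX _ _ oV) => x Vx; exists W, f; split=> //; exact: VW.
have reg (V W : set X) f : open V -> open W -> W `<=` V -> regular W f <->
    regular (set_val @^-1` W : set (restrict V)) (f \o set_val).
  move=> oV oW WV; split=> [rf x Wx|rf]; first by exists W, f; split.
  apply/(sX _ _ oW) => x Wx.
  have [V' [g [oV' V'x rg e]]] := rf (SigSub (mem_set (WV _ Wx))) Wx.
  exists V', g; split=> // y V'y Wy.
  exact: (e (SigSub (mem_set (WV _ Wy)))).
have glue (W : set X) f : open W -> (forall V, open V -> nice (restrict V) ->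
    regular (set_val @^-1` (W `&` V) : set (restrict V)) (f \o set_val)) -> regular W f.
  move=> oW h; apply/(sX _ _ oW) => x Wx; have [V [oV Vx nV]] := loc x.
  by exists (W `&` V), f; split=> //; [exact: openI|apply/(reg V) => //; [exact: openI|apply: h]].
have loc' (W V : set X) f : open W -> open V -> regular W f ->
    regular (set_val @^-1` (W `&` V) : set (restrict V)) (f \o set_val).
  move=> oW oV rf; apply/reg => //; first exact: openI.
  by apply: rsub rf => //; apply: openI.
have oWV (W V : set X) : open W -> open V -> open (set_val @^-1` (W `&` V) : set (restrict V)).
  by move=> oW oV; apply: open_restrict; apply: openI.
split=> //.
- by move=> W c oW; apply: glue => // V oV nV; apply: (nice_cst nV); apply: oWV.
- move=> W f g oW rf rg; apply: glue => // V oV nV.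
  by apply: (nice_add nV) => //; [exact: oWV|exact: loc'..].
- move=> W f g oW rf rg; apply: glue => // V oV nV.
  by apply: (nice_mul nV) => //; [exact: oWV|exact: loc'..].
- move=> W f oW rf f0; apply: glue => // V oV nV.
  by apply: (nice_inv nV) => //; [exact: oWV|exact: loc'|move=> x [Wx _]; apply: f0].
move=> W f oW rf; apply: open_local => x [Wx fx].
have [V [oV Vx nV]] := loc x.
have /open_restrictP [V' oV' V'E] := nice_open nV (oWV _ _ oW oV) (loc' _ _ _ oW oV rf).
exists (V `&` V'); split; first exact: openI.
  split=> //; have : (set_val @^-1` V' : set (restrict V)) (SigSub (mem_set Vx)) by rewrite V'E.
  by [].
move=> y [Vy V'y]; have : (set_val @^-1` V' : set (restrict V)) (SigSub (mem_set Vy)) by [].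
by rewrite V'E => -[[Wy _] fy].
Qed.

End Nice.

Section AffineSpace.
Variable K : fieldType.
Implicit Types (X Y : kspace K).

Definition pvar n (i : 'I_n) : mpoly n K := mpolyX K (mnm1 i).

Lemma peval_var n i (z : 'rV[K]_n) : peval (pvar i) z = z 0 i.
Proof. exact: mevalXU. Qed.

Lemma pevalM n (P Q : mpoly n K) z : peval (P * Q) z = peval P z * peval Q z.
Proof. exact: mevalM. Qed.

Lemma pevalD n (P Q : mpoly n K) z : peval (P + Q) z = peval P z + peval Q z.
Proof. exact: mevalD. Qed.

Lemma pevalN n (P : mpoly n K) z : peval (- P) z = - peval P z.
Proof. exact: mevalN. Qed.

Lemma pevalC n c (z : 'rV[K]_n) : peval (mpolyC n c) z = c.
Proof. exact: mevalC. Qed.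

Lemma peval1 n (z : 'rV[K]_n) : peval 1 z = 1.
Proof. exact: meval1. Qed.

Lemma peval0 n (z : 'rV[K]_n) : peval 0 z = 0.
Proof. exact: meval0. Qed.

Lemma pevalX n (P : mpoly n K) k z : peval (P ^+ k) z = peval P z ^+ k.
Proof. by elim: k => [|k IH]; rewrite ?expr0 ?peval1 // !exprS pevalM IH. Qed.

Lemma peval_sum n I (r : seq I) (p : pred I) (F : I -> mpoly n K) z :
  peval (\sum_(i <- r | p i) F i) z = \sum_(i <- r | p i) peval (F i) z.
Proof. by elim/big_rec2: _ => [|i x y _ <-]; rewrite ?peval0 ?pevalD. Qed.

Lemma peval_prod n I (r : seq I) (p : pred I) (F : I -> mpoly n K) z :
  peval (\prod_(i <- r | p i) F i) z = \prod_(i <- r | p i) peval (F i) z.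
Proof. by elim/big_rec2: _ => [|i x y _ <-]; rewrite ?peval1 ?pevalM. Qed.

Lemma affine_openP n (W : set (affine_space K n)) :
  open W <-> forall z, W z -> exists2 P, peval P z != 0 & forall y, peval P y != 0 -> W y.
Proof.
have [z|A B z [P PE] [Q QE] Az Bz|h1 h2] := @open_fromP (affine_pts K n) (@affine_basic K n) _ _ W.
- exists [set z | peval 1 z != 0]; first by exists 1.
  by rewrite /= peval1 oner_neq0.
- exists [set y | peval (P * Q) y != 0]; split; first by exists (P * Q).
    by rewrite /= pevalM mulf_neq0 //; [move: Az; rewrite PE|move: Bz; rewrite QE].
  by move=> y /=; rewrite pevalM mulf_eq0 negb_or PE QE => /andP[].
split=> [/h1 h z /h[B [[P BE] Bz BW]]|h].
  by exists P; [move: Bz; rewrite BE|move=> y Py; apply: BW; rewrite BE].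
apply: h2 => z /h[P Pz PW]; exists [set y | peval P y != 0].
by split=> //; exists P.
Qed.

Lemma open_basic n (P : mpoly n K) : open ([set z | peval P z != 0] : set (affine_space K n)).
Proof. by apply/affine_openP => z Pz; exists P. Qed.

Lemma affine_closedP n (C : set (affine_space K n)) : closed C ->
  forall z, ~ C z -> exists2 P, peval P z != 0 & forall y, C y -> peval P y = 0.
Proof.
move=> /closed_openC/affine_openP h z Cz; have [P Pz PC] := h z Cz.
exists P => // y Cy; apply: contrapT => /eqP Py.
exact: (PC y Py).
Qed.

Lemma nice_affine n : nice (affine_space K n).
Proof.
split.
- move=> W f oW; split=> [rf x Wx|h x Wx]; first by exists W, f; split.
  have [V [g [/affine_openP oV Vx rg e]]] := h x Wx.
  have [P [Q [Qx PQ]]] := rg x Vx; have [R Rx RV] := oV x Vx.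
  exists (P * R), (Q * R); split; first by rewrite !pevalM !mulf_neq0.
  move=> y Wy; rewrite !pevalM mulf_eq0 negb_or => /andP[Qy Ry].
  by rewrite e ?PQ //; [field; rewrite Ry|exact: RV..].
- by move=> W c oW x Wx; exists (mpolyC n c), 1; split=> [|y Wy _]; rewrite !(peval1, pevalC) ?oner_neq0 ?divr1.
- move=> W f g oW rf rg x Wx; have [P [Q [Qx PQ]]] := rf x Wx; have [P' [Q' [Qx' PQ']]] := rg x Wx.
  exists (P * Q' + P' * Q), (Q * Q'); split; first by rewrite !(pevalD, pevalM) !mulf_neq0.
  move=> y Wy; rewrite !(pevalD, pevalM) mulf_eq0 negb_or => /andP[Qy Q'y].
  by rewrite PQ // PQ' //; field; rewrite Qy Q'y.
- move=> W f g oW rf rg x Wx; have [P [Q [Qx PQ]]] := rf x Wx; have [P' [Q' [Qx' PQ']]] := rg x Wx.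
  exists (P * P'), (Q * Q'); split; first by rewrite !(pevalD, pevalM) !mulf_neq0.
  move=> y Wy; rewrite !(pevalD, pevalM) mulf_eq0 negb_or => /andP[Qy Q'y].
  by rewrite PQ // PQ' //; field; rewrite Qy Q'y.
- move=> W f oW rf f0 x Wx; have [P [Q [Qx PQ]]] := rf x Wx.
  have Px : peval P x != 0 by have := f0 x Wx; rewrite PQ // mulf_eq0 negb_or => /andP[].
  exists (Q * Q), (P * Q); split; first by rewrite !(pevalD, pevalM) !mulf_neq0.
  move=> y Wy; rewrite !(pevalD, pevalM) mulf_eq0 negb_or => /andP[Py Qy].
  by rewrite PQ //; field; rewrite Qy Py.
move=> W f oW rf; apply/affine_openP => x [Wx /= fx]; have [P [Q [Qx PQ]]] := rf x Wx.
move/affine_openP: oW => /(_ x Wx)[R Rx RW].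
have Px : peval P x != 0 by move: fx; rewrite PQ // mulf_eq0 negb_or => /andP[].
exists (R * (P * Q)); first by rewrite !pevalM !mulf_neq0.
move=> y; rewrite !pevalM !mulf_eq0 !negb_or => /and3P[Ry Py Qy].
by split; [exact: RW|rewrite /= PQ ?mulf_neq0 ?invr_eq0 //; exact: RW].
Qed.

Lemma regular_peval n (W : set (affine_space K n)) P : regular W (peval P).
Proof.
by move=> x Wx; exists P, 1; split=> [|y _ _]; rewrite peval1 ?oner_neq0 ?divr1.
Qed.

Section MapToAffine.
Variables (X : kspace K) (nX : nice X) (n : nat) (W : set X) (oW : open W).
Variable f : X -> affine_space K n.
Hypothesis rf : forall i, regular W (fun x => f x 0 i).

Lemma regular_peval_comp P : regular W (fun x => peval P (f x)).
Proof. exact: regular_meval. Qed.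

Lemma preimage_affine_open O : open O -> open (W `&` f @^-1` O).
Proof.
move=> /affine_openP oO; apply: open_local => x [Wx /= /oO[P Px PO]].
exists (W `&` [set y | peval P (f y) != 0]); split=> //.
  exact: nice_open nX _ _ oW (regular_peval_comp P).
by move=> y [Wy Py]; split=> //; apply: PO.
Qed.

Lemma preimage_affine_regular O g : open O -> regular O g ->
  regular (W `&` f @^-1` O) (g \o f).
Proof.
move=> oO rg; have oWO := preimage_affine_open oO.
apply: (regular_local nX) => // x [Wx Ofx]; have [P [Q [Qx PQ]]] := rg (f x) Ofx.
have oQ := nice_open nX oW (regular_peval_comp Q).
exists ((W `&` f @^-1` O) `&` (W `&` [set y | peval Q (f y) != 0])), (fun y => peval P (f y) / peval Q (f y)); split=> //.
- exact: openI.
- apply: regular_div => //; first exact: openI.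
  + by apply: (regular_sub nX) (regular_peval_comp P) => //; [exact: openI|move=> y [[]]].
  + by apply: (regular_sub nX) (regular_peval_comp Q) => //; [exact: openI|move=> y [[]]].
  by move=> y [_ []].
by move=> y [[_ Oy] [_ Qy]] _; rewrite /= PQ.
Qed.

End MapToAffine.

Lemma sheaf_restrict X (A : set X) : sheaf_of_functions X -> sheaf_of_functions (restrict A).
Proof.
move=> sX W f oW; split=> [rf x Wx|h x Wx]; first by exists W, f; split.
have [V [g [oV Vx rg e]]] := h x Wx.
have [V' [g' [oV' V'x rg' e']]] := rg x Vx.
have [V2 oV2 V2E] := oV.
have oVV : open (V' `&` V2) by apply: openI.
exists (V' `&` V2), g'; split=> //.
- by split=> //; move: Vx; rewrite -V2E.
- by apply/(sX _ _ oVV) => y [V'y V2y]; exists V', g'; split.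
move=> y Wy [V'y V2y]; have Vy : V y by rewrite -V2E.
by rewrite e // e'.
Qed.

Lemma nice_variety X : variety X -> nice X.
Proof.
move=> [sX [N [V [aV cV]]] _]; apply: nice_locally => // x.
have [i Vx] := cV x; have [oV [k [Z [cZ iso]]]] := aV i.
exists (V i); split=> //; apply: nice_isomorphic iso _ _; first exact: sheaf_restrict.
by apply: nice_restrict; apply: nice_affine.
Qed.

End AffineSpace.

Section Products.
Variable K : fieldType.
Implicit Types (X Y : kspace K).

Lemma tensor_fin X Y (U : set X) (V : set Y) (T : finType) (a : T -> X -> K) (b : T -> Y -> K) h :
  (forall i, regular U (a i)) -> (forall i, regular V (b i)) ->
  (forall z, h z = \sum_i a i z.1 * b i z.2) -> tensor U V h.
Proof.
move=> ra rb hE; exists #|T|, (fun i => a (enum_val i)), (fun i => b (enum_val i)).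
by split=> // z; rewrite hE (reindex (@enum_val T predT)) //=; apply/onW_bij/enum_val_bij.
Qed.

Section Nice.
Variables (X Y : kspace K) (nX : nice X) (nY : nice Y).

Lemma tensor_cst (U : set X) (V : set Y) c : open U -> open V -> tensor U V (fun=> c).
Proof.
move=> oU oV; apply: (@tensor_fin X Y U V unit (fun _ _ => c) (fun _ _ => 1)).
- by move=> _; apply: nice_cst.
- by move=> _; apply: nice_cst.
by move=> z; rewrite (big_pred1 tt) ?mulr1 // => -[].
Qed.

Lemma tensor_fst (U : set X) (V : set Y) a : open U -> open V -> regular U a -> tensor U V (fun z => a z.1).
Proof.
move=> oU oV ra; apply: (@tensor_fin X Y U V unit (fun _ => a) (fun _ _ => 1)) => //.
  by move=> _; apply: nice_cst.
by move=> z; rewrite (big_pred1 tt) ?mulr1 // => -[].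
Qed.

Lemma tensor_snd (U : set X) (V : set Y) a : open U -> open V -> regular V a -> tensor U V (fun z => a z.2).
Proof.
move=> oU oV ra; apply: (@tensor_fin X Y U V unit (fun _ _ => 1) (fun _ => a)) => //.
  by move=> _; apply: nice_cst.
by move=> z; rewrite (big_pred1 tt) ?mul1r // => -[].
Qed.

Lemma tensor_add (U : set X) (V : set Y) h k : tensor U V h -> tensor U V k ->
  tensor U V (fun z => h z + k z).
Proof.
move=> [N [a [b [ra rb hE]]]] [N' [a' [b' [ra' rb' kE]]]].
apply: (@tensor_fin X Y U V ('I_N + 'I_N')%type (fun i => match i with inl i => a i | inr i => a' i end)
  (fun i => match i with inl i => b i | inr i => b' i end)).
- by case.
- by case.
by move=> z; rewrite big_sumType hE kE.
Qed.

Lemma tensor_mul (U : set X) (V : set Y) h k : open U -> open V -> tensor U V h -> tensor U V k ->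
  tensor U V (fun z => h z * k z).
Proof.
move=> oU oV [N [a [b [ra rb hE]]]] [N' [a' [b' [ra' rb' kE]]]].
apply: (@tensor_fin X Y U V ('I_N * 'I_N')%type (fun i x => a i.1 x * a' i.2 x)
  (fun i y => b i.1 y * b' i.2 y)).
- by move=> i; apply: nice_mul.
- by move=> i; apply: nice_mul.
move=> z; rewrite hE kE big_distrlr pair_bigA /=; apply: eq_bigr => i _.
by rewrite mulrACA.
Qed.

Lemma tensor_sub (U U' : set X) (V V' : set Y) h : open U -> open V -> open U' -> open V' ->
  U `<=` U' -> V `<=` V' -> tensor U' V' h -> tensor U V h.
Proof.
move=> oU oV oU' oV' UU VV [N [a [b [ra rb hE]]]]; exists N, a, b; split=> // i.
  exact: regular_sub (ra i).
exact: regular_sub (rb i).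
Qed.

Lemma tensor_subI1 (U U' : set X) (V V' : set Y) h : open U -> open V -> open U' -> open V' ->
  tensor U V h -> tensor (U `&` U') (V `&` V') h.
Proof. by move=> oU oV oU' oV'; apply: tensor_sub => //; apply: openI. Qed.

Lemma tensor_subI2 (U U' : set X) (V V' : set Y) h : open U -> open V -> open U' -> open V' ->
  tensor U' V' h -> tensor (U `&` U') (V `&` V') h.
Proof. by move=> oU oV oU' oV'; apply: tensor_sub => //; apply: openI. Qed.

Lemma product_openP (W : set (product X Y)) : open W <-> forall z, W z -> exists U V h,
  [/\ open U, open V, tensor U V h, [/\ U z.1, V z.2 & h z != 0] &
   forall y : X * Y, U y.1 -> V y.2 -> h y != 0 -> W y].
Proof.
have [z|A B z [U [V [h [oU oV th ->]]]] [U' [V' [k [oU' oV' tk ->]]]] [/= Uz Vz hz] [/= Uz' Vz' kz]|h1 h2] :=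
    @open_fromP (prod_pts X Y) (@prod_basic K X Y) _ _ W.
- exists setT => //; exists setT, setT, (fun=> 1); split; [exact: openT|exact: openT| |].
    by apply: tensor_cst; apply: openT.
  by apply/seteqP; split=> // y _; split=> //; rewrite oner_neq0.
- exists [set z | [/\ (U `&` U') z.1, (V `&` V') z.2 & h z * k z != 0]]; split.
  + exists (U `&` U'), (V `&` V'), (fun z => h z * k z); split=> //; try exact: openI.
    by apply: tensor_mul; [exact: openI|exact: openI|exact: tensor_subI1|exact: tensor_subI2].
  + by split=> //; rewrite mulf_neq0.
  by move=> y [/= [? ?] [? ?]]; rewrite mulf_eq0 negb_or => /andP[? ?].
split=> [/h1 hW z /hW[B [[U [V [h [oU oV th ->]]]] [Uz Vz hz] BW]]|hW].
  by exists U, V, h; split=> // y Uy Vy hy; apply: BW.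
apply: h2 => z /hW[U [V [h [oU oV th [Uz Vz hz] BW]]]].
exists [set z | [/\ U z.1, V z.2 & h z != 0]]; split=> //; first by exists U, V, h.
by move=> y [Uy Vy hy]; apply: BW.
Qed.

Lemma nice_product : nice (product X Y).
Proof.
split.
- move=> W f oW; split=> [rf x Wx|h x Wx]; first by exists W, f; split.
  have [W' [g [/product_openP oW' W'x rg e]]] := h x Wx.
  have [U [V [a [b [[oU oV Ux Vx] [ta tb bx gE]]]]]] := rg x W'x.
  have [U' [V' [k [oU' oV' tk [Ux' Vx' kx] kW]]]] := oW' x W'x.
  have oUU : open (U `&` U') by apply: openI.
  have oVV : open (V `&` V') by apply: openI.
  exists (U `&` U'), (V `&` V'), (fun z => a z * k z), (fun z => b z * k z); split; first by split.
  split.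
  + by apply: tensor_mul => //; [exact: tensor_subI1|exact: tensor_subI2].
  + by apply: tensor_mul => //; [exact: tensor_subI1|exact: tensor_subI2].
  + by rewrite mulf_neq0.
  move=> y Wy [Uy Uy'] [Vy Vy']; rewrite mulf_eq0 negb_or => /andP[bk ky].
  by rewrite e ?gE //; [field; rewrite bk ky|exact: kW..].
- move=> W c oW x Wx; exists setT, setT, (fun=> c), (fun=> 1); split; first by split=> //; apply: openT.
  by split; [apply: tensor_cst; apply: openT|apply: tensor_cst; apply: openT|exact: oner_neq0|move=> *; rewrite divr1].
- move=> W f g oW rf rg x Wx; have [U [V [a [b [[oU oV Ux Vx] [ta tb bx fE]]]]]] := rf x Wx.
  have [U' [V' [a' [b' [[oU' oV' Ux' Vx'] [ta' tb' bx' gE]]]]]] := rg x Wx.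
  have oUU : open (U `&` U') by apply: openI.
  have oVV : open (V `&` V') by apply: openI.
  have t1 h (th : tensor U V h) := tensor_subI1 oU oV oU' oV' th.
  have t2 h (th : tensor U' V' h) := tensor_subI2 oU oV oU' oV' th.
  exists (U `&` U'), (V `&` V'), (fun z => a z * b' z + a' z * b z), (fun z => b z * b' z); split; first by split.
  split; [by apply: tensor_add; apply: tensor_mul; auto|by apply: tensor_mul; auto|by rewrite mulf_neq0|].
  move=> y Wy [Uy Uy'] [Vy Vy']; rewrite mulf_eq0 negb_or => /andP[bk ky].
  by rewrite fE // gE //; field; rewrite bk ky.
- move=> W f g oW rf rg x Wx; have [U [V [a [b [[oU oV Ux Vx] [ta tb bx fE]]]]]] := rf x Wx.
  have [U' [V' [a' [b' [[oU' oV' Ux' Vx'] [ta' tb' bx' gE]]]]]] := rg x Wx.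
  have oUU : open (U `&` U') by apply: openI.
  have oVV : open (V `&` V') by apply: openI.
  have t1 h (th : tensor U V h) := tensor_subI1 oU oV oU' oV' th.
  have t2 h (th : tensor U' V' h) := tensor_subI2 oU oV oU' oV' th.
  exists (U `&` U'), (V `&` V'), (fun z => a z * a' z), (fun z => b z * b' z); split; first by split.
  split; [by apply: tensor_mul; auto|by apply: tensor_mul; auto|by rewrite mulf_neq0|].
  move=> y Wy [Uy Uy'] [Vy Vy']; rewrite mulf_eq0 negb_or => /andP[bk ky].
  by rewrite fE // gE //; field; rewrite bk ky.
- move=> W f oW rf f0 x Wx; have [U [V [a [b [[oU oV Ux Vx] [ta tb bx fE]]]]]] := rf x Wx.
  have ax : a x != 0 by have := f0 x Wx; rewrite fE // mulf_eq0 negb_or => /andP[].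
  exists U, V, (fun z => b z * b z), (fun z => a z * b z); split; first by split.
  split; [by apply: tensor_mul|by apply: tensor_mul|by rewrite mulf_neq0|].
  move=> y Wy Uy Vy; rewrite mulf_eq0 negb_or => /andP[bk ky].
  by rewrite fE //; field; rewrite bk ky.
move=> W f /product_openP oW rf; apply/product_openP => x [Wx /= fx].
have [U [V [a [b [[oU oV Ux Vx] [ta tb bx fE]]]]]] := rf x Wx.
have [U' [V' [k [oU' oV' tk [Ux' Vx' kx] kW]]]] := oW x Wx.
have oUU : open (U `&` U') by apply: openI.
have oVV : open (V `&` V') by apply: openI.
have t1 h (th : tensor U V h) := tensor_subI1 oU oV oU' oV' th.
have t2 h (th : tensor U' V' h) := tensor_subI2 oU oV oU' oV' th.
have ax : a x != 0 by move: fx; rewrite fE // mulf_eq0 negb_or => /andP[].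
exists (U `&` U'), (V `&` V'), (fun z => k z * (a z * b z)); split=> //.
- by apply: tensor_mul; auto; apply: tensor_mul; auto.
- by split=> //; rewrite !mulf_neq0.
move=> y [Uy Uy'] [Vy Vy']; rewrite !mulf_eq0 !negb_or => /and3P[ky ay by0].
by split; [exact: kW|rewrite /= fE ?mulf_neq0 ?invr_eq0 //; exact: kW].
Qed.

Lemma open_product (U : set X) (V : set Y) : open U -> open V ->
  open ([set z | U z.1 /\ V z.2] : set (product X Y)).
Proof.
move=> oU oV; apply/product_openP => z [Uz Vz]; exists U, V, (fun=> 1).
by split=> //; [exact: tensor_cst|split=> //; rewrite oner_neq0].
Qed.

Lemma regular_tensor (U : set X) (V : set Y) h : open U -> open V -> tensor U V h ->
  regular ([set z | U z.1 /\ V z.2] : set (product X Y)) h.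
Proof.
move=> oU oV th z [Uz Vz]; exists U, V, h, (fun=> 1); split=> //.
by split=> //; [exact: tensor_cst|exact: oner_neq0|move=> *; rewrite divr1].
Qed.

End Nice.

(** Restricting to the slice through [x], the open complement of the diagonal becomes the complement
    of [x]. *)
Lemma closed_point X : nice X -> closed [set z : product X X | z.1 = z.2] ->
  forall x : X, closed [set x].
Proof.
move=> nX /closed_openC/(product_openP nX nX) h x; rewrite -(setCK [set x]); apply: open_closedC; apply: open_local => y /= yx.
have [|U [V [k [oU oV [N [a [b [ra rb kE]]]] [/= Ux Vy ky] kW]]]] := h (x, y).
  by move=> /= e; apply: yx.
have rk : regular V (fun y' => k (x, y')).
  apply: (regular_eq nX oV (f := fun y' => \sum_i a i x * b i y')) => [y' _|]; first by rewrite kE.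
  by apply: regular_sum => // i _; apply: nice_mul => //; apply: nice_cst.
exists (V `&` [set y' | k (x, y') != 0]); split=> //; first exact: nice_open.
by move=> y' [Vy' ky'] /= e; apply: (kW (x, y')) => //=.
Qed.

End Products.

Lemma cross_cancel (R : idomainType) (P Q P' Q' P0 Q1 : R) : Q != 0 ->
  P' * Q = P * Q' -> P * Q1 = P0 * Q -> P' * Q1 = P0 * Q'.
Proof.
move=> Q0 e1 e2; apply: (mulfI Q0).
have -> : Q * (P' * Q1) = P' * Q * Q1 by ring.
rewrite e1; have -> : P * Q' * Q1 = P * Q1 * Q' by ring.
by rewrite e2; ring.
Qed.

(** * Regular functions on open subsets of affine space *)

Section AffineGeometry.
Variable K : fieldType.
Hypothesis hK : [pchar K] =i pred0.

Lemma peval_nonzero n (P : mpoly n K) : P != 0 -> exists z, peval P z != 0.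
Proof.
move=> /(mpoly_nonzero hK)[v hv]; exists (\row_i v i).
by rewrite /peval (meval_eq (v2 := v)) // => i; rewrite mxE.
Qed.

Lemma mpoly_eq0_open n (V : set (affine_space K n)) (P : mpoly n K) : open V -> V !=set0 ->
  (forall z, V z -> peval P z = 0) -> P = 0.
Proof.
move=> /affine_openP oV [z /oV[R Rz RV]] h; apply/eqP; apply: contrapT => /negP P0.
have R0 : R != 0 by apply: contraNneq Rz => ->; rewrite peval0.
have [y] := peval_nonzero (mulf_neq0 P0 R0).
by rewrite pevalM; case: (boolP (peval R y == 0)) => [/eqP->|/RV/h ->]; rewrite ?mulr0 ?mul0r eqxx.
Qed.

Lemma mpoly_eq_open n (V : set (affine_space K n)) (P Q : mpoly n K) : open V -> V !=set0 ->
  (forall z, V z -> peval P z = peval Q z) -> P = Q.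
Proof.
move=> oV V0 h; apply/eqP; rewrite -subr_eq0; apply/eqP; apply: mpoly_eq0_open oV V0 _ => z Vz.
by rewrite pevalD pevalN h // subrr.
Qed.

Lemma affine_meet n (V W : set (affine_space K n)) : open V -> open W ->
  V !=set0 -> W !=set0 -> V `&` W !=set0.
Proof.
move=> /affine_openP oV /affine_openP oW [x /oV[P Px PV]] [y /oW[Q Qy QW]].
have [|z] := @peval_nonzero _ (P * Q).
  by rewrite mulf_neq0 //; [apply: contraNneq Px => ->|apply: contraNneq Qy => ->]; rewrite peval0.
by rewrite pevalM mulf_eq0 negb_or => /andP[/PV ? /QW ?]; exists z.
Qed.

(** The reduced form of one local expression serves everywhere on [B]: the denominator of any other
    local expression is a multiple of the reduced one, which therefore has no zero in [B]. *)
Lemma regular_global_fraction n (B : set (affine_space K n)) f : open B -> regular B f ->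
  exists P Q, forall z, B z -> peval Q z != 0 /\ f z = peval P z / peval Q z.
Proof.
move=> oB rf; case: (pselect (B !=set0)) => [[z0 Bz0]|B0]; last first.
  by exists 0, 1 => z Bz; case: B0; exists z.
have [P [Q [Qz0 PQ]]] := rf z0 Bz0.
have Q0 : Q != 0 by apply: contraNneq Qz0 => ->; rewrite peval0.
have [P0 [Q1 [Q1_neq0 e h]]] := reduced_fraction P (@ufd_mpoly K n) Q0.
exists P0, Q1 => x Bx; have [P' [Q' [Q'x PQ']]] := rf x Bx.
have E : P' * Q = P * Q'.
  have oD : open (B `&` [set z | peval (Q * Q') z != 0]) by apply: openI => //; apply: open_basic.
  have oBQ : open (B `&` [set z | peval Q z != 0]) by apply: openI => //; apply: open_basic.
  have oBQ' : open (B `&` [set z | peval Q' z != 0]) by apply: openI => //; apply: open_basic.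
  have [||z [[Bz Qz] [_ Q'z]]] := affine_meet oBQ oBQ'; [by exists z0|by exists x|].
  apply: mpoly_eq_open oD _ _; first by exists z; split=> //=; rewrite pevalM mulf_neq0.
  move=> y [By /=]; rewrite !pevalM mulf_eq0 negb_or => /andP[Qy Q'y].
  by have := PQ y By Qy; rewrite PQ' // => /eqP; rewrite eqr_div // => /eqP.
have E' : P' * Q1 = P0 * Q'.
  exact: cross_cancel Q0 E e.
have [c Q'E] := h _ _ E'.
have Q1x : peval Q1 x != 0 by apply: contraNneq Q'x => z; rewrite Q'E pevalM z mulr0.
split=> //; rewrite PQ' //; apply/eqP; rewrite eqr_div //.
by rewrite -!pevalM E'.
Qed.

Lemma regular_agree n (B V : set (affine_space K n)) f g : open B -> open V -> B `&` V !=set0 ->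
  regular B f -> regular B g -> (forall z, B z -> V z -> f z = g z) -> forall z, B z -> f z = g z.
Proof.
move=> oB oV BV rf rg e z Bz; apply/eqP; rewrite -subr_eq0; apply: contrapT => /negP ne.
have nA := nice_affine K n.
have oD := nice_open nA oB (regular_sub_fun nA oB rf rg).
have [|y [[By ney] [_ Vy]]] := affine_meet oD (openI oB oV) _ BV; first by exists z.
by move: ney; rewrite /= e // subrr eqxx.
Qed.

(** The coordinates of an isomorphism of [B] onto a closed [Z] are global fractions, so it extends
    to a map [F] on the locus [D] where no denominator vanishes. As [B] is dense in [D], [F] still
    maps into [Z], and the inverse isomorphism after [F] is the identity of [D]. Hence every point
    of [D] lies in [B]. *)
Theorem affine_open_principal n (B : set (affine_space K n)) : B !=set0 ->
  affine_open B -> exists Q, B = [set z | peval Q z != 0].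
Proof.
move=> B0 [oB [k [Z [cZ [f [g [mf mg fK gK]]]]]]].
have nA d := nice_affine K d.
pose c i : affine_space K n -> K := extend (fun b : restrict B => (set_val (f b) : 'rV[K]_k) 0 i).
have rc i : regular B (c i).
  rewrite -[B]setIT; apply/(regular_extend _ (nA n) oB openT).
  have /(_ setT (fun u => (set_val u : 'rV[K]_k) 0 i) openT) := proj2 mf; apply.
  have := restrict_regular (A := Z) (nA k) openT (@regular_peval K k setT (pvar K i)).
  by congr regular; apply/funext => u /=; rewrite peval_var.
have /choice[P /choice[Q PQ]] : forall i, exists P Q, forall z, B z -> peval Q z != 0 /\ c i z = peval P z / peval Q z.
  by move=> i; apply: regular_global_fraction.
pose D : set (affine_space K n) := [set z | peval (\prod_i Q i) z != 0].
have oD : open D by apply: open_basic.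
have DQ z i : D z -> peval (Q i) z != 0.
  by rewrite /D /= peval_prod => /prodf_neq0/(_ i isT).
have BD z : B z -> D z.
  by move=> Bz; rewrite /D /= peval_prod; apply/prodf_neq0 => i _; case: (PQ i z Bz).
pose F (z : affine_space K n) : affine_space K k := \row_i (peval (P i) z / peval (Q i) z).
have rF i : regular D (fun z => F z 0 i).
  apply: (regular_eq (nA n) oD (f := fun z => peval (P i) z / peval (Q i) z)) => [z _|]; first by rewrite mxE.
  by apply: regular_div => //; [exact: regular_peval|exact: regular_peval|move=> z /DQ].
have FB (b : restrict B) : F (set_val b) = set_val (f b).
  have Bb := set_valP b; apply/rowP => i; rewrite mxE.
  by have [_ <-] := PQ i _ Bb; rewrite /c extendE.
have FZ z : D z -> Z (F z).
  move=> Dz; apply: contrapT => /(affine_closedP cZ)[p pz pZ].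
  have oE := nice_open (nA n) oD (regular_peval_comp (nA n) oD rF p).
  have [|y [[_ /= py] By]] := affine_meet oE oB _ B0; first by exists z.
  move: py; rewrite -[y]/(set_val (SigSub (mem_set By) : restrict B)) FB pZ ?eqxx //.
  exact: set_valP.
pose h l : affine_space K n -> K := extend (fun u : restrict Z => (set_val (g u) : 'rV[K]_n) 0 l) \o F.
have rh l : regular D (h l).
  have rg : regular (setT : set (restrict Z)) (fun u => (set_val (g u) : 'rV[K]_n) 0 l).
    have /(_ setT (fun u => (set_val u : 'rV[K]_n) 0 l) openT) := proj2 mg; apply.
    have := restrict_regular (A := B) (nA n) openT (@regular_peval K n setT (pvar K l)).
    by congr regular; apply/funext => u /=; rewrite peval_var.
  apply: (regular_local (nA n)) => // z Dz.
  have [V [g' [oV Vz rg' e]]] := rg (SigSub (mem_set (FZ z Dz))) I.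
  exists (D `&` F @^-1` V), (g' \o F); split=> //.
  - exact: (preimage_affine_open (nA n)).
  - exact: (preimage_affine_regular (nA n)).
  move=> y [_ Vy] Dy; have := e (SigSub (mem_set (FZ y Dy))) I Vy.
  by rewrite /= => <-; rewrite /h /= -[F y]/(set_val (SigSub (mem_set (FZ y Dy)) : restrict Z)) extendE.
have hB z l : B z -> h l z = z 0 l.
  move=> Bz; rewrite /h /= -[z]/(set_val (SigSub (mem_set Bz) : restrict B)) FB extendE.
  by rewrite fK.
have hD z l : D z -> h l z = z 0 l.
  have DB : D `&` B !=set0 by have [y By] := B0; exists y; split=> //; apply: BD.
  have rl : regular D (fun z => z 0 l).
    apply: (regular_eq (nA n) oD _ (@regular_peval K n D (pvar K l))) => y _.
    exact: peval_var.
  by move=> Dz; apply: (regular_agree oD oB DB (rh l) rl) Dz => y _; apply: hB.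
exists (\prod_i Q i); apply/seteqP; split=> z; first exact: BD.
move=> Dz; suff -> : z = set_val (g (SigSub (mem_set (FZ z Dz)))) by apply: set_valP.
apply/rowP => l; rewrite -hD // /h /= -[F z]/(set_val (SigSub (mem_set (FZ z Dz)) : restrict Z)).
by rewrite extendE.
Qed.

End AffineGeometry.

Section ClosedField.
Variable K : closedFieldType.
Hypothesis hK : [pchar K] =i pred0.

Lemma peval_row n (P : mpoly n K) v : peval P (\row_i v i) = meval v P.
Proof. by apply: meval_eq => i; rewrite mxE. Qed.

Lemma peval_nullstellensatz n (pi F : mpoly n K) : prime_elt pi ->
  (forall z, peval pi z = 0 -> peval F z = 0) -> divides pi F.
Proof.
move=> pp h; apply: hypersurface_nullstellensatz => // v.
by rewrite -!peval_row => /h.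
Qed.

(** A prime factor of [Q] would have no zeros, so by the Nullstellensatz it would divide 1. *)
Lemma nonvanishing_const n (Q : mpoly n K) : (forall z, peval Q z != 0) ->
  exists2 c, c != 0 & Q = mpolyC n c.
Proof.
move=> Qn; suff uQ : Q \is a GRing.unit by have [c c0 e] := mpoly_unit_const uQ; exists c.
have Q0 : Q != 0 by apply: contraNneq (Qn 0) => ->; rewrite peval0.
have [u [s [uu sp QE]]] := ufd_mpoly Q0.
case: s sp QE => [|p s] sp QE; first by rewrite QE big_nil mulr1.
have pp : prime_elt p by apply: sp; rewrite mem_head.
have [_ pN1 _] := pp; case: pN1; apply: peval_nullstellensatz => // z pz.
by have := Qn z; rewrite QE big_cons !pevalM pz mul0r mulr0 eqxx.
Qed.

Lemma regular_polynomial n (f : affine_space K n -> K) : regular setT f ->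
  exists P, forall z, f z = peval P z.
Proof.
move=> rf; have [P [Q h]] := regular_global_fraction hK openT rf.
have [|c c0 QE] := @nonvanishing_const n Q; first by move=> z; case: (h z I).
exists (mpolyC n c^-1 * P) => z; have [_ ->] := h z I.
by rewrite QE pevalM !pevalC mulrC.
Qed.

End ClosedField.

(** * Gradings and torus actions *)

Section Variables.
Variable K : closedFieldType.
Hypothesis hK : [pchar K] =i pred0.

Lemma pvar_neq0 n (j : 'I_n) : pvar K j != 0.
Proof.
apply: (contra_neq (z1 := 1) (z2 := 0 : K)) (oner_neq0 K) => e.
by rewrite -(peval0 (const_mx 1 : 'rV[K]_n)) -e peval_var mxE.
Qed.

Definition kill_var n (j : 'I_n) : mpoly n K -> mpoly n K :=
  mmap (@mpolyC n K) (fun i => if i == j then 0 else pvar K i).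

Lemma kill_var_sub n (j : 'I_n) P : divides (pvar K j) (P - kill_var j P).
Proof.
have mono m : divides (pvar K j) (mpolyX K m - kill_var j (mpolyX K m)).
  rewrite /kill_var mmapX /mmap1 mpolyXE_id.
  elim/big_rec2: _ => [|i x y _ [c e]]; first by exists 0; rewrite subrr mul0r.
  case: eqP => [->|_].
    case: (m j) => [|k]; first by exists c; rewrite !expr0 !mul1r.
    exists (pvar K j ^+ k * y); rewrite expr0n mul0r subr0.
    by rewrite -/(pvar K j) exprSr mulrAC.
  by exists (pvar K i ^+ m i * c); rewrite -mulrBr e mulrA.
have -> : kill_var j P = \sum_(m <- msupp P) kill_var j (mcoeff m P *: mpolyX K m).
  by rewrite {1}(mpolyE P) /kill_var raddf_sum.
rewrite {1}(mpolyE P) -sumrB; apply: divides_sum => m _.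
by rewrite /kill_var mmapZ mul_mpolyC -scalerBr -mul_mpolyC; apply/divides_mull/mono.
Qed.

Lemma divides_pvar n (j : 'I_n) P : divides (pvar K j) P <-> kill_var j P = 0.
Proof.
split=> [[c ->]|e]; last by have := kill_var_sub j P; rewrite e subr0.
rewrite /kill_var (rmorphM (mmap (@mpolyC n K) (fun i => if i == j then 0 else pvar K i))).
by rewrite [X in _ * X]mmapX mmap1U eqxx mulr0.
Qed.

Lemma prime_pvar n (j : 'I_n) : prime_elt (pvar K j).
Proof.
split; first exact: pvar_neq0.
  move=> [c e]; have := congr1 (fun P => peval P (0 : 'rV[K]_n)) e.
  by rewrite peval1 pevalM peval_var mxE mulr0 => /eqP; rewrite oner_eq0.
move=> a b /divides_pvar; rewrite /kill_var rmorphM => /eqP; rewrite mulf_eq0.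
by move=> /orP[] /eqP e; [left|right]; apply/divides_pvar.
Qed.

(** A prime factor of [F] vanishes only where some coordinate does, so it divides the product of the
    variables and is a variable up to a constant. *)
Lemma torus_nonvanishing_monomial r (F : mpoly r K) :
  (forall t, torus t -> peval F t != 0) -> exists c m, F = c *: mpolyX K m.
Proof.
move=> Fn; have t1 : torus (const_mx 1 : 'rV[K]_r) by move=> j; rewrite mxE oner_neq0.
have F0 : F != 0 by apply: contraNneq (Fn _ t1) => ->; rewrite peval0.
have [u [s [/mpoly_unit_const[c c0 ->] sp FE]]] := ufd_mpoly F0.
have {}sp q : q \in s -> exists c m, q = c *: mpolyX K m.
  move=> qs; have pq := sp q qs.
  have : divides q (\prod_j pvar K j).
    apply: peval_nullstellensatz => // z qz; rewrite peval_prod.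
    apply/eqP; apply: contrapT => /negP/prodf_neq0 h.
    have /Fn/negP[] : torus z by move=> j; have := h j isT; rewrite peval_var.
    by rewrite FE (big_rem q) //= !pevalM qz mul0r mulr0.
  rewrite -(big_map (fun j => pvar K j) xpredT idfun) => /(prime_divides_prod pq)[x].
  move=> /mapP[j _ ->] /(prime_assoc pq (prime_pvar j))[v /mpoly_unit_const[d d0 ->] e].
  exists d^-1, (mnm1 j); rewrite -[mpolyX _ _]/(pvar K j) e mul_mpolyC scalerA.
  by rewrite mulVf // scale1r.
rewrite {}FE; elim: s sp => [|q s IH] sp.
  by exists c, mnm0; rewrite big_nil mulr1 mpolyX0 -mul_mpolyC mulr1.
have [|d [m e]] := IH; first by move=> x xs; apply: sp; rewrite inE xs orbT.
have [d' [m' ->]] := sp q (mem_head _ _).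
exists (d' * d), (mnm_add m' m); rewrite big_cons mulrCA e.
by rewrite -scalerAl -scalerAr scalerA mpolyXD.
Qed.

End Variables.

Section Gradings.
Variables (K : closedFieldType).
Hypothesis hK : [pchar K] =i pred0.

(** The character of weight [a] of the torus. *)
Definition tpow r (t : 'rV[K]_r) (a : 'rV[int]_r) : K := \prod_j t 0 j ^ a 0 j.

Lemma tpowD r (t : 'rV[K]_r) a b : torus t -> tpow t (a + b) = tpow t a * tpow t b.
Proof.
by move=> ht; rewrite -big_split; apply: eq_bigr => j _; rewrite mxE expfzDr // ht.
Qed.

Lemma tpow0 r (t : 'rV[K]_r) : tpow t 0 = 1.
Proof. by apply: big1 => j _; rewrite mxE expr0z. Qed.

Lemma tpow_neq0 r (t : 'rV[K]_r) a : torus t -> tpow t a != 0.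
Proof. by move=> ht; apply/prodf_neq0 => j _; apply/expfz_neq0/ht. Qed.

Lemma tpowN r (t : 'rV[K]_r) a : torus t -> tpow t (- a) = (tpow t a)^-1.
Proof.
move=> ht; apply: (mulfI (tpow_neq0 a ht)).
by rewrite -tpowD // subrr tpow0 divff // tpow_neq0.
Qed.

Lemma tpowMn r (t : 'rV[K]_r) a k : torus t -> tpow t (a *+ k) = tpow t a ^+ k.
Proof.
by move=> ht; elim: k => [|k IH]; rewrite ?mulr0n ?tpow0 ?expr0 // mulrS tpowD // IH exprS.
Qed.

Lemma tpow_sum r (t : 'rV[K]_r) I (s : seq I) (p : pred I) (F : I -> 'rV[int]_r) : torus t ->
  tpow t (\sum_(i <- s | p i) F i) = \prod_(i <- s | p i) tpow t (F i).
Proof. by move=> ht; elim/big_rec2: _ => [|i x y _ <-]; rewrite ?tpow0 ?tpowD. Qed.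

(** Characters become distinct monomials after multiplication by a common one. The shift is the sum
    of the absolute values of all exponents in [S], which makes each of them nonnegative. *)
Lemma laurent_polynomial r (S : seq 'rV[int]_r) : exists mu : 'rV[int]_r -> multinom r,
  {in S &, injective mu} /\ exists N : 'rV[int]_r,
  forall a t, a \in S -> torus t -> peval (mpolyX K (mu a)) t = tpow t N * tpow t a.
Proof.
pose N := (\sum_(a <- S) \sum_j absz (a 0%R j))%N.
have aN a j : a \in S -> 0 <= a 0 j + N%:Z.
  move=> aS; have : (absz (a 0%R j) <= N)%N.
    rewrite /N (big_rem a) //= (bigD1 j) //=.
    by rewrite -addnA leq_addr.
  by lia.
exists (fun a => Multinom [tuple absz (a 0 j + N%:Z) | j < r]); split=> [a b aS bS /mnmP e|].
  apply/rowP => j; have := e j; rewrite !mnmE => /(congr1 Posz).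
  by rewrite !gez0_abs ?aN // => /addIr.
exists (const_mx N%:Z) => a t aS ht.
rewrite -tpowD // /peval mevalX; apply: eq_bigr => j _.
by rewrite mnmE !mxE -[in RHS]addrC -[in RHS](gez0_abs (aN a j aS)).
Qed.

Lemma laurent_independent r (S : seq 'rV[int]_r) (c : 'rV[int]_r -> K) : uniq S ->
  (forall t : 'rV[K]_r, torus t -> \sum_(a <- S) c a * tpow t a = 0) ->
  forall a, a \in S -> c a = 0.
Proof.
move=> uS h a aS; have [mu [muI [N muE]]] := laurent_polynomial S.
pose F : mpoly r K := \sum_(b <- S) c b *: mpolyX K (mu b).
have F0 : F = 0.
  have oT : open ([set t | peval (\prod_j pvar K j) t != 0] : set (affine_space K r)) by apply: open_basic.
  apply: (mpoly_eq0_open hK oT) => [|t /=].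
    exists (const_mx 1); rewrite /= peval_prod; apply/prodf_neq0 => j _.
    by rewrite peval_var mxE oner_neq0.
  rewrite peval_prod => /prodf_neq0 ht; have {}ht : torus t by move=> j; have := ht j isT; rewrite peval_var.
  rewrite peval_sum big_seq (eq_bigr (fun b => tpow t N * (c b * tpow t b))).
    by rewrite -big_seq -big_distrr /= h // mulr0.
  by move=> b bS; rewrite -mul_mpolyC pevalM pevalC muE // mulrCA.
have := congr1 (mcoeff (mu a)) F0; rewrite mcoeff0 /F raddf_sum /= (bigD1_seq a) //=.
rewrite mcoeffZ mcoeffX eqxx mulr1 big_seq_cond big1 ?addr0 // => b /andP[bS ba].
rewrite mcoeffZ mcoeffX; case: eqP => [/muI e|]; last by rewrite mulr0.
by move: ba; rewrite e ?eqxx.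
Qed.

Lemma laurent_nonvanishing r (S : seq 'rV[int]_r) (c : 'rV[int]_r -> K) : uniq S ->
  (forall t : 'rV[K]_r, torus t -> \sum_(a <- S) c a * tpow t a != 0) ->
  exists2 a, a \in S & forall b, b \in S -> b != a -> c b = 0.
Proof.
move=> uS h; have [mu [muI [N muE]]] := laurent_polynomial S.
pose F : mpoly r K := \sum_(b <- S) c b *: mpolyX K (mu b).
have FE t : torus t -> peval F t = tpow t N * \sum_(a <- S) c a * tpow t a.
  move=> ht; rewrite peval_sum big_distrr /= big_seq [RHS]big_seq; apply: eq_bigr => b bS.
  by rewrite -mul_mpolyC pevalM pevalC muE // mulrCA.
have [t ht|d [m FE']] := @torus_nonvanishing_monomial K hK r F.
  by rewrite FE // mulf_neq0 ?h // tpow_neq0.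
have cE a : a \in S -> c a = d * (m == mu a)%:R.
  move=> aS; have := congr1 (mcoeff (mu a)) FE'; rewrite mcoeffZ mcoeffX /F raddf_sum /= (bigD1_seq a) //=.
  rewrite mcoeffZ mcoeffX eqxx mulr1 big_seq_cond big1 ?addr0 // => b /andP[bS ba].
  rewrite mcoeffZ mcoeffX; case: eqP => [/muI e|]; last by rewrite mulr0.
  by move: ba; rewrite e ?eqxx.
have [a aS ma] : exists2 a, a \in S & m = mu a.
  apply: contrapT => nex; have t1 : torus (const_mx 1 : 'rV[K]_r) by move=> j; rewrite mxE oner_neq0.
  have /negP[] := h _ t1; rewrite big_seq big1 // => a aS.
  by rewrite cE //; case: eqP => [e|_]; [case: nex; exists a|rewrite mulr0 mul0r].
exists a => // b bS ba; rewrite cE // ma; case: eqP => [/muI e|]; last by rewrite mulr0.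
by move: ba; rewrite e ?eqxx.
Qed.

Variables (n r : nat) (w : 'I_n -> 'rV[int]_r).
Implicit Types (P Q : mpoly n K) (a b : 'rV[int]_r) (t : 'rV[K]_r) (z : affine_space K n).

Definition wdeg (m : multinom n) : 'rV[int]_r := \sum_i w i *+ m i.

Definition hcomp a P : mpoly n K := \sum_(m <- msupp P | wdeg m == a) mcoeff m P *: mpolyX K m.

Definition degs P := undup [seq wdeg m | m <- msupp P].

Local Notation act := (grading_action (K := K) w).

Lemma peval_mono m z : peval (mpolyX K m) z = \prod_i z 0 i ^+ m i.
Proof. exact: mevalX. Qed.

Lemma peval_mono_act m t z : torus t ->
  peval (mpolyX K m) (act t z) = tpow t (wdeg m) * peval (mpolyX K m) z.
Proof.
move=> ht; rewrite !peval_mono tpow_sum // -big_split; apply: eq_bigr => i _.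
by rewrite mxE exprMn tpowMn.
Qed.

Lemma whomog_act a P t z : torus t -> whomog w a P -> peval P (act t z) = tpow t a * peval P z.
Proof.
move=> ht hP; rewrite (mpolyE P) !peval_sum big_distrr /= big_seq [RHS]big_seq.
apply: eq_bigr => m mP; rewrite -mul_mpolyC !pevalM peval_mono_act // !pevalC.
by rewrite (hP m mP : wdeg m = a) mulrCA.
Qed.

Lemma mcoeff_hcomp a P m : mcoeff m (hcomp a P) = if wdeg m == a then mcoeff m P else 0.
Proof.
rewrite /hcomp raddf_sum /=.
have [mP|mP] := boolP (m \in msupp P); last first.
  rewrite big_seq_cond big1 ?(memN_msupp_eq0 mP) ?if_same // => m' /andP[m'P _].
  rewrite mcoeffZ mcoeffX; case: eqP => [e|]; last by rewrite mulr0.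
  by move: mP; rewrite -e m'P.
case: ifPn => am.
  rewrite big_mkcond (bigD1_seq m) ?msupp_uniq //= am mcoeffZ mcoeffX eqxx mulr1.
  rewrite big1 ?addr0 // => m' /negbTE mm.
  by rewrite mcoeffZ mcoeffX mm mulr0 if_same.
rewrite big1 // => m' am'; rewrite mcoeffZ mcoeffX; case: eqP => [e|]; last by rewrite mulr0.
by move: am; rewrite -e am'.
Qed.

Lemma hcomp_whomog a P : whomog w a (hcomp a P).
Proof.
move=> m; rewrite mcoeff_msupp mcoeff_hcomp; by case: (wdeg m =P a) => // _; rewrite eqxx.
Qed.

Lemma whomog_hcomp a P : whomog w a P -> hcomp a P = P.
Proof.
move=> hP; apply/mpolyP => m; rewrite mcoeff_hcomp; case: eqP => // ne.
by rewrite memN_msupp_eq0 //; apply/negP => /hP.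
Qed.

Lemma whomog_hcomp_neq a b P : whomog w a P -> b != a -> hcomp b P = 0.
Proof.
move=> hP ba; apply/mpolyP => m; rewrite mcoeff_hcomp mcoeff0; case: eqP => // e.
by apply: memN_msupp_eq0; apply/negP => /hP e'; move: ba; rewrite -e -e' eqxx.
Qed.

Lemma hcomp_notin a P : a \notin degs P -> hcomp a P = 0.
Proof.
move=> na; apply/mpolyP => m; rewrite mcoeff_hcomp mcoeff0; case: eqP => // e.
apply: memN_msupp_eq0; apply: contra na => mP; rewrite mem_undup; apply/mapP.
by exists m.
Qed.

Lemma hcomp_sum (S : seq 'rV[int]_r) P : uniq S -> {subset degs P <= S} ->
  P = \sum_(a <- S) hcomp a P.
Proof.
move=> uS sS; apply/mpolyP => m; rewrite raddf_sum /=.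
have [mP|mP] := boolP (m \in msupp P); last first.
  by rewrite memN_msupp_eq0 // big1 // => a _; rewrite mcoeff_hcomp (memN_msupp_eq0 mP) if_same.
rewrite (bigD1_seq (wdeg m)) //=; last by apply: sS; rewrite mem_undup map_f.
rewrite mcoeff_hcomp eqxx big1 ?addr0 // => a /negbTE ne.
by rewrite mcoeff_hcomp eq_sym ne.
Qed.

(** Along a torus orbit [P] is a Laurent polynomial in [t] whose coefficients are the values of its
    homogeneous components at [z]. *)
Lemma peval_act (S : seq 'rV[int]_r) P t z : torus t -> uniq S -> {subset degs P <= S} ->
  peval P (act t z) = \sum_(a <- S) peval (hcomp a P) z * tpow t a.
Proof.
move=> ht uS sS; rewrite {1}(hcomp_sum uS sS) peval_sum; apply: eq_bigr => a _.
by rewrite (whomog_act _ ht (@hcomp_whomog a P)) mulrC.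
Qed.

Lemma peval_act_zero P z : (forall t, torus t -> peval P (act t z) = 0) ->
  forall a, peval (hcomp a P) z = 0.
Proof.
move=> h a; have [ad|/hcomp_notin->] := boolP (a \in degs P); last by rewrite peval0.
apply: (laurent_independent (undup_uniq _) _ ad (c := fun a => peval (hcomp a P) z)) => t ht.
by rewrite -(peval_act _ ht (undup_uniq _)) ?h.
Qed.

Definition invariant_set (O : set (affine_space K n)) := forall t z, torus t -> O z -> O (act t z).

Lemma torus1 : torus (const_mx 1 : 'rV[K]_r).
Proof. by move=> j; rewrite mxE oner_neq0. Qed.

Lemma tpow1 a : tpow (const_mx 1 : 'rV[K]_r) a = 1.
Proof. by apply: big1 => j _; rewrite mxE exp1rz. Qed.

Lemma act1 z : act (const_mx 1) z = z.
Proof. by apply/rowP => i; rewrite mxE -/(tpow _ _) tpow1 mul1r. Qed.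

(** Converse of [whomog_act], from the independence of characters. Closure properties of forms
    thereby reduce to identities between values. *)
Lemma whomogP a P : (forall t z, torus t -> peval P (act t z) = tpow t a * peval P z) -> whomog w a P.
Proof.
move=> h; suff -> : P = hcomp a P by apply: hcomp_whomog.
pose S := undup (a :: degs P).
have sS : {subset degs P <= S} by move=> b bd; rewrite mem_undup inE bd orbT.
have uS : uniq S by apply: undup_uniq.
have aS : a \in S by rewrite mem_undup mem_head.
have z0 b : b \in S -> b != a -> hcomp b P = 0.
  move=> bS ba; apply: (mpoly_eq0_open hK openT) => [|z _]; first by exists 0.
  suff /(_ b bS) : forall c, c \in S -> peval (hcomp c P) z - (c == a)%:R * peval P z = 0.
    by rewrite (negbTE ba) mul0r subr0.
  apply: laurent_independent => // t ht.
  under eq_bigr do rewrite mulrBl; rewrite sumrB -(peval_act _ ht uS sS) h //.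
  rewrite (bigD1_seq a) //= eqxx mul1r big1 => [|c /negbTE ->]; last by rewrite !mul0r.
  by rewrite addr0 mulrC subrr.
rewrite {1}(hcomp_sum uS sS) (bigD1_seq a) //= big_seq_cond big1 ?addr0 // => b /andP[bS ba].
exact: z0.
Qed.

End Gradings.

Section Homogeneous.
Variables (K : closedFieldType).
Hypothesis hK : [pchar K] =i pred0.
Variables (n r : nat) (w : 'I_n -> 'rV[int]_r).
Implicit Types (P Q : mpoly n K) (a b : 'rV[int]_r) (t : 'rV[K]_r) (z : affine_space K n).

Local Notation act := (grading_action (K := K) w).
Local Notation hom := (whomog (K := K) w).

Lemma act_mul s t z : torus s -> torus t -> act (torus_mul s t) z = act s (act t z).
Proof.
move=> hs ht; apply/rowP => i; rewrite !mxE mulrA; congr (_ * _).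
by rewrite -big_split; apply: eq_bigr => j _; rewrite mxE expfzMl.
Qed.

Lemma torus_mulP d (s t : 'rV[K]_d) : torus s -> torus t -> torus (torus_mul s t).
Proof. by move=> hs ht j; rewrite mxE mulf_neq0. Qed.

Definition torus_inv d (t : 'rV[K]_d) : 'rV[K]_d := \row_j (t 0 j)^-1.

Lemma torus_invP d (t : 'rV[K]_d) : torus t -> torus (torus_inv t).
Proof. by move=> ht j; rewrite mxE invr_eq0. Qed.

Lemma torus_mulV d (t : 'rV[K]_d) : torus t -> torus_mul (torus_inv t) t = const_mx 1.
Proof. by move=> ht; apply/rowP => j; rewrite !mxE mulVf. Qed.

Lemma actK t z : torus t -> act (torus_inv t) (act t z) = z.
Proof. by move=> ht; rewrite -act_mul ?torus_mulV ?act1 //; apply: torus_invP. Qed.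

Lemma whomogM a b P Q : hom a P -> hom b Q -> hom (a + b) (P * Q).
Proof.
move=> hP hQ; apply: whomogP => // t z ht; rewrite !pevalM !(whomog_act _ ht hP, whomog_act _ ht hQ).
by rewrite tpowD // mulrACA.
Qed.

Lemma whomogD a P Q : hom a P -> hom a Q -> hom a (P + Q).
Proof.
move=> hP hQ; apply: whomogP => // t z ht; rewrite !pevalD !(whomog_act _ ht hP, whomog_act _ ht hQ).
by rewrite mulrDr.
Qed.

Lemma whomogC c : hom 0 (mpolyC n c).
Proof. by apply: whomogP => // t z ht; rewrite !pevalC tpow0 mul1r. Qed.

Lemma whomog1 : hom 0 1.
Proof. by apply: whomogP => // t z ht; rewrite !peval1 tpow0 mul1r. Qed.

Lemma whomog0 a : hom a 0.
Proof. by apply: whomogP => // t z ht; rewrite !peval0 mulr0. Qed.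

Lemma whomogX a k P : hom a P -> hom (a *+ k) (P ^+ k).
Proof.
move=> hP; elim: k => [|k IH]; rewrite ?mulr0n ?expr0; first exact: whomog1.
by rewrite mulrS exprS; apply: whomogM.
Qed.

Lemma whomogZ a c P : hom a P -> hom a (c *: P).
Proof. by rewrite -mul_mpolyC -{2}(add0r a); apply/whomogM/whomogC. Qed.

Lemma whomog_var i : hom (w i) (pvar K i).
Proof. by apply: whomogP => // t z ht; rewrite !peval_var mxE. Qed.

Lemma whomog_prod I (s : seq I) (p : pred I) (d : I -> 'rV[int]_r) (F : I -> mpoly n K) :
  (forall i, p i -> hom (d i) (F i)) ->
  hom (\sum_(i <- s | p i) d i) (\prod_(i <- s | p i) F i).
Proof.
by move=> h; elim/big_rec2: _ => [|i x y pi hy]; [exact: whomog1|apply: whomogM => //; exact: h].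
Qed.

Lemma whomog_uniq a b P : P != 0 -> hom a P -> hom b P -> a = b.
Proof.
move=> P0 ha hb; apply/eqP; apply: contraNT P0 => ab.
by rewrite -(whomog_hcomp hb) (whomog_hcomp_neq ha) // eq_sym.
Qed.

(* On a point of E, Q restricts to the torus orbit as a nowhere vanishing
   Laurent polynomial, that is, as a monomial. *)
Lemma nonvanishing_whomog (E : set (affine_space K n)) Q : open E -> E !=set0 ->
  invariant_set w E -> (forall z, E z -> peval Q z != 0) -> exists a, hom a Q.
Proof.
move=> oE E0 iE Qn.
have one z : E z -> exists2 a, a \in degs w Q & forall b, b \in degs w Q -> b != a -> peval (hcomp w b Q) z = 0.
  move=> Ez; apply: (laurent_nonvanishing hK (undup_uniq _) (c := fun a => peval (hcomp w a Q) z)) => t ht.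
  by rewrite -(peval_act _ ht (undup_uniq _)) // Qn //; apply: iE.
have [z0 Ez0] := E0; have [a ad az0] := one z0 Ez0.
have Qa : peval (hcomp w a Q) z0 != 0.
  have := Qn _ Ez0; rewrite {1}(hcomp_sum (undup_uniq _) (fun x h => h : x \in degs w Q)).
  rewrite peval_sum (bigD1_seq a) ?undup_uniq //= big_seq_cond big1 ?addr0 // => b /andP[bd ba].
  exact: az0.
exists a; suff -> : Q = hcomp w a Q by apply: hcomp_whomog.
rewrite {1}(hcomp_sum (undup_uniq _) (fun x h => h : x \in degs w Q)).
rewrite (bigD1_seq a) ?undup_uniq //= big_seq_cond big1 ?addr0 // => b /andP[bd ba].
apply/eqP; apply: contrapT => /negP Qb.
have oa := openI oE (open_basic (hcomp w a Q)).
have [y Qby] := peval_nonzero hK Qb.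
have ob := open_basic (hcomp w b Q).
have [||z [[Ez /= Qaz] /= Qbz]] := affine_meet hK oa ob; [by exists z0|by exists y|].
have [c cd cz] := one z Ez; have [ca|ca] := eqVneq c a.
  by move: Qbz; rewrite cz ?eqxx // ca.
by move: Qaz; rewrite cz ?eqxx // eq_sym.
Qed.

(** The locus where the product does not vanish is invariant, and [P] has no zero there. *)
Lemma whomog_factor a P Q : hom a (P * Q) -> P * Q != 0 -> exists b, hom b P.
Proof.
move=> hPQ PQ0; apply: (nonvanishing_whomog (open_basic (P * Q))).
- by have [z] := peval_nonzero hK PQ0; exists z.
- by move=> t z ht /= Pz; rewrite (whomog_act _ ht hPQ) mulf_neq0 ?tpow_neq0.
by move=> z /=; rewrite pevalM mulf_eq0 negb_or => /andP[].
Qed.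

Lemma whomog_cancel a b P Q : hom (a + b) (P * Q) -> hom b Q -> Q != 0 -> hom a P.
Proof.
move=> hPQ hQ Q0; have [->|P0] := eqVneq P 0; first exact: whomog0.
have PQ0 := mulf_neq0 P0 Q0; have [c hc] := whomog_factor hPQ PQ0.
by have /addIr -> := whomog_uniq PQ0 hPQ (whomogM hc hQ).
Qed.

(** Some homogeneous component of a polynomial separating [z] from the complement of [O] is nonzero
    at [z]. It vanishes outside [O], since there the polynomial vanishes on whole orbits. *)
Lemma invariant_open_basic (O : set (affine_space K n)) z : open O -> invariant_set w O -> O z ->
  exists a F, [/\ hom a F, peval F z != 0 & forall y, peval F y != 0 -> O y].
Proof.
move=> /affine_openP oO iO /oO[P Pz PO].
have [a Paz] : exists a, peval (hcomp w a P) z != 0.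
  apply: contrapT => h; move: Pz; rewrite (hcomp_sum (undup_uniq _) (fun x h => h : x \in degs w P)).
  rewrite peval_sum big1 ?eqxx // => a _; apply/eqP; apply: contrapT => /negP Pa.
  by apply: h; exists a.
exists a, (hcomp w a P); split=> //; first exact: hcomp_whomog.
move=> y Pay; apply: contrapT => nOy; move: Pay; rewrite (peval_act_zero hK (P := P)) ?eqxx // => t ht.
apply/eqP; apply: contrapT => /negP/PO Oty; apply: nOy.
by rewrite -(actK y ht); apply: iO => //; apply: torus_invP.
Qed.

(** The denominator of the global fraction has no zero in [O], hence is homogeneous; semi-invariance
    then forces the degree of the numerator. *)
Lemma semi_invariant_fraction (O : set (affine_space K n)) f b : open O -> O !=set0 ->
  invariant_set w O -> regular O f -> (forall t z, torus t -> O z -> f (act t z) = tpow t b * f z) ->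
  exists a P Q, [/\ hom (a + b) P, hom a Q &
    forall z, O z -> peval Q z != 0 /\ f z = peval P z / peval Q z].
Proof.
move=> oO O0 iO rf fE; have [P [Q PQ]] := regular_global_fraction hK oO rf.
have [a hQ] : exists a, hom a Q.
  by apply: (nonvanishing_whomog oO O0 iO) => z /PQ[].
exists a, P, Q; split=> //; apply: whomogP => // t z ht.
suff e : forall y, O y -> peval P (act t y) = tpow t (a + b) * peval P y.
  pose PT := \sum_(c <- degs w P) tpow t c *: hcomp w c P.
  have PTE y : peval P (act t y) = peval PT y.
    rewrite (peval_act _ ht (undup_uniq _) (fun x h => h : x \in degs w P)) peval_sum.
    by apply: eq_bigr => c _; rewrite -mul_mpolyC pevalM pevalC mulrC.
  have := mpoly_eq_open hK oO O0 (P := PT) (Q := tpow t (a + b) *: P).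
  rewrite PTE => ->; first by rewrite -mul_mpolyC pevalM pevalC.
  by move=> y Oy; rewrite -PTE e // -mul_mpolyC pevalM pevalC.
move=> y Oy; have [Qy fy] := PQ y Oy; have [Qty fty] := PQ _ (iO t y ht Oy).
move: fty; rewrite fE // fy (whomog_act _ ht hQ) tpowD // => e.
have ta0 := tpow_neq0 a ht.
have : peval P (act t y) = tpow t b * (peval P y / peval Q y) * (tpow t a * peval Q y).
  by rewrite e divfK // mulf_neq0.
by move=> ->; field.
Qed.

End Homogeneous.

(** * Quotients of open subsets of affine space by a torus *)

Section Presentations.
Variables (K : closedFieldType).
Hypothesis hK : [pchar K] =i pred0.

(* A model of the Cox quotient [pi : U -> X]; values of [pi] outside [U] are
   irrelevant. *)
Record presentation (X : kspace K) n r (w : 'I_n -> 'rV[int]_r)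
    (U : set (affine_space K n)) (pi : affine_space K n -> X) : Prop := Presentation {
  pr_open : open U;
  pr_inv : invariant_set w U;
  pr_cont : forall O, open O -> open (U `&` pi @^-1` O);
  pr_reg : forall O f, open O -> regular O f -> regular (U `&` pi @^-1` O) (f \o pi);
  pr_sec : forall x, exists V (s : X -> affine_space K n), [/\ open V, V x,
    forall i, regular V (fun y => s y 0 i) & forall y, V y -> U (s y) /\ pi (s y) = y];
  pr_fib : forall z z', U z -> U z' ->
    (pi z = pi z' <-> exists2 t, torus t & z' = grading_action w t z) }.

Variables (X : kspace K) (nX : nice X) (n r : nat) (w : 'I_n -> 'rV[int]_r).
Variables (U : set (affine_space K n)) (pi : affine_space K n -> X).
Hypothesis pr : presentation w U pi.

Local Notation act := (grading_action (K := K) w).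
Local Notation hom := (whomog (K := K) w).

Lemma pr_act t z : torus t -> U z -> pi (act t z) = pi z.
Proof.
move=> ht Uz; apply/esym/(pr_fib pr) => //; first exact: (pr_inv pr).
by exists t.
Qed.

Lemma pr_surj x : exists2 z, U z & pi z = x.
Proof. by have [V [s [_ Vx _ /(_ x Vx)[]]]] := pr_sec pr x; exists (s x). Qed.

Lemma pr_quotient_open O : open (U `&` pi @^-1` O) -> open O.
Proof.
move=> oO; apply: open_local => x Ox; have [V [s [oV Vx rs sE]]] := pr_sec pr x.
exists (V `&` s @^-1` (U `&` pi @^-1` O)); split.
- exact: preimage_affine_open.
- by have [Us sx] := sE x Vx; split=> //; split=> //=; rewrite sx.
by move=> y [Vy [_ /=]]; case: (sE y Vy) => _ ->.
Qed.

(** Locally [f] is its own pullback composed with a regular section; [pr_quotient_open] uses the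
    sections in the same way for open sets. *)
Lemma pr_quotient_regular O f : open O -> regular (U `&` pi @^-1` O) (f \o pi) -> regular O f.
Proof.
move=> oO rf; apply: (regular_local nX) => // x Ox; have [V [s [oV Vx rs sE]]] := pr_sec pr x.
have oUO := pr_cont pr oO.
exists (V `&` s @^-1` (U `&` pi @^-1` O)), ((f \o pi) \o s); split.
- exact: preimage_affine_open.
- by have [Us sx] := sE x Vx; split=> //; split=> //=; rewrite sx.
- exact: preimage_affine_regular.
by move=> y [Vy _] Oy /=; case: (sE y Vy) => _ ->.
Qed.

Lemma pr_saturated (O : set (affine_space K n)) : invariant_set w O -> O `<=` U ->
  U `&` pi @^-1` (pi @` O) = O.
Proof.
move=> iO OU; apply/seteqP; split=> [z [Uz [y Oy /(pr_fib pr (OU _ Oy) Uz)[t ht ->]]]|z Oz].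
  exact: iO.
by split; [exact: OU|exists z].
Qed.

Lemma pr_image_open (O : set (affine_space K n)) : open O -> invariant_set w O -> O `<=` U -> open (pi @` O).
Proof. by move=> oO iO OU; apply: pr_quotient_open; rewrite pr_saturated. Qed.

Lemma pr_pullback_inv O : invariant_set w (U `&` pi @^-1` O).
Proof. by move=> t z ht [Uz Oz]; split; [exact: (pr_inv pr)|rewrite /= pr_act]. Qed.

Lemma pr_regular_fraction O f : open O -> O !=set0 -> regular O f ->
  exists a P Q, [/\ hom a P, hom a Q &
    forall z, U z -> O (pi z) -> peval Q z != 0 /\ f (pi z) = peval P z / peval Q z].
Proof.
move=> oO [x Ox] rf; have [z Uz zx] := pr_surj x.
have := semi_invariant_fraction hK (b := 0) (pr_cont pr oO) _ (@pr_pullback_inv O) (pr_reg pr oO rf).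
case=> [|t y ht [Uy Oy]|a [P [Q [hP hQ PQ]]]]; first by exists z; split=> //=; rewrite zx.
  by rewrite tpow0 mul1r /= pr_act.
by exists a, P, Q; split=> //; [rewrite -(addr0 a)|move=> y Uy Oy; apply: PQ].
Qed.

(** A set-theoretic section of [pi], neither continuous nor canonical: vanishing of forms and
    quotients of forms of equal degree do not depend on the choice. *)
Definition lift x : affine_space K n := xget 0 [set z | U z /\ pi z = x].

Lemma liftP x : U (lift x) /\ pi (lift x) = x.
Proof.
have [z Uz zx] := pr_surj x.
have h : exists y, [set y | U y /\ pi y = x] y by exists z.
exact: (xgetPex 0 h).
Qed.

Definition zset (F : mpoly n K) : set X := [set x | peval F (lift x) = 0].

Lemma lift_pi z : U z -> exists2 t, torus t & lift (pi z) = act t z.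
Proof. by move=> Uz; have [Ul e] := liftP (pi z); apply/(pr_fib pr). Qed.

Lemma zset_pi a F z : hom a F -> U z -> zset F (pi z) <-> peval F z = 0.
Proof.
move=> hF /lift_pi[t ht e]; rewrite /zset /= e (whomog_act _ ht hF).
split=> [/eqP|->]; last by rewrite mulr0.
by rewrite mulf_eq0 (negbTE (tpow_neq0 _ ht)) => /eqP.
Qed.

(* Independent of the chosen lift when [P] and [Q] are forms of equal degree. *)
Definition form_frac P Q x : K := peval P (lift x) / peval Q (lift x).

Lemma form_frac_pi a P Q z : hom a P -> hom a Q -> U z -> form_frac P Q (pi z) = peval P z / peval Q z.
Proof.
move=> hP hQ /lift_pi[t ht e]; rewrite /form_frac e !(whomog_act _ ht hP, whomog_act _ ht hQ).
by rewrite invfM mulrACA divff ?mul1r // tpow_neq0.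
Qed.

Lemma open_zset a F : hom a F -> open (~` zset F).
Proof.
move=> hF; apply: pr_quotient_open.
have := openI (pr_open pr) (open_basic F); congr open; apply/seteqP; split=> z [Uz /= Fz]; split=> //=.
  by move/(zset_pi hF Uz)/eqP; apply/negP.
by apply/eqP => /(zset_pi hF Uz).
Qed.

Lemma closed_zset a F : hom a F -> closed (zset F).
Proof. by move=> hF; rewrite -[zset F]setCK; apply/open_closedC/(open_zset hF). Qed.

Lemma regular_frac a P Q : hom a P -> hom a Q -> regular (~` zset Q) (form_frac P Q).
Proof.
move=> hP hQ; have oQ := open_zset hQ; apply: pr_quotient_regular => //.
have nA := nice_affine K n; have oUQ := pr_cont pr oQ.
apply: (regular_eq nA oUQ (f := fun z => peval P z / peval Q z)) => [z [Uz Qz]|].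
  by rewrite /= (form_frac_pi hP hQ).
apply: regular_div => //; [exact: regular_peval..|].
by move=> z [Uz Qz]; apply/eqP => /(zset_pi hQ Uz).
Qed.

Lemma closed_zset_sep (C : set X) x : closed C -> ~ C x ->
  exists a F, [/\ hom a F, C `<=` zset F & ~ zset F x].
Proof.
move=> cC Cx; have [z Uz zx] := pr_surj x; have oC := closed_openC cC.
have [|a [F [hF Fz FC]]] := invariant_open_basic hK (pr_cont pr oC) (@pr_pullback_inv _) (z := z).
  by split=> //=; rewrite zx.
exists a, F; split=> // [y Cy|].
  have [y' Uy' y'y] := pr_surj y; rewrite -y'y; apply/(zset_pi hF Uy').
  by apply/eqP; apply: contrapT => /negP/FC[_]; rewrite /= y'y.
by rewrite -zx => /(zset_pi hF Uz)/eqP; apply/negP.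
Qed.

End Presentations.

(** * Products of projective spaces *)

Section Blocks.
Variable K : closedFieldType.
Hypothesis hK : [pchar K] =i pred0.

Definition block_weight n k (blk : 'I_n -> 'I_k) (i : 'I_n) : 'rV[int]_k := delta_mx 0 (blk i).

(** The points with no vanishing block of coordinates. When every block has at least two coordinates
    this is the characteristic space of the corresponding product of projective spaces. *)
Definition Uhat n k (blk : 'I_n -> 'I_k) : set (affine_space K n) :=
  [set z | forall b, exists2 i, blk i = b & z 0 i != 0].

Lemma block_act n k (blk : 'I_n -> 'I_k) (t : 'rV[K]_k) z :
  grading_action (block_weight blk) t z = \row_i (t 0 (blk i) * z 0 i).
Proof.
apply/rowP => i; rewrite !mxE; congr (_ * _).
rewrite (bigD1 (blk i)) //= /block_weight mxE !eqxx expr1z big1 ?mulr1 // => j /negbTE ji.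
by rewrite mxE ji andbF expr0z.
Qed.

Lemma Uhat_inv n k (blk : 'I_n -> 'I_k) : invariant_set (block_weight blk) (Uhat blk).
Proof.
move=> t z ht Uz b; have [i ib zi] := Uz b; exists i => //.
by rewrite block_act mxE mulf_neq0.
Qed.

Lemma open_Uhat n k (blk : 'I_n -> 'I_k) : open (Uhat blk).
Proof.
apply: open_local => z Uz; have /choice[c cP] : forall b, exists i, blk i = b /\ z 0 i != 0.
  by move=> b; have [i] := Uz b; exists i.
exists [set y | peval (\prod_b pvar K (c b)) y != 0]; split; first exact: open_basic.
  by rewrite /= peval_prod; apply/prodf_neq0 => b _; rewrite peval_var; case: (cP b).
move=> y /=; rewrite peval_prod => /prodf_neq0 h b; exists (c b); first by case: (cP b).
by have := h b isT; rewrite peval_var.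
Qed.

Definition block_size n k (blk : 'I_n -> 'I_k) b := #|[pred i | blk i == b]|.

End Blocks.

Section ProjectiveSpace.
Variable K : closedFieldType.
Hypothesis hK : [pchar K] =i pred0.
Variable n : nat.

Local Notation P := (projective_space K n).
Local Notation V := 'rV[K]_n.+1.

Definition one_block : 'I_n.+1 -> 'I_1 := fun=> ord0.
Local Notation w := (block_weight one_block).

Lemma one_block_homP d (F : mpoly n.+1 K) : homogeneous_form d F <-> whomog w (const_mx d%:Z) F.
Proof.
have E m : (wdeg w m = const_mx d%:Z) <-> mdeg m = d.
  have -> : wdeg w m = const_mx (mdeg m)%:Z.
    apply/rowP => j; rewrite mdegE (big_morph Posz PoszD (erefl _)) mxE summxE.
    by apply: eq_bigr => i _; rewrite mulmxnE mxE (ord1 j) (ord1 (one_block i)) !eqxx /= mulr1n natz.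
  split=> [/rowP/(_ ord0)|->//]; by rewrite !mxE => -[].
by split=> h m mF; apply/E/h.
Qed.

Lemma dim_line1 : \dim <[const_mx 1 : V]>%VS == 1%N.
Proof.
rewrite dim_vline eqb1; apply/rV0Pn; exists ord0.
by rewrite mxE oner_neq0.
Qed.

(** For z = 0 the span is not a point of the projective space, and the line through the all-ones
    vector is the default. *)
Definition line (z : affine_space K n.+1) : P :=
  insubd (exist (fun L : {vspace V} => \dim L == 1%N) <[const_mx 1]>%VS dim_line1) <[z]>%VS.

Lemma val_line z : z != 0 -> val (line z) = <[z]>%VS.
Proof. by move=> z0; rewrite val_insubd dim_vline z0 eqxx. Qed.

Lemma vpick_neq0 (L : P) : vpick (val L) != 0.
Proof. by rewrite vpick0 -dimv_eq0; have /eqP -> := valP L. Qed.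

Lemma vline_vpick (L : P) : <[vpick (val L)]>%VS = val L.
Proof.
apply/eqP; rewrite eqEdim -memvE memv_pick dim_vline vpick_neq0.
by have /eqP -> := valP L.
Qed.

Lemma line_vpick (L : P) : line (vpick (val L)) = L.
Proof. by apply: val_inj; rewrite val_line ?vpick_neq0 // vline_vpick. Qed.

Lemma line_scale z (c : K) : c != 0 -> line (c *: z) = line z.
Proof.
move=> c0; rewrite /line; congr insubd; apply/eqP; rewrite eqEsubv -!memvE memvZ ?memv_line //=.
by rewrite -[X in X \in _](scalerK c0) memvZ ?memv_line.
Qed.

Lemma vpick_line z : z != 0 -> exists2 c, c != 0 & vpick (val (line z)) = c *: z.
Proof.
move=> z0; have := memv_pick (val (line z)); rewrite {2}val_line // => /vlineP[c cE].
by exists c => //; apply: contraNneq (vpick_neq0 (line z)) => c0; rewrite cE c0 scale0r.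
Qed.

Lemma one_block_act (t : 'rV[K]_1) (z : affine_space K n.+1) :
  grading_action w t z = t 0 0 *: z.
Proof. by rewrite block_act; apply/rowP => i; rewrite !mxE. Qed.

Lemma peval_scale d (F : mpoly n.+1 K) (c : K) z : homogeneous_form d F -> c != 0 ->
  peval F (c *: z) = c ^+ d * peval F z.
Proof.
move=> /one_block_homP hF c0; have ht : torus (const_mx c : 'rV[K]_1) by move=> j; rewrite mxE.
have := whomog_act z ht hF; rewrite one_block_act mxE => ->; congr (_ * _).
by rewrite /tpow big_ord1 !mxE.
Qed.

Lemma feval_line d F z : homogeneous_form d F -> z != 0 -> exists2 c, c != 0 &
  feval F (line z) = c ^+ d * peval F z.
Proof.
by move=> hF /vpick_line[c c0 cE]; exists c => //; rewrite /feval cE (peval_scale _ hF c0).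
Qed.

Lemma feval_line_neq0 d F z : homogeneous_form d F -> z != 0 ->
  (feval F (line z) != 0) = (peval F z != 0).
Proof.
move=> hF z0; have [c c0 ->] := feval_line hF z0.
by rewrite mulf_eq0 expf_eq0 (negbTE c0) andbF.
Qed.

Lemma formM d e (F G : mpoly n.+1 K) : homogeneous_form d F -> homogeneous_form e G ->
  homogeneous_form (d + e) (F * G).
Proof.
move=> /one_block_homP hF /one_block_homP hG; apply/one_block_homP.
have -> : const_mx (d + e)%:Z = const_mx d%:Z + const_mx e%:Z :> 'rV[int]_1 by apply/rowP => j; rewrite !mxE.
exact: whomogM.
Qed.

Lemma formD d (F G : mpoly n.+1 K) : homogeneous_form d F -> homogeneous_form d G ->
  homogeneous_form d (F + G).
Proof. by move=> /one_block_homP hF /one_block_homP hG; apply/one_block_homP/whomogD. Qed.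

Lemma form_var i : homogeneous_form 1 (pvar K i : mpoly n.+1 K).
Proof.
apply/one_block_homP; have -> : const_mx 1%:Z = w i by apply/rowP => j; rewrite /block_weight !mxE !ord1.
exact: whomog_var.
Qed.

Lemma form_const c : homogeneous_form 0 (mpolyC n.+1 c : mpoly n.+1 K).
Proof.
apply/one_block_homP; have -> : const_mx 0%:Z = 0 :> 'rV[int]_1 by apply/rowP => j; rewrite !mxE.
exact: whomogC.
Qed.

Lemma fevalM F G (L : P) : feval (F * G) L = feval F L * feval G L.
Proof. exact: pevalM. Qed.

Lemma fevalD F G (L : P) : feval (F + G) L = feval F L + feval G L.
Proof. exact: pevalD. Qed.

Lemma projective_openP (W : set P) : open W <-> forall L, W L -> exists d F,
  [/\ homogeneous_form d F, feval F L != 0 & forall M, feval F M != 0 -> W M].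
Proof.
have [z|A B z [d [P [hP PE]]] [e [Q [hQ QE]]] Az Bz|h1 h2] :=
    @open_fromP (projective_pts K n) (@projective_basic K n) _ _ W.
- exists [set L | feval (mpolyC n.+1 1) L != 0].
    by exists 0%N, (mpolyC n.+1 1); split=> //; exact: form_const.
  by rewrite /= /feval pevalC oner_neq0.
- exists [set y | feval (P * Q) y != 0]; split.
  + by exists (d + e)%N, (P * Q); split=> //; exact: formM.
  + by rewrite /= fevalM mulf_neq0 //; [move: Az; rewrite PE|move: Bz; rewrite QE].
  by move=> y /=; rewrite fevalM mulf_eq0 negb_or PE QE => /andP[].
split=> [/h1 h z /h[B [[d [F [hF BE]]] Bz BW]]|h].
  by exists d, F; split=> //; [move: Bz; rewrite BE|move=> y Py; apply: BW; rewrite BE].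
apply: h2 => z /h[d [F [hF Fz FW]]]; exists [set y | feval F y != 0].
by split=> //; exists d, F.
Qed.

Lemma nice_projective : nice P.
Proof.
split.
- move=> W f oW; split=> [rf x Wx|h x Wx]; first by exists W, f; split.
  have [V [g [/projective_openP oV Vx rg e]]] := h x Wx.
  have [d [F [G [hF hG Gx FG]]]] := rg x Vx; have [d' [R [hR Rx RV]]] := oV x Vx.
  exists (d + d')%N, (F * R), (G * R); split; [exact: formM|exact: formM|by rewrite fevalM mulf_neq0|].
  move=> y Wy; rewrite !fevalM mulf_eq0 negb_or => /andP[Gy Ry].
  by rewrite e ?FG //; [field; rewrite Ry|exact: RV..].
- move=> W c oW x Wx; exists 0%N, (mpolyC n.+1 c), (mpolyC n.+1 1).
  by split; [exact: form_const|exact: form_const|rewrite /feval pevalC oner_neq0|move=> y _ _; rewrite /feval !pevalC divr1].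
- move=> W f g oW rf rg x Wx; have [d [F [G [hF hG Gx FG]]]] := rf x Wx.
  have [d' [F' [G' [hF' hG' Gx' FG']]]] := rg x Wx.
  exists (d + d')%N, (F * G' + F' * G), (G * G'); split.
  + by apply: formD; [exact: formM|rewrite addnC; exact: formM].
  + exact: formM.
  + by rewrite fevalM mulf_neq0.
  move=> y Wy; rewrite fevalD !fevalM mulf_eq0 negb_or => /andP[Gy G'y].
  by rewrite FG // FG' //; field; rewrite Gy G'y.
- move=> W f g oW rf rg x Wx; have [d [F [G [hF hG Gx FG]]]] := rf x Wx.
  have [d' [F' [G' [hF' hG' Gx' FG']]]] := rg x Wx.
  exists (d + d')%N, (F * F'), (G * G'); split; [exact: formM|exact: formM|by rewrite fevalM mulf_neq0|].
  move=> y Wy; rewrite !fevalM mulf_eq0 negb_or => /andP[Gy G'y].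
  by rewrite FG // FG' //; field; rewrite Gy G'y.
- move=> W f oW rf f0 x Wx; have [d [F [G [hF hG Gx FG]]]] := rf x Wx.
  have Fx : feval F x != 0 by have := f0 x Wx; rewrite FG // mulf_eq0 negb_or => /andP[].
  exists (d + d)%N, (G * G), (F * G); split; [exact: formM|exact: formM|by rewrite fevalM mulf_neq0|].
  move=> y Wy; rewrite !fevalM mulf_eq0 negb_or => /andP[Fy Gy].
  by rewrite FG //; field; rewrite Gy Fy.
move=> W f oW rf; apply/projective_openP => x [Wx /= fx]; have [d [F [G [hF hG Gx FG]]]] := rf x Wx.
move/projective_openP: oW => /(_ x Wx)[d' [R [hR Rx RW]]].
have Fx : feval F x != 0 by move: fx; rewrite FG // mulf_eq0 negb_or => /andP[].
exists (d' + (d + d))%N, (R * (F * G)); split; [by do !apply: formM|by rewrite !fevalM !mulf_neq0|].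
move=> y; rewrite !fevalM !mulf_eq0 !negb_or => /and3P[Ry Fy Gy].
by split; [exact: RW|rewrite /= FG ?mulf_neq0 ?invr_eq0 //; exact: RW].
Qed.

Lemma Uhat_one_block (z : affine_space K n.+1) : Uhat (K:=K) one_block z <-> z != 0.
Proof.
split=> [/(_ 0)[i _ zi]|/rV0Pn[i zi] b]; first by apply/rV0Pn; exists i.
by exists i => //; rewrite !ord1.
Qed.

Lemma projective_presentation : presentation w (Uhat (K:=K) one_block) line.
Proof.
have oU := open_Uhat K one_block; have nA := nice_affine K n.+1.
split=> //; first exact: Uhat_inv.
- move=> O /projective_openP oO; apply: open_local => z [/Uhat_one_block z0 /= /oO[d [F [hF Fz FO]]]].
  exists (Uhat (K:=K) one_block `&` [set y | peval F y != 0]); split; first by apply: openI => //; apply: open_basic.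
    by split; [exact/Uhat_one_block|rewrite /= -(feval_line_neq0 hF)].
  move=> y [/Uhat_one_block y0 /= Fy]; split; first exact/Uhat_one_block.
  by apply: FO; rewrite (feval_line_neq0 hF).
- move=> O f oO rf z [/Uhat_one_block z0 /= Oz]; have [d [F [G [hF hG Gz FG]]]] := rf _ Oz.
  exists F, G; split; first by rewrite -(feval_line_neq0 hG).
  move=> y [/Uhat_one_block y0 Oy] Gy; rewrite FG ?(feval_line_neq0 hG) //.
  have [c c0 cE] := vpick_line y0; rewrite /feval cE !(peval_scale _ hF c0, peval_scale _ hG c0).
  by rewrite invfM mulrACA divff ?mul1r // expf_neq0.
- move=> x; have /rV0Pn[j xj] := vpick_neq0 x.
  (* Dividing by coordinate [j] removes the dependence on the vector picked in the line, so these
     are regular coordinates of a section. *)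
  pose s i (y : P) := feval (pvar K i) y / feval (pvar K j) y.
  have fvar i (y : P) : feval (pvar K i) y = vpick (val y) 0 i by apply: peval_var.
  have oV : open [set y : P | feval (pvar K j) y != 0].
    by apply/projective_openP => y yj; exists 1%N, (pvar K j); split=> //; exact: form_var.
  exists [set y | feval (pvar K j) y != 0], (fun y => \row_i s i y); split=> //=.
  + by rewrite fvar.
  + move=> i y yj; exists 1%N, (pvar K i), (pvar K j); split=> //; try exact: form_var.
    by move=> y' _ _; rewrite mxE.
  move=> y; rewrite fvar => yj.
  have E : \row_i s i y = (vpick (val y) 0 j)^-1 *: vpick (val y).
    by apply/rowP => i; rewrite !mxE /s !fvar mulrC.
  rewrite E line_scale ?invr_eq0 // line_vpick; split=> //; apply/Uhat_one_block.
  by rewrite scaler_eq0 invr_eq0 (negbTE yj) /= vpick_neq0.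
move=> z z' /Uhat_one_block z0 /Uhat_one_block z'0; split=> [e|[t ht ->]]; last first.
  by rewrite one_block_act line_scale // ht.
have : z' \in <[z]>%VS by rewrite -(val_line z0) e (val_line z'0) memv_line.
move=> /vlineP[c cE]; exists (const_mx c); last by rewrite one_block_act mxE.
by move=> j; rewrite mxE; apply: contraNneq z'0 => c0; rewrite cE c0 scale0r.
Qed.

End ProjectiveSpace.

Section ProductPresentation.
Variable K : closedFieldType.
Hypothesis hK : [pchar K] =i pred0.

Section PullTensor.
Variables (X Y : kspace K) (nX : nice X) (nY : nice Y) (n : nat).
Variables (D E : set (affine_space K n)) (p : affine_space K n -> X) (q : affine_space K n -> Y).
Hypothesis cp : forall O, open O -> open (D `&` p @^-1` O).
Hypothesis rp : forall O f, open O -> regular O f -> regular (D `&` p @^-1` O) (f \o p).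
Hypothesis cq : forall O, open O -> open (E `&` q @^-1` O).
Hypothesis rq : forall O f, open O -> regular O f -> regular (E `&` q @^-1` O) (f \o q).

Local Notation pq := (fun z => (p z, q z) : product X Y).

Lemma pull_tensor (U : set X) (V : set Y) h : open U -> open V -> tensor U V h ->
  regular ((D `&` p @^-1` U) `&` (E `&` q @^-1` V)) (h \o pq).
Proof.
move=> oU oV [N [a [b [ra rb hE]]]]; have nA := nice_affine K n.
have o : open ((D `&` p @^-1` U) `&` (E `&` q @^-1` V)) by apply: openI; auto.
apply: (regular_eq nA o (f := fun z => \sum_i (a i (p z) * b i (q z)))) => [z _|]; first by rewrite /= hE.
apply: regular_sum => // i _; apply: nice_mul => //.
  by apply: (regular_sub nA o _ _ (rp oU (ra i))); auto => z [].
by apply: (regular_sub nA o _ _ (rq oV (rb i))); auto => z [].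
Qed.

(** The maps [p] and [q] have their own domains so that this covers both pairs of quotient maps and
    slices, where one of them is constant. *)
Lemma pull_product_open O : open O -> open ((D `&` E) `&` pq @^-1` O).
Proof.
move=> /(product_openP nX nY) oO; apply: open_local => z [[Dz Ez] /= /oO[U [V [h [oU oV th [Uz Vz hz] hO]]]]].
have o : open ((D `&` p @^-1` U) `&` (E `&` q @^-1` V)) by apply: openI; auto.
exists (((D `&` p @^-1` U) `&` (E `&` q @^-1` V)) `&` [set z | (h \o pq) z != 0]); split=> //.
  have oo := nice_open (nice_affine K n) o (pull_tensor oU oV th).
  exact: oo.
by move=> y [[[Dy Uy] [Ey Vy]] hy]; split=> //; apply: hO.
Qed.

Lemma pull_product_regular O f : open O -> regular O f -> regular ((D `&` E) `&` pq @^-1` O) (f \o pq).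
Proof.
move=> oO rf; have nA := nice_affine K n.
apply: (regular_local nA); first exact: pull_product_open.
move=> z [[Dz Ez] Oz]; have [U [V [a [b [[oU oV Uz Vz] [ta tb bz fE]]]]]] := rf _ Oz.
have o : open ((D `&` p @^-1` U) `&` (E `&` q @^-1` V)) by apply: openI; auto.
have rb := pull_tensor oU oV tb; have ob := nice_open nA o rb.
exists (((D `&` p @^-1` U) `&` (E `&` q @^-1` V)) `&` [set z | (b \o pq) z != 0]), (fun z => (a \o pq) z / (b \o pq) z).
split=> //.
  apply: regular_div => //; last by move=> y [].
    by apply: (regular_sub nA ob o _ (pull_tensor oU oV ta)) => y [].
  by apply: (regular_sub nA ob o _ rb) => y [].
by move=> y [[[Dy Uy] [Ey Vy]] hy] [_ Oy]; rewrite /= fE.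
Qed.

End PullTensor.

Section TwoFactors.
Variables (X Y : kspace K) (nX : nice X) (nY : nice Y).
Variables (n1 k1 n2 k2 : nat) (b1 : 'I_n1 -> 'I_k1) (b2 : 'I_n2 -> 'I_k2).
Variables (p1 : affine_space K n1 -> X) (p2 : affine_space K n2 -> Y).
Hypothesis pr1 : presentation (block_weight b1) (Uhat b1) p1.
Hypothesis pr2 : presentation (block_weight b2) (Uhat b2) p2.

Definition sum_block (i : 'I_(n1 + n2)) : 'I_(k1 + k2) :=
  match fintype.split i with inl i => lshift k2 (b1 i) | inr j => rshift k1 (b2 j) end.

Lemma sum_block_l i : sum_block (lshift n2 i) = lshift k2 (b1 i).
Proof. by rewrite /sum_block (unsplitK (inl i)). Qed.

Lemma sum_block_r i : sum_block (rshift n1 i) = rshift k1 (b2 i).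
Proof. by rewrite /sum_block (unsplitK (inr i)). Qed.

Lemma split_ordP n m (i : 'I_(n + m)) : (exists j, i = lshift m j) \/ exists j, i = rshift n j.
Proof. by case: (split_ordP i) => j ->; [left|right]; exists j. Qed.

Lemma Uhat_sum (z : affine_space K (n1 + n2)) : Uhat sum_block z <->
  Uhat b1 (lsubmx (z : 'rV[K]_(n1 + n2))) /\ Uhat b2 (rsubmx (z : 'rV[K]_(n1 + n2))).
Proof.
split=> [h|[h1 h2] b].
  split=> b.
    have [i] := h (lshift k2 b); have [[j ->]|[j ->]] := split_ordP i.
      by rewrite sum_block_l => /lshift_inj <- zj; exists j; rewrite ?mxE.
    by rewrite sum_block_r => /eqP; rewrite eq_rlshift.
  have [i] := h (rshift k1 b); have [[j ->]|[j ->]] := split_ordP i.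
    by rewrite sum_block_l => /eqP; rewrite eq_lrshift.
  by rewrite sum_block_r => /rshift_inj <- zj; exists j; rewrite ?mxE.
have [[b' ->]|[b' ->]] := split_ordP b.
  by have [i ib zi] := h1 b'; exists (lshift n2 i); [rewrite sum_block_l ib|move: zi; rewrite mxE].
by have [i ib zi] := h2 b'; exists (rshift n1 i); [rewrite sum_block_r ib|move: zi; rewrite mxE].
Qed.

Definition pair_proj (z : affine_space K (n1 + n2)) : product X Y :=
  (p1 (lsubmx (z : 'rV[K]_(n1 + n2))), p2 (rsubmx (z : 'rV[K]_(n1 + n2)))).

Lemma product_presentation : presentation (block_weight sum_block) (Uhat sum_block) pair_proj.
Proof.
have nA m := nice_affine K m.
pose l (z : affine_space K (n1 + n2)) : affine_space K n1 := lsubmx (z : 'rV[K]_(n1 + n2)).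
pose r (z : affine_space K (n1 + n2)) : affine_space K n2 := rsubmx (z : 'rV[K]_(n1 + n2)).
have rl i : regular setT (fun z => l z 0 i).
  have h := @regular_peval K (n1 + n2) setT (pvar K (lshift n2 i)).
  by apply: (regular_eq (nA _) openT _ h) => z _; rewrite peval_var mxE.
have rr i : regular setT (fun z => r z 0 i).
  have h := @regular_peval K (n1 + n2) setT (pvar K (rshift n1 i)).
  by apply: (regular_eq (nA _) openT _ h) => z _; rewrite peval_var mxE.
have ol O : open O -> open (l @^-1` O).
  by move=> oO; rewrite -[X in open X]setTI; apply: (preimage_affine_open (nA _) openT rl).
have or O : open O -> open (r @^-1` O).
  by move=> oO; rewrite -[X in open X]setTI; apply: (preimage_affine_open (nA _) openT rr).
have regl O g : open O -> regular O g -> regular (l @^-1` O) (g \o l).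
  by move=> oO rg; have := preimage_affine_regular (nA _) openT rl oO rg; rewrite setTI.
have regr O g : open O -> regular O g -> regular (r @^-1` O) (g \o r).
  by move=> oO rg; have := preimage_affine_regular (nA _) openT rr oO rg; rewrite setTI.
have c1 O : open O -> open (l @^-1` (Uhat b1) `&` (p1 \o l) @^-1` O).
  by move=> /(pr_cont pr1)/ol.
have c2 O : open O -> open (r @^-1` (Uhat b2) `&` (p2 \o r) @^-1` O).
  by move=> /(pr_cont pr2)/or.
have r1 O f : open O -> regular O f -> regular (l @^-1` (Uhat b1) `&` (p1 \o l) @^-1` O) (f \o (p1 \o l)).
  by move=> oO /(pr_reg pr1 oO); apply: regl; apply: (pr_cont pr1).
have r2 O f : open O -> regular O f -> regular (r @^-1` (Uhat b2) `&` (p2 \o r) @^-1` O) (f \o (p2 \o r)).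
  by move=> oO /(pr_reg pr2 oO); apply: regr; apply: (pr_cont pr2).
have UE : Uhat sum_block = (l @^-1` (Uhat b1)) `&` (r @^-1` (Uhat b2)).
  by apply/seteqP; split=> z /Uhat_sum.
split.
- exact: open_Uhat.
- exact: Uhat_inv.
- by move=> O oO; rewrite UE; apply: (pull_product_open nX nY c1 r1 c2 r2).
- by move=> O f oO rf; rewrite UE; apply: (pull_product_regular nX nY c1 r1 c2 r2).
- move=> [x y]; have [V1 [s1 [oV1 V1x rs1 s1E]]] := pr_sec pr1 x.
  have [V2 [s2 [oV2 V2y rs2 s2E]]] := pr_sec pr2 y.
  exists [set z | V1 z.1 /\ V2 z.2], (fun z => row_mx (s1 z.1) (s2 z.2)); split=> //.
  + exact: open_product.
  + have oV : open ([set z | V1 z.1 /\ V2 z.2] : set (product X Y)) by apply: open_product.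
    move=> i; have [[j ->]|[j ->]] := split_ordP i.
      have h := regular_tensor nX nY oV1 oV2 (tensor_fst nY oV1 oV2 (rs1 j)).
      by apply: (regular_eq (nice_product nX nY) oV _ h) => z _; rewrite row_mxEl.
    have h := regular_tensor nX nY oV1 oV2 (tensor_snd nX oV1 oV2 (rs2 j)).
    by apply: (regular_eq (nice_product nX nY) oV _ h) => z _; rewrite row_mxEr.
  move=> [x' y'] [/= Vx' Vy']; have [U1 e1] := s1E _ Vx'; have [U2 e2] := s2E _ Vy'.
  rewrite /pair_proj row_mxKl row_mxKr e1 e2; split=> //.
  by apply/Uhat_sum; rewrite row_mxKl row_mxKr.
have actE (t : 'rV[K]_(k1 + k2)) (z : affine_space K (n1 + n2)) :
    grading_action (block_weight sum_block) t z =
    row_mx (grading_action (block_weight b1) (lsubmx t) (l z)) (grading_action (block_weight b2) (rsubmx t) (r z)).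
  rewrite !block_act; apply/rowP => i; have [[j ->]|[j ->]] := split_ordP i.
    by rewrite row_mxEl !mxE sum_block_l.
  by rewrite row_mxEr !mxE sum_block_r.
move=> z z' /Uhat_sum[U1 U2] /Uhat_sum[U1' U2']; split=> [[e1 e2]|[t ht e]].
  have [t1 ht1 e1'] := (pr_fib pr1 U1 U1').1 e1; have [t2 ht2 e2'] := (pr_fib pr2 U2 U2').1 e2.
  exists (row_mx t1 t2).
    by move=> j; have [[i ->]|[i ->]] := split_ordP j; rewrite ?row_mxEl ?row_mxEr.
  by rewrite actE row_mxKl row_mxKr -e1' -e2' hsubmxK.
have ht1 : torus (lsubmx t) by move=> j; rewrite mxE.
have ht2 : torus (rsubmx t) by move=> j; rewrite mxE.
rewrite /pair_proj e actE row_mxKl row_mxKr; congr pair.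
  by apply/(pr_fib pr1 U1); [exact: Uhat_inv|exists (lsubmx t)].
by apply/(pr_fib pr2 U2); [exact: Uhat_inv|exists (rsubmx t)].
Qed.

Lemma sum_block_size_l b : block_size sum_block (lshift k2 b) = block_size b1 b.
Proof.
rewrite /block_size -!sum1_card big_mkcond [RHS]big_mkcond big_split_ord /=.
rewrite [X in (_ + X)%N]big1 ?addn0 => [|i _]; last by rewrite inE sum_block_r eq_rlshift.
by apply: eq_bigr => i _; rewrite !inE sum_block_l eq_lshift.
Qed.

Lemma sum_block_size_r b : block_size sum_block (rshift k1 b) = block_size b2 b.
Proof.
rewrite /block_size -!sum1_card big_mkcond [RHS]big_mkcond big_split_ord /=.
rewrite [X in (X + _)%N]big1 ?add0n => [|i _]; last by rewrite inE sum_block_l eq_lrshift.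
by apply: eq_bigr => i _; rewrite !inE sum_block_r eq_rshift.
Qed.

End TwoFactors.

(** A factor of dimension 0 is a point and must contribute no block: later arguments need two
    coordinates in each block. *)
Lemma point_factor_presentation (X Y : kspace K) (nX : nice X) (nY : nice Y) (x0 : X)
    n k (b : 'I_n -> 'I_k) (p : affine_space K n -> Y) :
  (forall x, x = x0) -> presentation (block_weight b) (Uhat b) p ->
  presentation (block_weight b) (Uhat b) (fun z => (x0, p z) : product X Y).
Proof.
move=> X1 pr; have nA := nice_affine K n.
have c1 O : open O -> open (setT `&` (fun _ : affine_space K n => x0) @^-1` O).
  move=> oO; rewrite setTI; have [Ox|nOx] := pselect (O x0).
    by rewrite (_ : _ @^-1` _ = setT); [exact: openT|apply/seteqP; split].
  by rewrite (_ : _ @^-1` _ = set0); [exact: open0|apply/seteqP; split].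
have r1 O f : open O -> regular O f -> regular (setT `&` (fun _ : affine_space K n => x0) @^-1` O) (f \o fun=> x0).
  by move=> oO _; apply: nice_cst => //; apply: c1.
split.
- exact: open_Uhat.
- exact: Uhat_inv.
- move=> O oO; have := pull_product_open nX nY c1 r1 (pr_cont pr) (pr_reg pr) oO.
  by rewrite setTI.
- move=> O f oO rf; have := pull_product_regular nX nY c1 r1 (pr_cont pr) (pr_reg pr) oO rf.
  by rewrite setTI.
- move=> [x y]; have [V [s [oV Vy rs sE]]] := pr_sec pr y.
  exists [set z | setT z.1 /\ V z.2], (fun z => s z.2); split=> //.
  + by apply: open_product => //; apply: openT.
  + move=> i; have h := regular_tensor nX nY openT oV (tensor_snd nX openT oV (rs i)).
    exact: h.
  by move=> [x' y'] [_ /= /sE[Us e]]; split=> //=; rewrite e -(X1 x').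
move=> z z' Uz Uz'; split=> [[/(pr_fib pr Uz Uz')]//|/(pr_fib pr Uz Uz') ->//].
Qed.

Lemma projective0_point (L : projective_space K 0) : L = line (const_mx 1 : 'rV[K]_1).
Proof.
have z0 : (const_mx 1 : 'rV[K]_1) != 0 by apply/rV0Pn; exists 0; rewrite mxE oner_neq0.
apply: val_inj; rewrite val_line // -vline_vpick; apply/eqP; rewrite eqEdim !dim_vline vpick_neq0 z0 andbT.
rewrite -memvE; apply/vlineP; exists (vpick (val L) 0 0); apply/rowP => j.
by rewrite !mxE mulr1 ord1.
Qed.

Lemma nice_dims dims : nice (product_of_projective_spaces K dims).
Proof.
elim: dims => [|d dims IH] /=; first exact: nice_affine.
by apply: nice_product => //; apply: nice_projective.
Qed.

Lemma dims_presentation dims : exists k n (blk : 'I_n -> 'I_k)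
    (p : affine_space K n -> product_of_projective_spaces K dims),
  [/\ presentation (block_weight blk) (Uhat blk) p, k = size [seq d <- dims | (0 < d)%N] &
   forall b, block_size blk b = (nth 0%N [seq d <- dims | (0 < d)%N] b).+1].
Proof.
elim: dims => [|d dims [k [n [blk [p [pr kE bE]]]]]] /=.
  exists 0%N, 0%N, id, id; split=> //; last by case.
  have nA := nice_affine K 0.
  have UT : Uhat (K := K) (@id 'I_0) = setT by apply/seteqP; split=> // z _ b; have := ltn_ord b.
  split=> //; rewrite UT; first exact: openT.
  - by [].
  - by move=> O oO; rewrite setTI.
  - by move=> O f oO; rewrite setTI.
  - by move=> x; exists setT, id; split=> //; [exact: openT|case].
  by move=> z z' _ _; split=> [->|_]; [exists 0|]; try case; rewrite ?flatmx0 //; apply/rowP; case.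
have nP := nice_projective hK d; have nY := nice_dims dims.
have [d0|d0] := posnP d.
  subst d; exists k, n, blk, (fun z => (line (const_mx 1 : 'rV[K]_1), p z)); split=> //.
  exact: (point_factor_presentation nP nY (@projective0_point)).
exists (1 + k)%N, (d.+1 + n)%N, (sum_block (@one_block d) blk), (pair_proj (@line K d) p).
split; [|by rewrite /= kE|].
  have h := product_presentation nP nY (projective_presentation hK d) pr.
  exact: h.
move=> b; have [[b' ->]|[b' ->]] := split_ordP b.
  rewrite sum_block_size_l ord1 /block_size /= -sum1_card.
  rewrite (eq_bigl xpredT) => [|i]; last by rewrite inE !ord1 eqxx.
  by rewrite sum1_card card_ord.
by rewrite sum_block_size_r bE.
Qed.

Section Reindex.
Variables (X : kspace K) (nX : nice X) (n k : nat) (b : 'I_n -> 'I_k) (s : 'S_n).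
Variables (p : affine_space K n -> X).
Hypothesis pr : presentation (block_weight b) (Uhat b) p.

Lemma reindex_presentation : presentation (block_weight (b \o s)) (Uhat (b \o s))
  (fun z => p (\row_i (z : 'rV[K]_n) 0 ((s^-1)%g i))).
Proof.
have nA := nice_affine K n.
pose f (z : affine_space K n) : affine_space K n := \row_i (z : 'rV[K]_n) 0 ((s^-1)%g i).
have rf i : regular setT (fun z => f z 0 i).
  have h := @regular_peval K n setT (pvar K ((s^-1)%g i)).
  by apply: (regular_eq nA openT _ h) => z _; rewrite peval_var mxE.
have of_ O : open O -> open (f @^-1` O).
  by move=> oO; rewrite -[X in open X]setTI; apply: (preimage_affine_open nA openT rf).
have regf O g : open O -> regular O g -> regular (f @^-1` O) (g \o f).
  by move=> oO rg; have := preimage_affine_regular nA openT rf oO rg; rewrite setTI.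
have UE : Uhat (b \o s) = f @^-1` Uhat b.
  apply/seteqP; split=> z h c; have [i /= ib zi] := h c.
    by exists (s i) => //; rewrite mxE permK.
  by exists ((s^-1)%g i); rewrite /= ?permKV // -[z]/(z); move: zi; rewrite mxE.
have actE t z : f (grading_action (block_weight (b \o s)) t z) = grading_action (block_weight b) t (f z).
  by rewrite !block_act; apply/rowP => i; rewrite !mxE /= permKV.
have fI : injective f.
  by move=> z z' /rowP e; apply/rowP => i; have := e (s i); rewrite !mxE permK.
split.
- exact: open_Uhat.
- exact: Uhat_inv.
- by move=> O oO; rewrite UE; apply: (of_ _ (pr_cont pr oO)).
- by move=> O g oO rg; rewrite UE; apply: (regf _ _ (pr_cont pr oO) (pr_reg pr oO rg)).
- move=> x; have [V [c [oV Vx rc cE]]] := pr_sec pr x.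
  exists V, (fun y => \row_i (c y : 'rV[K]_n) 0 (s i)); split=> //.
    by move=> i; apply: (regular_eq nX oV _ (rc (s i))) => y _; rewrite mxE.
  have fc y : f (\row_i (c y : 'rV[K]_n) 0 (s i)) = c y by apply/rowP => i; rewrite !mxE permKV.
  by move=> y /cE[Uy cy]; rewrite UE /= -/(f _) fc.
move=> z z'; rewrite UE => Uz Uz'; rewrite (pr_fib pr Uz Uz').
by split=> -[t ht e]; exists t => //; [apply: fI; rewrite actE|rewrite -/(f z') e actE].
Qed.

End Reindex.

Lemma block_perm n n' k (b : 'I_n -> 'I_k) (b' : 'I_n' -> 'I_k) :
  (forall c, block_size b c = block_size b' c) ->
  exists (e : n = n') (s : 'S_n), forall i, b i = b' (cast_ord e (s i)).
Proof.
move=> h; have pe : perm_eq [seq b i | i <- enum 'I_n] [seq b' i | i <- enum 'I_n'].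
  apply/allP => c _; apply/eqP; rewrite (count_map b) (count_map b').
  have E m (d : 'I_m -> 'I_k) : count (preim d (pred1 c)) (enum 'I_m) = block_size d c.
    by rewrite -sum1_count big_enum_cond /block_size -sum1_card; apply: eq_bigl.
  exact: etrans (E _ b) (etrans (h c) (esym (E _ b'))).
have e : n = n' by have := perm_size pe; rewrite (size_map b) (size_map b') !size_enum_ord.
subst n'; exists erefl.
have /tuple_permP[s /val_inj e] : perm_eq (mktuple b) (mktuple b').
  by [].
exists s => i; have := congr1 (fun u => tnth u i) e.
by rewrite !tnth_mktuple cast_ord_id.
Qed.

(** A block of size s stands for a factor of dimension s - 1. The coordinates of the product are
    then permuted to match the given blocks. *)
Theorem blocks_presentation n k (blk : 'I_n -> 'I_k) : (forall c, 1 < block_size blk c)%N ->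
  exists dims p, presentation (X := product_of_projective_spaces K dims)
    (block_weight blk) (Uhat blk) p.
Proof.
move=> h; pose sizes := [seq (block_size blk c).-1 | c <- enum 'I_k].
have sE : [seq d <- sizes | (0 < d)%N] = sizes.
  apply/all_filterP/allP => _ /mapP[c _ ->].
  by rewrite -subn1 subn_gt0.
have [k' [n' [blk' [p [pr kE bE]]]]] := dims_presentation sizes.
have {}kE : k' = k by rewrite kE sE size_map size_enum_ord.
subst k'; have [c|e [s sE']] := @block_perm n n' k blk blk'.
  rewrite bE sE (nth_map c) ?size_enum_ord // nth_ord_enum prednK //.
  exact: ltn_trans (h c).
subst n'; exists sizes, (fun z => p (\row_i (z : 'rV[K]_n) 0 ((s^-1)%g i))).
have -> : blk = blk' \o s by apply/funext => i; rewrite sE' cast_ord_id.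
exact: (reindex_presentation (nice_dims sizes) s pr).
Qed.

End ProductPresentation.

(** * Divisors and Cox rings of quotients by a torus *)

Section Valuation.
Variables (R : idomainType) (uR : is_ufd R).
Implicit Types (p q F G : R).

(** The [p]-adic valuation, meaningful for [p] prime and [F] nonzero. *)
Definition vp p F : nat := xget 0%N [set e | exists G, F = G * p ^+ e /\ ~ divides p G].

Lemma vp_uniq p F e e' G G' : prime_elt p -> F = G * p ^+ e -> ~ divides p G ->
  F = G' * p ^+ e' -> ~ divides p G' -> e = e'.
Proof.
move=> pp; have p0 : p != 0 by case: pp.
wlog le : e e' G G' / (e <= e')%N => [h|].
  case: (leqP e e') => [|/ltnW] le h1 h2 h3 h4; first exact: (h e e' G G').
  by apply/esym/(h e' e G' G).
move=> FE nG FE' nG'; apply/eqP; rewrite eqn_leq le leqNgt; apply/negP => lt.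
case: nG; move: FE; rewrite FE' -(subnK le) exprD mulrA => /mulIf.
rewrite expf_neq0 // => /(_ isT) <-; apply: divides_mull.
by rewrite -(prednK (_ : 0 < e' - e)%N) ?subn_gt0 // exprS; apply/divides_mulr/divides_refl.
Qed.

Lemma vp_exists p F : prime_elt p -> F != 0 -> exists e G, F = G * p ^+ e /\ ~ divides p G.
Proof.
move=> pp F0; have [u [s [uu sp ->]]] := uR F0; elim: s sp {F F0} => [|q s IH] sp.
  exists 0%N, u; rewrite big_nil expr0; split=> // pu; case: pp => _ pN1 _; apply: pN1.
  by apply: divides_trans pu _; apply/divides1_unit.
have [|e [G [GE nG]]] := IH; first by move=> x xs; apply: sp; rewrite inE xs orbT.
have pq := sp q (mem_head _ _); rewrite big_cons mulrCA GE.
have [/(prime_assoc pp pq)[v uv ->]|npq] := pselect (divides p q).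
  exists e.+1, (v * G); split; first by rewrite exprS; ring.
  case: pp => _ pN1 pM /pM[pv|//]; apply: pN1.
  by apply: divides_trans pv _; apply/divides1_unit.
exists e, (q * G); split; first by rewrite mulrA.
by case: pp => _ _ pM /pM[].
Qed.

Lemma vpP p F : prime_elt p -> F != 0 -> exists G, F = G * p ^+ vp p F /\ ~ divides p G.
Proof.
move=> pp F0; have [e h] := vp_exists pp F0.
exact: (@xgetPex _ 0%N [set e | exists G, F = G * p ^+ e /\ ~ divides p G] (ex_intro _ e h)).
Qed.

Lemma vpE p F G e : prime_elt p -> F != 0 -> F = G * p ^+ e -> ~ divides p G -> vp p F = e.
Proof. by move=> pp F0 FE nG; have [G' [FE' nG']] := vpP pp F0; apply: vp_uniq pp FE' nG' FE nG. Qed.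

Lemma vpM p F G : prime_elt p -> F != 0 -> G != 0 -> vp p (F * G) = (vp p F + vp p G)%N.
Proof.
move=> pp F0 G0; have [F' [FE nF]] := vpP pp F0; have [G' [GE nG]] := vpP pp G0.
apply: (vpE pp _ (G := F' * G')); first by rewrite mulf_neq0.
  by rewrite {1}FE {1}GE exprD; ring.
by case: pp => _ _ pM /pM[].
Qed.

Lemma vp0 p F : prime_elt p -> F != 0 -> ~ divides p F -> vp p F = 0%N.
Proof. by move=> pp F0 nF; apply: (vpE pp F0 (G := F)) => //; rewrite expr0 mulr1. Qed.

Lemma vp_gt0 p F : prime_elt p -> F != 0 -> (0 < vp p F)%N <-> divides p F.
Proof.
move=> pp F0; split=> [|dF]; last first.
  rewrite lt0n; apply/eqP => e; have [G [FE nG]] := vpP pp F0.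
  by apply: nG; move: dF; rewrite {1}FE e expr0 mulr1.
have [G [FE _]] := vpP pp F0; rewrite {2}FE; case: (vp p F) => // e _.
by rewrite exprS; apply/divides_mull/divides_mulr/divides_refl.
Qed.

Lemma vp1 p : prime_elt p -> vp p 1 = 0%N.
Proof. by move=> pp; apply: vp0 => //; [exact: oner_neq0|case: pp]. Qed.

Lemma vp_self p : prime_elt p -> vp p p = 1%N.
Proof.
move=> pp; apply: (vpE pp (G := 1)); [by case: pp|by rewrite mul1r expr1|by case: pp].
Qed.

Lemma vp_unit p u : prime_elt p -> u \is a GRing.unit -> vp p u = 0%N.
Proof.
move=> pp uu; apply: vp0 => //; first by apply: contraTneq uu => ->; rewrite unitr0.
by move=> pu; case: pp => _ pN1 _; apply: pN1; apply: divides_trans pu _; apply/divides1_unit.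
Qed.

Lemma vpX p F e : prime_elt p -> F != 0 -> vp p (F ^+ e) = (e * vp p F)%N.
Proof.
move=> pp F0; elim: e => [|e IH]; first by rewrite expr0 vp1.
by rewrite exprS vpM ?expf_neq0 // IH mulSn.
Qed.

Lemma vp_prod p I (s : seq I) (P : pred I) (F : I -> R) : prime_elt p -> (forall i, P i -> F i != 0) ->
  vp p (\prod_(i <- s | P i) F i) = (\sum_(i <- s | P i) vp p (F i))%N.
Proof.
move=> pp F0; suff [] : \prod_(i <- s | P i) F i != 0 /\
  vp p (\prod_(i <- s | P i) F i) = (\sum_(i <- s | P i) vp p (F i))%N by [].
elim/big_rec2: _ => [|i x y Pi [y0 <-]]; first by rewrite vp1 // oner_neq0.
by rewrite vpM ?F0 // mulf_neq0 ?F0.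
Qed.

End Valuation.

(** * Prime divisors as zero loci of prime forms *)

Section Hypersurfaces.
Variables (K : closedFieldType).
Hypothesis hK : [pchar K] =i pred0.

(** A local Nullstellensatz: with [G] vanishing outside [O] but not at [z0], the prime [p] divides
    [F * G]; it does not divide [G] since it vanishes at [z0]. *)
Lemma divides_of_zeros n (p F : mpoly n K) (O : set (affine_space K n)) z0 : prime_elt p ->
  open O -> O z0 -> peval p z0 = 0 -> (forall z, O z -> peval p z = 0 -> peval F z = 0) -> divides p F.
Proof.
move=> pp /affine_openP oO /oO[G Gz GO] pz h.
have : divides p (F * G).
  apply: peval_nullstellensatz => // z pz'; rewrite pevalM.
  by have [->|/GO Oz] := eqVneq (peval G z) 0; rewrite ?mulr0 // h // mul0r.
case: pp => _ _ pM /pM[//|[c GE]].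
by move: Gz; rewrite GE pevalM pz mulr0 eqxx.
Qed.

Lemma not_divides_of_value n (p F : mpoly n K) z : peval p z = 0 -> peval F z != 0 -> ~ divides p F.
Proof. by move=> pz Fz [c FE]; move: Fz; rewrite FE pevalM pz mulr0 eqxx. Qed.

Variables (X : kspace K) (nX : nice X) (n r : nat) (w : 'I_n -> 'rV[int]_r).
Variables (U : set (affine_space K n)) (pi : affine_space K n -> X).
Hypothesis pr : presentation w U pi.

Local Notation hom := (whomog (K := K) w).
Local Notation zs := (zset U pi).

(** The zero in [U] ensures that the hypersurface is seen on [X]. *)
Definition form_prime (p : mpoly n K) := [/\ prime_elt p, exists a, hom a p & exists2 z, U z & peval p z = 0].

Lemma zset_divides p F a : form_prime p -> hom a F -> zs p `<=` zs F -> divides p F.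
Proof.
move=> [pp [b hp] [z0 Uz0 pz0]] hF sub.
apply: (divides_of_zeros pp (pr_open pr) Uz0 pz0) => z Uz pz.
by apply/(zset_pi pr hF Uz)/sub/(zset_pi pr hp Uz).
Qed.

Lemma zset_mul F G : zs (F * G) = zs F `|` zs G.
Proof.
apply/seteqP; split=> x; rewrite /zset /= pevalM.
  by move=> /eqP; rewrite mulf_eq0 => /orP[] /eqP; [left|right].
by case=> ->; rewrite ?mul0r ?mulr0.
Qed.

(** Closed sets not containing the locus are enclosed in zero loci of forms with the same property.
    If two of them covered it, [p] would divide the product of these forms, and hence one of
    them. *)
Lemma zset_irreducible p : form_prime p -> irreducible_closed (zs p).
Proof.
move=> fp; have [pp [b hp] [z0 Uz0 pz0]] := fp; split; first exact: (closed_zset nX pr hp).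
split; first by exists (pi z0); apply/(zset_pi pr hp Uz0).
move=> C1 C2 cC1 cC2 sub; apply: contrapT => /not_orP[n1 n2].
have sep C : closed C -> ~ (zs p `<=` C) -> exists a F, [/\ hom a F, C `<=` zs F & ~ (zs p `<=` zs F)].
  move=> cC /existsNP[x /not_implyP[px nCx]]; have [a [F [hF CF nFx]]] := closed_zset_sep hK pr cC nCx.
  by exists a, F; split=> // /(_ x px).
have [a1 [F1 [h1 s1 m1]]] := sep _ cC1 n1; have [a2 [F2 [h2 s2 m2]]] := sep _ cC2 n2.
have : divides p (F1 * F2).
  apply: (zset_divides fp (whomogM hK h1 h2)) => x /sub; rewrite zset_mul.
  by case=> [/s1|/s2]; [left|right].
have div_sub F : divides p F -> zs p `<=` zs F.
  by move=> [c ->] x px; rewrite zset_mul; right.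
by case: (pp) => _ _ pM /pM[/div_sub/m1|/div_sub/m2].
Qed.

Lemma presented_irreducible : U !=set0 -> irreducible [set: X].
Proof.
move=> [z0 Uz0]; split; first by exists (pi z0).
move=> C1 C2 cC1 cC2 sub; apply: contrapT => /not_orP[n1 n2].
have sep C : closed C -> ~ ([set: X] `<=` C) -> exists a F, [/\ hom a F, C `<=` zs F & F != 0].
  move=> cC /existsNP[x /not_implyP[_ nCx]]; have [a [F [hF CF nFx]]] := closed_zset_sep hK pr cC nCx.
  by exists a, F; split=> //; apply: contra_notN nFx => /eqP ->; rewrite /zset /= peval0.
have [a1 [F1 [h1 s1 m1]]] := sep _ cC1 n1; have [a2 [F2 [h2 s2 m2]]] := sep _ cC2 n2.
have /negP[] := mulf_neq0 m1 m2; apply/eqP; apply: (mpoly_eq0_open hK (pr_open pr)); first by exists z0.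
move=> z Uz; apply/(zset_pi pr (whomogM hK h1 h2) Uz); rewrite zset_mul.
by case: (sub (pi z) I) => [/s1|/s2]; [left|right].
Qed.

Lemma chain_above_top k (Z : set X) : chain_above k.+1 Z -> exists x, ~ Z x.
Proof.
by move=> [B [_ [_ /existsNP[x /not_implyP[_ Zx]]] _]]; exists x.
Qed.

(** Take a form vanishing on [Z] but not at [x]. Its prime factors are forms again, and [Z], being
    irreducible, lies in the zero locus of one of them. *)
Lemma irreducible_sub_zset (Z : set X) x : irreducible_closed Z -> ~ Z x ->
  exists2 p, form_prime p & Z `<=` zs p.
Proof.
move=> [cZ [[z Zz] iZ]] nZx; have [a [F [hF ZF nFx]]] := closed_zset_sep hK pr cZ nZx.
have F0 : F != 0 by apply: contra_notN nFx => /eqP ->; rewrite /zset /= peval0.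
have [u [s [/mpoly_unit_const[c c0 ->] sp FE]]] := @ufd_mpoly K n F F0.
have sh q : q \in s -> exists b, hom b q.
  move=> qs; pose q' := mpolyC n c * \prod_(x <- rem q s) x.
  have e : q * q' = F by rewrite FE [in RHS](big_rem q) //= mulrCA.
  have F0' : q * q' != 0 by rewrite e.
  by have := hF; rewrite -{1}e => /(whomog_factor hK)/(_ F0').
have : Z `<=` zs (\prod_(q <- s) q).
  by move=> y /ZF; rewrite FE zset_mul => -[] //; rewrite /zset /= pevalC => e; rewrite e eqxx in c0.
elim: s sp sh {FE} => [|q s IH] sp sh.
  by rewrite big_nil => /(_ z Zz); rewrite /zset /= peval1 => /eqP; rewrite oner_eq0.
rewrite big_cons zset_mul => sub.
have [b hb] := sh q (mem_head _ _).
have sp' x' : x' \in s -> prime_elt x' by move=> xs; apply: sp; rewrite inE xs orbT.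
have sh' x' : x' \in s -> exists b, hom b x' by move=> xs; apply: sh; rewrite inE xs orbT.
have cs : closed (zs (\prod_(q <- s) q)).
  have /choice[d dE] : forall x', exists b, x' \in s -> hom b x'.
    by move=> x'; have [/sh'[b' hb']|nx] := boolP (x' \in s); [exists b'|exists 0].
  have hp : hom (\sum_(i <- s | i \in s) d i) (\prod_(q <- s) q).
    by have := @whomog_prod K hK n r w _ s (fun i => i \in s) d id dE; rewrite -big_seq.
  exact: (closed_zset nX pr hp).
case: (iZ _ _ (closed_zset nX pr hb) cs sub) => [Zq|/(IH sp' sh')//].
exists q => //; split; [by apply: sp; rewrite mem_head|by exists b|].
have [y Uy yz] := pr_surj pr z; exists y => //; apply/(zset_pi pr hb Uy).
by rewrite yz; apply: Zq.
Qed.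

Lemma zset_proper p : form_prime p -> U !=set0 -> zs p `<` [set: X].
Proof.
move=> [[p0 _ _] [a hp] _] [z Uz]; split=> // sub; case/negP: p0; apply/eqP.
apply: (mpoly_eq0_open hK (pr_open pr)); first by exists z.
by move=> y Uy; apply/(zset_pi pr hp Uy)/sub.
Qed.

Lemma setT_irreducible_closed : U !=set0 -> irreducible_closed [set: X].
Proof. by move=> U0; split; [exact: closedT|exact: presented_irreducible]. Qed.

Lemma zset_assoc p q : form_prime p -> form_prime q -> zs p `<=` zs q -> zs p = zs q.
Proof.
move=> fp fq sub; have [pq [b hb] _] := fq; have [pp _ _] := fp.
have [u uu qE] := prime_assoc pp pq (zset_divides fp hb sub).
apply/seteqP; split=> // x; rewrite qE zset_mul => -[] //.
have [c c0 ->] := mpoly_unit_const uu.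
by rewrite /zset /= pevalC => e; rewrite e eqxx in c0.
Qed.

(** A proper irreducible closed set containing the locus of [p] lies in the locus of a prime form q.
    Then [p] divides q, the two are associated, and nothing lies strictly between. *)
Lemma not_chain2_zset p : form_prime p -> ~ chain_above 2 (zs p).
Proof.
move=> fp [B1 [iB1 [sB1 nB1] cB1]]; have [x nx] := @chain_above_top 0 B1 cB1.
have [q fq Bq] := irreducible_sub_zset iB1 nx.
by apply: nB1; rewrite (zset_assoc fp fq (subset_trans sB1 Bq)).
Qed.

Lemma prime_divisor_zset p : form_prime p -> prime_divisor (zs p).
Proof.
move=> fp; have U0 : U !=set0 by case: fp => _ _ [z]; exists z.
split; [exact: zset_irreducible| |exact: not_chain2_zset].
by exists [set: X]; split=> //; [exact: setT_irreducible_closed|exact: zset_proper].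
Qed.

(** [Z] lies in the locus of some prime form; were the inclusion strict, that locus and [X] would
    give a chain of length 2 above [Z]. *)
Lemma prime_divisorP (Z : set X) : prime_divisor Z -> exists2 p, form_prime p & Z = zs p.
Proof.
move=> [iZ cZ n2]; have [x nx] := @chain_above_top 0 Z cZ; have [p fp Zp] := irreducible_sub_zset iZ nx.
exists p => //; apply/seteqP; split=> // y py; apply: contrapT => nZy; apply: n2.
have U0 : U !=set0 by case: fp => _ _ [z]; exists z.
exists (zs p); split; [exact: zset_irreducible|by split=> // /(_ y py)|].
by exists [set: X]; split=> //; [exact: setT_irreducible_closed|exact: zset_proper].
Qed.

End Hypersurfaces.

Lemma order_identity (F : fieldType) (a b x y u v : F) : b != 0 -> y != 0 -> u != 0 -> v != 0 ->
  a * x / (b * y) = a * u / (b * v) * (x / u / (y / v)).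
Proof. by move=> b0 y0 u0 v0; field; rewrite b0 y0 u0 v0. Qed.

Lemma order_identity_pos (F : fieldType) (a b u v x y : F) (m : nat) :
  b != 0 -> x != 0 -> y != 0 -> v != 0 -> a / b = u / v * (x / y) ^ Posz m ->
  a * (v * y ^+ m) = b * (u * x ^+ m).
Proof.
move=> b0 x0 y0 v0; rewrite -exprnP expr_div_n => e; rewrite -[a](divfK b0) e.
by have ym := expf_neq0 m y0; field; rewrite ym v0.
Qed.

Lemma order_identity_neg (F : fieldType) (a b u v x y : F) (m : nat) :
  b != 0 -> x != 0 -> y != 0 -> v != 0 -> a / b = u / v * (x / y) ^ Negz m ->
  a * (v * x ^+ m.+1) = b * (u * y ^+ m.+1).
Proof.
move=> b0 x0 y0 v0; rewrite NegzE -exprnN expr_div_n => e; rewrite -[a](divfK b0) e.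
have xm := expf_neq0 m.+1 x0; have ym := expf_neq0 m.+1 y0.
by move: (x ^+ m.+1) (y ^+ m.+1) xm ym => x' y' x'0 y'0; field; rewrite x'0 y'0 v0.
Qed.

Lemma peval_monomial (F : fieldType) n (C D E : mpoly n F) m z :
  peval (C * (D * E ^+ m)) z = peval C z * (peval D z * peval E z ^+ m).
Proof. by rewrite pevalM (pevalM D) pevalX. Qed.

(** * Orders of rational functions along prime divisors *)

Section Orders.
Variables (K : closedFieldType).
Hypothesis hK : [pchar K] =i pred0.
Variables (X : kspace K) (nX : nice X) (n r : nat) (w : 'I_n -> 'rV[int]_r).
Variables (U : set (affine_space K n)) (pi : affine_space K n -> X).
Hypothesis pr : presentation w U pi.

Local Notation hom := (whomog (K := K) w).
Local Notation zs := (zset U pi).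
Local Notation form_prime := (form_prime w U).
Local Notation fr := (form_frac U pi).
Local Notation ufd := (@ufd_mpoly K n).

Lemma pr_pull_nonempty (O : set X) : O !=set0 -> U `&` pi @^-1` O !=set0.
Proof. by move=> [x Ox]; have [z Uz zx] := pr_surj pr x; exists z; split=> //=; rewrite zx. Qed.

Lemma pr_meet (O1 O2 : set X) : open O1 -> open O2 -> O1 !=set0 -> O2 !=set0 -> O1 `&` O2 !=set0.
Proof.
move=> o1 o2 /pr_pull_nonempty n1 /pr_pull_nonempty n2.
have [z [[Uz O1z] [_ O2z]]] := affine_meet hK (pr_cont pr o1) (pr_cont pr o2) n1 n2.
by exists (pi z).
Qed.

Lemma rational_eq_trans (f g h : X -> K) : rational_eq f g -> rational_eq g h -> rational_eq f h.
Proof.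
move=> [V1 [o1 n1 e1]] [V2 [o2 n2 e2]]; exists (V1 `&` V2).
by split; [exact: openI|exact: pr_meet|move=> x [? ?]; rewrite e1 ?e2].
Qed.

Lemma rational_eq_sym (f g : X -> K) : rational_eq f g -> rational_eq g f.
Proof. by move=> [V [o nV e]]; exists V; split=> // x /e. Qed.

Lemma compl_zset_nonempty a F : U !=set0 -> hom a F -> F != 0 -> ~` zs F !=set0.
Proof.
move=> U0 hF F0; have [y Fy] := peval_nonzero hK F0.
have ne : ([set z | peval F z != 0] : set (affine_space K n)) !=set0 by exists y.
have [z [Uz Fz]] := affine_meet hK (pr_open pr) (open_basic F) U0 ne.
by exists (pi z) => /(zset_pi pr hF Uz)/eqP; apply/negP.
Qed.

Lemma notin_zset a F z : hom a F -> U z -> ~ zs F (pi z) -> peval F z != 0.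
Proof. by move=> hF Uz nz; apply/eqP => /(zset_pi pr hF Uz). Qed.

Lemma zset_notin a F z : hom a F -> U z -> peval F z != 0 -> (~` zs F) (pi z).
Proof. by move=> hF Uz /eqP Fz /(zset_pi pr hF Uz). Qed.

Lemma rational_frac a A B : U !=set0 -> hom a A -> hom a B -> B != 0 -> rational (fr A B).
Proof.
move=> U0 hA hB B0; exists (~` zs B).
split; [exact: (open_zset nX pr hB)|exact: (compl_zset_nonempty U0 hB B0)|exact: (regular_frac nX pr hA hB)].
Qed.

Lemma rational_eq_fracI a (f : X -> K) (O : set X) A B : open O -> O !=set0 -> hom a A -> hom a B -> B != 0 ->
  (forall z, U z -> O (pi z) -> peval B z != 0 -> f (pi z) = peval A z / peval B z) ->
  rational_eq f (fr A B).
Proof.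
move=> oO O0 hA hB B0 h; have oB := open_zset nX pr hB.
have U0 : U !=set0 by have [z [Uz _]] := pr_pull_nonempty O0; exists z.
exists (O `&` ~` zs B); split; [exact: openI|exact: pr_meet oO oB O0 (compl_zset_nonempty U0 hB B0)|].
move=> x [Ox Bx]; have [z Uz zx] := pr_surj pr x; rewrite -zx in Ox Bx *.
by rewrite (form_frac_pi pr hA hB Uz) h //; apply: notin_zset hB Uz Bx.
Qed.

Lemma rational_eq_fracE a (f : X -> K) A B : hom a A -> hom a B -> rational_eq f (fr A B) ->
  exists O, [/\ open O, O !=set0 &
    forall z, U z -> O (pi z) -> f (pi z) = peval A z / peval B z].
Proof.
move=> hA hB [V [oV V0 e]]; exists V; split=> // z Uz Vz.
by rewrite e // (form_frac_pi pr hA hB Uz).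
Qed.

Lemma frac_cross a b (f : X -> K) A B C D : hom a A -> hom a B -> hom b C -> hom b D -> B != 0 -> D != 0 ->
  rational_eq f (fr A B) -> rational_eq f (fr C D) -> A * D = C * B.
Proof.
move=> hA hB hC hD B0 D0 /(rational_eq_fracE hA hB)[O1 [o1 n1 e1]] /(rational_eq_fracE hC hD)[O2 [o2 n2 e2]].
have [y BDy] := peval_nonzero hK (mulf_neq0 B0 D0).
have ne : ([set z | peval (B * D) z != 0] : set (affine_space K n)) !=set0 by exists y.
have o12 := openI o1 o2; have oP := pr_cont pr o12.
have n12 := pr_pull_nonempty (pr_meet o1 o2 n1 n2).
apply: (mpoly_eq_open hK (openI oP (open_basic (B * D))) (affine_meet hK oP (open_basic (B * D)) n12 ne)).
move=> z [[Uz [O1z O2z]]]; rewrite /= !pevalM mulf_eq0 negb_or => /andP[Bz Dz].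
by have /eqP := e1 z Uz O1z; rewrite e2 // eqr_div // => /eqP ->.
Qed.

Definition represents (f : X -> K) A B := [/\ exists2 a, hom a A & hom a B, A != 0, B != 0 &
  rational_eq f (fr A B)].

Lemma rational_represents (f : X -> K) : rational f -> ~ rational_eq f (fun=> 0) ->
  exists A B, represents f A B.
Proof.
move=> [V [oV V0 rf]] nf; have [a [A [B [hA hB AB]]]] := pr_regular_fraction hK pr oV V0 rf.
have [z [Uz Vz]] := pr_pull_nonempty V0.
have B0 : B != 0 by have [Bz _] := AB z Uz Vz; apply: contraNneq Bz => ->; rewrite peval0.
exists A, B; split=> //; [by exists a| |].
  apply/eqP => A0; apply: nf; exists V; split=> // x Vx; have [y Uy yx] := pr_surj pr x.
  by rewrite -yx in Vx *; have [_ ->] := AB y Uy Vx; rewrite A0 peval0 mul0r.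
by apply: rational_eq_fracI oV V0 hA hB B0 _ => y Uy Vy _; have [_ ->] := AB y Uy Vy.
Qed.

(** Supplies denominators: near any point of [U], a form can be divided by one of the same degree
    that does not vanish there. *)
Hypothesis mono : forall a F z, F != 0 -> hom a F -> U z -> exists2 M, hom a M & peval M z != 0.

(** A regular function vanishing on the locus of [p] is a fraction with numerator divisible by [p],
    hence a multiple of p / M. The form [N] serves to shrink the neighbourhood. *)
Lemma uniformizer_frac p b M c N z0 : form_prime p -> hom b p -> hom b M -> hom c N ->
  U z0 -> peval p z0 = 0 -> peval (M * N) z0 != 0 ->
  uniformizer (zs p) (~` zs (M * N)) (fr p M).
Proof.
move=> fp hp hM hN Uz0 pz0 MNz0; have [pp _ _] := fp.
have hMN := whomogM hK hM hN; have oV := open_zset nX pr hMN.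
have VM : ~` zs (M * N) `<=` ~` zs M by move=> x; rewrite zset_mul => nx Mx; apply: nx; left.
split=> //.
- exists (pi z0); split; first exact/(zset_pi pr hp Uz0).
  exact: zset_notin hMN Uz0 MNz0.
- by apply: (regular_sub nX oV (open_zset nX pr hM) VM); apply: (regular_frac nX pr hp hM).
- by move=> x px _; rewrite /form_frac; move: px; rewrite /zset /= => ->; rewrite mul0r.
move=> V1 g oV1 [x1 [Zx1 Vx1]] rg g0.
have V10 : V1 !=set0 by exists x1.
have [a [G1 [G2 [h1 h2 GE]]]] := pr_regular_fraction hK pr oV1 V10 rg.
have [z1 Uz1 zx1] := pr_surj pr x1; rewrite -zx1 in Zx1 Vx1.
have pz1 := (zset_pi pr hp Uz1).1 Zx1.
have oO1 := pr_cont pr oV1.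
have [G1' G1E] : divides p G1.
  apply: (divides_of_zeros hK pp oO1 (z0 := z1)) => // z [Uz Vz] pz.
  have [G2z] := GE z Uz Vz; rewrite g0 //; last exact/(zset_pi pr hp Uz).
  by move/esym/eqP; rewrite mulf_eq0 invr_eq0 (negbTE G2z) orbF => /eqP.
have [z2 [Uz2 Vz2] [pz2 MNz2]] : exists2 z, (U `&` pi @^-1` V1) z & peval p z = 0 /\ peval (M * N) z != 0.
  apply: contrapT => nex; apply: (not_divides_of_value pz0 MNz0).
  apply: (divides_of_zeros hK pp oO1 (z0 := z1)) => // z Oz pz.
  by apply/eqP; apply: contrapT => /negP nz; apply: nex; exists z.
have hG1M : hom a (G1' * M).
  apply: (whomog_cancel hK (b := b) (Q := p)) => //; last by case: pp.
  by rewrite mulrAC -G1E; apply: whomogM.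
exists (V1 `&` ~` zs (M * N)), (fr (G1' * M) G2); split=> //.
- exact: openI.
- exists (pi z2); split; first exact/(zset_pi pr hp Uz2).
  by split=> //; apply: zset_notin hMN Uz2 MNz2.
- have oI := openI oV1 oV; apply: (regular_sub nX oI (open_zset nX pr h2) _ (regular_frac nX pr hG1M h2)).
  move=> x [V1x _]; have [z Uz zx] := pr_surj pr x; rewrite -zx in V1x *.
  by have [G2z _] := GE z Uz V1x; apply: zset_notin h2 Uz G2z.
move=> x [V1x Vx]; have [z Uz zx] := pr_surj pr x; rewrite -zx in V1x Vx *.
have [G2z ->] := GE z Uz V1x; have Mz := notin_zset hM Uz (VM _ Vx).
by rewrite (form_frac_pi pr hG1M h2 Uz) (form_frac_pi pr hp hM Uz) G1E !pevalM; field; rewrite ?G2z ?Mz.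
Qed.

(** Write A = A' p^i and B = B' p^j. The uniformizer is p / M, and the unit is (A' M^i) / (B' M^j),
    whose powers of [M] restore equal degrees. *)
Lemma has_order_represents p f A B : form_prime p -> represents f A B ->
  has_order (zs p) f ((vp p A)%:Z - (vp p B)%:Z).
Proof.
move=> fp [[a hA hB] A0 B0 fAB]; have [pp [b hp] [zU Uz pzU]] := fp.
have p0 : p != 0 by case: pp.
have [A' [AE nA']] := vpP ufd pp A0; have [B' [BE nB']] := vpP ufd pp B0.
set i := vp p A in AE *; set j := vp p B in BE *.
have A'0 : A' != 0 by apply/eqP => e; apply: nA'; rewrite e; exists 0; rewrite mul0r.
have B'0 : B' != 0 by apply/eqP => e; apply: nB'; rewrite e; exists 0; rewrite mul0r.
have [a' hA'] : exists a', hom a' A'.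
  by apply: (whomog_factor hK (a := a) (Q := p ^+ i)); rewrite -AE.
have [b' hB'] : exists b', hom b' B'.
  by apply: (whomog_factor hK (a := a) (Q := p ^+ j)); rewrite -BE.
have ea : a = a' + b *+ i by apply: (whomog_uniq A0 hA); rewrite AE; apply: whomogM => //; apply: whomogX.
have eb : a = b' + b *+ j by apply: (whomog_uniq B0 hB); rewrite BE; apply: whomogM => //; apply: whomogX.
have [z0 Uz0 [pz0 ABz0]] : exists2 z, U z & peval p z = 0 /\ peval (A' * B') z != 0.
  apply: contrapT => nex; have : divides p (A' * B').
    apply: (divides_of_zeros hK pp (pr_open pr) Uz pzU) => z Uz' pz.
    by apply/eqP; apply: contrapT => /negP nz; apply: nex; exists z.
  by case: pp => _ _ pM /pM[].
have [M hM Mz0] := mono p0 hp Uz0.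
have hAB' := whomogM hK hA' hB'; have hMAB := whomogM hK hM hAB'.
have uni : uniformizer (zs p) (~` zs (M * (A' * B'))) (fr p M).
  by apply: uniformizer_frac hp hM hAB' Uz0 pz0 _ => //; rewrite pevalM mulf_neq0.
have hN : hom a (A' * M ^+ i) by rewrite ea; apply: whomogM => //; apply: whomogX.
have hD : hom a (B' * M ^+ j) by rewrite eb; apply: whomogM => //; apply: whomogX.
have val z : U z -> (~` zs (M * (A' * B'))) (pi z) -> [/\ peval M z != 0, peval A' z != 0 & peval B' z != 0].
  move=> Uz' nz; have := notin_zset hMAB Uz' nz.
  by rewrite !pevalM !mulf_eq0 !negb_or => /and3P[].
exists (~` zs (M * (A' * B'))), (fr p M), (fr (A' * M ^+ i) (B' * M ^+ j)); split=> //.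
- apply: (regular_sub nX (open_zset nX pr hMAB) (open_zset nX pr hD) _ (regular_frac nX pr hN hD)).
  move=> x nx; have [z Uz' zx] := pr_surj pr x; rewrite -zx in nx *; have [Mz Az Bz] := val z Uz' nx.
  by apply: zset_notin hD Uz' _; rewrite pevalM pevalX mulf_neq0 ?expf_neq0.
- move=> x nx; have [z Uz' zx] := pr_surj pr x; rewrite -zx in nx *; have [Mz Az Bz] := val z Uz' nx.
  by rewrite (form_frac_pi pr hN hD Uz') !pevalM !pevalX !mulf_neq0 ?invr_eq0 ?expf_neq0 ?mulf_neq0 ?expf_neq0.
have [O [oO O0 fE]] := rational_eq_fracE hA hB fAB.
have U0 : U !=set0 by exists z0.
have hpM := whomogM hK hp hMAB; have opM := open_zset nX pr hpM.
have npM : p * (M * (A' * B')) != 0.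
  by rewrite !mulf_neq0 //; apply: contraNneq Mz0 => ->; rewrite peval0.
exists (O `&` ~` zs (p * (M * (A' * B')))); split.
- exact: openI.
- exact: pr_meet oO opM O0 (compl_zset_nonempty U0 hpM npM).
move=> x [Ox nx]; have [z Uz' zx] := pr_surj pr x; rewrite -zx in Ox nx *.
have := notin_zset hpM Uz' nx; rewrite !pevalM !mulf_eq0 !negb_or => /and4P[pz Mz Az Bz].
rewrite fE // (form_frac_pi pr hN hD Uz') (form_frac_pi pr hp hM Uz') AE BE !pevalM !pevalX.
have q0 : peval p z / peval M z != 0 by rewrite mulf_neq0 ?invr_eq0.
rewrite expfzDr // -exprnN -exprnP !expr_div_n.
by apply: order_identity => //; apply: expf_neq0.
Qed.

(** Since [ord] picks any admissible value, all must agree. The numerator [T1] of an arbitrary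
    uniformizer contains [p] exactly once; comparing valuations in the identity for [f] with
    denominators cleared then gives [k]. *)
Lemma has_order_uniq p f A B k : form_prime p -> represents f A B ->
  has_order (zs p) f k -> k = (vp p A)%:Z - (vp p B)%:Z.
Proof.
move=> fp [[a hA hB] A0 B0 fAB] [V [t [u [[oV [x0 [Zx0 Vx0]] rt t0 gen] ru u0 fE]]]].
have [pp [b hp] _] := fp; have p0 : p != 0 by case: pp.
have V0 : V !=set0 by exists x0.
have [d [T1 [T2 [hT1 hT2 TE]]]] := pr_regular_fraction hK pr oV V0 rt.
have [e [U1 [U2 [hU1 hU2 UE]]]] := pr_regular_fraction hK pr oV V0 ru.
have [z0 Uz0 zx0] := pr_surj pr x0; rewrite -zx0 in Zx0 Vx0.
have pz0 := (zset_pi pr hp Uz0).1 Zx0; have oO := pr_cont pr oV.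
have [T2z0 _] := TE _ Uz0 Vx0; have [U2z0 uz0] := UE _ Uz0 Vx0.
have U1z0 : peval U1 z0 != 0 by have := u0 _ Vx0; rewrite uz0 mulf_eq0 negb_or => /andP[].
have nz (F : mpoly n K) : peval F z0 != 0 -> F != 0 by move=> h; apply: contraNneq h => ->; rewrite peval0.
have v0 F : peval F z0 != 0 -> vp p F = 0%N.
  by move=> h; apply: (vp0 ufd pp (nz _ h)); exact: not_divides_of_value h.
have [T1' T1E] : divides p T1.
  apply: (divides_of_zeros hK pp oO (z0 := z0)) => // z [Uz Vz] pz.
  have [T2z] := TE z Uz Vz; rewrite t0 //; last exact/(zset_pi pr hp Uz).
  by move/esym/eqP; rewrite mulf_eq0 invr_eq0 (negbTE T2z) orbF => /eqP.
have [M hM Mz0] := mono p0 hp Uz0.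
have [|||V2 [h [oV2 sV2 [x2 [Zx2 Vx2]] rh hE]]] := gen (~` zs M) (fr p M) (open_zset nX pr hM).
- exists (pi z0); split=> //; exact: zset_notin hM Uz0 Mz0.
- exact: (regular_frac nX pr hp hM).
- by move=> x px _; rewrite /form_frac; move: px; rewrite /zset /= => ->; rewrite mul0r.
have V20 : V2 !=set0 by exists x2.
have [c [H1 [H2 [hH1 hH2 HE]]]] := pr_regular_fraction hK pr oV2 V20 rh.
have E1 : H2 * T2 = H1 * T1' * M.
  apply: (mulfI p0); have -> : p * (H1 * T1' * M) = H1 * T1 * M by rewrite T1E; ring.
  apply: (mpoly_eq_open hK (pr_cont pr oV2) (pr_pull_nonempty V20)) => z [Uz V2z].
  have [H2z hz] := HE z Uz V2z; have [nM Vz] := sV2 _ V2z; have [T2z tz] := TE z Uz Vz.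
  have Mz := notin_zset hM Uz nM.
  have := hE _ V2z; rewrite (form_frac_pi pr hp hM Uz) hz tz => e3.
  rewrite !pevalM -[peval p z](divfK Mz) e3; field; rewrite ?H2z ?T2z //.
(* By [E1], a second factor [p] in [T1] would divide [H2 * T2], which is nonzero at some zero of
   [p]. *)
have nT1' : ~ divides p T1'.
  move=> dT; have : divides p (H2 * T2) by rewrite E1; apply/divides_mulr/divides_mull.
  have [z2 Uz2 zx2] := pr_surj pr x2; rewrite -zx2 in Zx2 Vx2.
  have pz2 := (zset_pi pr hp Uz2).1 Zx2; have [_ Vz2] := sV2 _ Vx2.
  have [H2z _] := HE z2 Uz2 Vx2; have [T2z _] := TE z2 Uz2 Vz2.
  by apply: (not_divides_of_value pz2); rewrite pevalM mulf_neq0.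
have T1'0 : T1' != 0 by apply/eqP => e0; apply: nT1'; rewrite e0; exists 0; rewrite mul0r.
have T10 : T1 != 0 by rewrite T1E mulf_neq0.
have vT1 : vp p T1 = 1%N by apply: (vpE ufd pp T10 (G := T1')) => //; rewrite expr1.
have [O1 [o1 n1 e1]] := rational_eq_fracE hA hB fAB; have [O2 [o2 n2 e2]] := fE.
have o12 := openI oV (openI o1 o2).
have n12 := pr_pull_nonempty (pr_meet oV (openI o1 o2) V0 (pr_meet o1 o2 n1 n2)).
have [y BTy] := peval_nonzero hK (mulf_neq0 B0 T10).
have ne : ([set z | peval (B * T1) z != 0] : set (affine_space K n)) !=set0 by exists y.
have oP := pr_cont pr o12.
pose G : set (affine_space K n) := (U `&` pi @^-1` (V `&` (O1 `&` O2))) `&` [set z | peval (B * T1) z != 0].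
have oG : open G := openI oP (open_basic (B * T1)).
have G0 : G !=set0 := affine_meet hK oP (open_basic (B * T1)) n12 ne.
have ident P Q : (forall z, G z -> peval P z = peval Q z) -> P = Q := mpoly_eq_open hK oG G0.
have local z : G z ->
  [/\ peval A z / peval B z = peval U1 z / peval U2 z * (peval T1 z / peval T2 z) ^ k,
      peval B z != 0, peval T1 z != 0, peval T2 z != 0 & peval U2 z != 0].
  move=> [[Uz [Vz [O1z O2z]]]]; rewrite /= pevalM mulf_eq0 negb_or => /andP[Bz Tz].
  have [T2z tz] := TE z Uz Vz; have [U2z uz] := UE z Uz Vz.
  by split=> //; rewrite -uz -tz -e1 // e2.
have [T20 U10 U20] : [/\ T2 != 0, U1 != 0 & U2 != 0] by rewrite !nz.
have [vU1 vU2 vT2] := And3 (v0 _ U1z0) (v0 _ U2z0) (v0 _ T2z0).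
have vE C D E m : C != 0 -> D != 0 -> E != 0 ->
    vp p (C * (D * E ^+ m)) = (vp p C + (vp p D + m * vp p E))%N.
  by move=> C0 D0 E0; rewrite (vpM ufd pp C0) ?mulf_neq0 ?expf_neq0 // (vpM ufd pp D0) ?expf_neq0 // (vpX ufd _ pp).
case: k local {fE e2} => m local.
  have e3 : A * (U2 * T2 ^+ m) = B * (U1 * T1 ^+ m).
    apply: ident => z Gz; have [E2 Bz T1z T2z U2z] := local z Gz.
    apply: etrans (peval_monomial A U2 T2 m z) _; apply: etrans _ (esym (peval_monomial B U1 T1 m z)).
    exact: order_identity_pos E2.
  have := etrans (esym (vE A U2 T2 m A0 U20 T20)) (etrans (congr1 (vp p) e3) (vE B U1 T1 m B0 U10 T10)).
  by rewrite vU1 vU2 vT2 vT1; move: (vp p A) (vp p B) => a1 b1; clear; lia.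
have e3 : A * (U2 * T1 ^+ m.+1) = B * (U1 * T2 ^+ m.+1).
  apply: ident => z Gz; have [E2 Bz T1z T2z U2z] := local z Gz.
  apply: etrans (peval_monomial A U2 T1 m.+1 z) _; apply: etrans _ (esym (peval_monomial B U1 T2 m.+1 z)).
  exact: order_identity_neg E2.
have := etrans (esym (vE A U2 T1 m.+1 A0 U20 T10)) (etrans (congr1 (vp p) e3) (vE B U1 T2 m.+1 B0 U10 T20)).
by rewrite vU1 vU2 vT2 vT1; move: (vp p A) (vp p B) => a1 b1; clear; lia.
Qed.

Lemma ord_represents p f A B : form_prime p -> represents f A B ->
  ord (zs p) f = (vp p A)%:Z - (vp p B)%:Z.
Proof.
move=> fp rf; have h := has_order_represents fp rf.
by apply: has_order_uniq fp rf _; apply: (xgetPex 0); exists ((vp p A)%:Z - (vp p B)%:Z).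
Qed.

End Orders.

Section DivisorForms.
Variables (K : closedFieldType).
Hypothesis hK : [pchar K] =i pred0.
Variables (X : kspace K) (nX : nice X) (n r : nat) (w : 'I_n -> 'rV[int]_r).
Variables (U : set (affine_space K n)) (pi : affine_space K n -> X).
Hypothesis pr : presentation w U pi.
Hypothesis mono : forall a (F : mpoly n K) z, F != 0 -> whomog w a F -> U z -> exists2 M : mpoly n K, whomog w a M & peval M z != 0.
(** Expresses that the complement of [U] contains no hypersurface defined by a prime form, so that
    every such prime gives a divisor on [X]. *)
Hypothesis meets : forall (p : mpoly n K) a, prime_elt p -> whomog w a p -> exists2 z, U z & peval p z = 0.
Hypothesis U0 : U !=set0.

Local Notation hom := (whomog (K := K) w).
Local Notation zs := (zset U pi).
Local Notation fprime := (form_prime w U).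
Local Notation fr := (form_frac U pi).
Local Notation ufd := (@ufd_mpoly K n).

Lemma vp_zset p q : fprime p -> fprime q -> vp p q = (zs p == zs q) :> nat.
Proof.
move=> fp fq; have [pp _ _] := fp; have [pq [b hb] _] := fq; have q0 : q != 0 by case: pq.
have [e|ne] := eqVneq (zs p) (zs q).
  have dpq : divides p q by apply: (zset_divides hK pr fp hb); rewrite e.
  have [u uu ->] := prime_assoc pp pq dpq.
  have u0 : u != 0 by apply: contraTneq uu => ->; rewrite unitr0.
  have p0 : p != 0 by case: pp.
  by rewrite (vpM ufd pp u0 p0) (vp_unit ufd pp uu) (vp_self ufd pp).
apply: (vp0 ufd pp q0) => dpq; case/eqP: ne; apply: (zset_assoc hK pr fp fq).
by have [c ->] := dpq => x px; rewrite zset_mul; right.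
Qed.

(** Positive and negative parts of an integer, used as exponents in a numerator and a
    denominator. *)
Definition posp (c : int) : nat := if 0 <= c then absz c else 0%N.
Definition negp (c : int) : nat := if 0 <= c then 0%N else absz c.

Lemma pospB c : (posp c)%:Z - (negp c)%:Z = c.
Proof. by rewrite /posp /negp; case: ifP; lia. Qed.

(** Upstairs every prime divisor is principal, so [D] is the divisor of a fraction of forms,
    possibly of different degrees. The difference of the degrees is the class of [D]. *)
Lemma divisor_pair (D : set X -> int) : divisor D -> exists N E d e,
  [/\ N != 0, E != 0, hom d N, hom e E &
   forall p, fprime p -> D (zs p) = (vp p N)%:Z - (vp p E)%:Z].
Proof.
move=> [/finite_seqP[s0 sE] pD]; pose s := undup s0.
have sP Z : (Z \in s) = (D Z != 0).
  rewrite mem_undup; have : [set Z | D Z != 0] Z <-> [set` s0] Z by rewrite sE.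
  by move=> [h1 h2]; apply/idP/idP => [/h2|/h1].
have /choice[q qP] : forall Z, exists q, D Z != 0 -> fprime q /\ Z = zs q.
  move=> Z; have [DZ|DZ] := eqVneq (D Z) 0; first by exists 0.
  by have [q fq ZE] := prime_divisorP hK nX pr (pD Z DZ); exists q.
have fq Z : Z \in s -> fprime (q Z) by rewrite sP => /qP[].
have zq Z : Z \in s -> zs (q Z) = Z by rewrite sP => /qP[].
have /choice[b hb] : forall Z, exists b, Z \in s -> hom b (q Z).
  by move=> Z; have [/fq[_ [b hb] _]|nZ] := boolP (Z \in s); [exists b|exists 0].
have main (c : set X -> nat) : exists N d, [/\ N != 0, hom d N &
    forall p, fprime p -> vp p N = if zs p \in s then c (zs p) else 0%N].
  have q0 Z : Z \in s -> q Z ^+ c Z != 0 by move=> /fq[[? _ _] _ _]; rewrite expf_neq0.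
  exists (\prod_(Z <- s | Z \in s) q Z ^+ c Z), (\sum_(Z <- s | Z \in s) b Z *+ c Z); split.
  - by elim/big_rec: _ => [|Z x Zs x0]; [exact: oner_neq0|rewrite mulf_neq0 ?q0].
  - by apply: (whomog_prod hK) => Z Zs; apply: (whomogX hK); apply: hb.
  move=> p fp; have [pp _ _] := fp; rewrite (vp_prod ufd s pp q0).
  rewrite (eq_bigr (fun Z => (c Z * (zs p == Z))%N)) => [|Z Zs]; last first.
    by have [[? _ _] _ _] := fq Z Zs; rewrite (vpX ufd _ pp) // (vp_zset fp (fq _ Zs)) zq.
  rewrite -big_seq; case: ifPn => ps.
    rewrite (bigD1_seq (zs p)) ?undup_uniq //= eqxx muln1 big1 ?addn0 // => Z.
    by rewrite eq_sym => /negbTE ->; rewrite muln0.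
  by rewrite big_seq big1 // => Z Zs; case: eqP => [e|_]; rewrite ?muln0 //; rewrite e Zs in ps.
have [N [d [N0 hN vN]]] := main (posp \o D); have [E [e [E0 hE vE]]] := main (negp \o D).
exists N, E, d, e; split=> // p fp; rewrite vN // vE // sP.
by have [->|_] := eqVneq (D (zs p)) 0; rewrite /= ?pospB.
Qed.

(** The prime factors of [B] are forms and by [meets] are detected on [X]; they are removed from [A]
    and [B] one at a time. *)
Lemma divides_vp A B b : A != 0 -> B != 0 -> hom b B ->
  (forall p, fprime p -> (vp p B <= vp p A)%N) -> divides B A.
Proof.
move=> A0 B0 hB; have [u [s [uu sp BE]]] := ufd B0.
elim: s u A B b uu sp BE A0 B0 hB => [|q s IH] u A B b uu sp BE A0 B0 hB h.
  by rewrite BE big_nil mulr1; exists (A / u); rewrite divrK.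
have pq := sp q (mem_head _ _); have q0 : q != 0 by case: pq.
pose B1 := u * \prod_(x <- s) x.
have BE1 : B = q * B1 by rewrite BE big_cons mulrCA.
have B10 : B1 != 0 by apply: contraNneq B0 => e; rewrite BE1 e mulr0.
have B0' : q * B1 != 0 by rewrite -BE1.
have hB' : hom b (q * B1) by rewrite -BE1.
have [c hq] := whomog_factor hK hB' B0'.
have fq : fprime q by split=> //; [exists c|apply: meets pq hq].
have hB1 : hom (b - c) B1.
  by apply: (whomog_cancel hK (b := c) (Q := q)) => //; rewrite subrK mulrC.
have [A1 A1E] : divides q A.
  apply/(vp_gt0 ufd pq A0); apply: leq_trans (h q fq).
  by rewrite BE1 (vpM ufd pq q0 B10) (vp_self ufd pq).
have A10 : A1 != 0 by apply: contraNneq A0 => e; rewrite A1E e mul0r.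
have sp' x : x \in s -> prime_elt x by move=> xs; apply: sp; rewrite inE xs orbT.
have [|c' c'E] := IH u A1 B1 (b - c) uu sp' erefl A10 B10 hB1.
  move=> p fp; have [pp _ _] := fp; have := h p fp.
  by rewrite BE1 A1E (vpM ufd pp q0 B10) (vpM ufd pp A10 q0) addnC leq_add2r.
by exists c'; rewrite A1E c'E BE1; ring.
Qed.

Section OneDivisor.
Variables (D : set X -> int) (N E : mpoly n K) (d e : 'rV[int]_r).
Hypotheses (N0 : N != 0) (E0 : E != 0) (hN : hom d N) (hE : hom e E).
Hypothesis DE : forall p, fprime p -> D (zs p) = (vp p N)%:Z - (vp p E)%:Z.

Lemma frac_hom F : hom (d - e) F -> hom d (F * E).
Proof. by move=> hF; rewrite -(subrK e d); apply: whomogM. Qed.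

(** As [D] is the divisor of N / E, multiplication by E / N turns forms of degree [d - e] into
    sections of [D]; [section_frac] is the converse. *)
Lemma frac_section F : hom (d - e) F -> sections setT D (fr (F * E) N).
Proof.
move=> hF; have hFE := frac_hom hF; split; first exact: (rational_frac hK nX pr U0 hFE hN N0).
have [F0|F0] := eqVneq F 0.
  left; exists setT; split; [exact: openT|by have [z Uz] := U0; exists (pi z)|].
  by move=> x _; rewrite /form_frac F0 mul0r peval0 mul0r.
right=> Z pZ _; have [p fp ->] := prime_divisorP hK nX pr pZ; have [pp _ _] := fp.
have rep : represents w U pi (fr (F * E) N) (F * E) N.
  split=> //; [by exists d|by rewrite mulf_neq0|].
  by exists setT; split=> //; [exact: openT|have [z Uz] := U0; exists (pi z)].
rewrite (ord_represents hK nX pr mono fp rep) DE // (vpM ufd pp F0 E0).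
by move: (vp p F) (vp p E) (vp p N) => x y u; clear; lia.
Qed.

Lemma section_frac f : sections setT D f -> exists2 F, hom (d - e) F & rational_eq f (fr (F * E) N).
Proof.
move=> [rf h]; have [f0|nf0] := pselect (rational_eq f (fun=> 0)).
  exists 0; first exact: whomog0.
  have [V [oV V0 fE]] := f0; exists V; split=> // x Vx; rewrite fE //.
  by rewrite /form_frac mul0r peval0 mul0r.
have [A [B [[a hA hB] A0 B0 fAB]]] := rational_represents hK nX pr rf nf0.
have rep : represents w U pi f A B by split=> //; exists a.
(* Nonnegativity of the order of [f] plus [D] at every prime form is exactly this divisibility. *)
have [F FE] : divides (B * E) (A * N).
  apply: (divides_vp _ _ (whomogM hK hB hE)); rewrite ?mulf_neq0 // => p fp.
  have [pp _ [z Uz pz]] := fp; case: h => // /(_ _ (prime_divisor_zset hK nX pr fp)).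
  have Zne : zs p `&` setT !=set0.
    exists (pi z); split=> //; have [_ [b hb] _] := fp; exact/(zset_pi pr hb Uz).
  move=> /(_ Zne); rewrite (ord_represents hK nX pr mono fp rep) DE //.
  rewrite (vpM ufd pp B0 E0) (vpM ufd pp A0 N0).
  by move: (vp p A) (vp p B) (vp p E) (vp p N) => x y u v; clear; lia.
have hF : hom (d - e) F.
  apply: (whomog_cancel hK (b := a + e) (Q := B * E)); [|exact: whomogM|by rewrite mulf_neq0].
  by rewrite -FE addrCA subrK; apply: whomogM.
exists F => //; have [O [oO O0 fE]] := rational_eq_fracE pr hA hB fAB.
have oB := open_zset nX pr hB.
have oOB := openI oO oB; have OB0 := pr_meet hK pr oO oB O0 (compl_zset_nonempty hK pr U0 hB B0).
apply: (rational_eq_fracI hK nX pr oOB OB0 (frac_hom hF) hN N0) => z Uz [Oz nBz] Nz.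
have Bz := notin_zset pr hB Uz nBz; rewrite fE //; apply/eqP; rewrite eqr_div //.
by rewrite -!pevalM FE; apply/eqP; congr peval; ring.
Qed.

End OneDivisor.

End DivisorForms.

Section Substitution.
Variable K : fieldType.

Definition subst m n (F : 'I_m -> mpoly n K) : mpoly m K -> mpoly n K := mmap (@mpolyC n K) F.

Lemma peval_subst m n (F : 'I_m -> mpoly n K) P z :
  peval (subst F P) z = meval (fun i => peval (F i) z) P.
Proof.
rewrite /subst {1}/mmap /mmap1 peval_sum mevalE; apply: eq_bigr => u _.
by rewrite pevalM pevalC peval_prod; congr (_ * _); apply: eq_bigr => i _; rewrite pevalX.
Qed.

End Substitution.

Lemma Posz_sum I (s : seq I) (P : pred I) (f : I -> nat) :
  (\sum_(i <- s | P i) f i)%N%:Z = \sum_(i <- s | P i) (f i)%:Z.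
Proof. exact: (big_morph Posz PoszD (erefl _)). Qed.

(** * Comparison of the given Cox ring with the ring of forms *)

Section CoxComparison.
Variables (K : closedFieldType).
Hypothesis hK : [pchar K] =i pred0.
Variables (X : kspace K) (nX : nice X) (n r : nat) (w : 'I_n -> 'rV[int]_r).
Variables (U : set (affine_space K n)) (pi : affine_space K n -> X).
Hypothesis pr : presentation w U pi.
Hypothesis mono : forall a (F : mpoly n K) z, F != 0 -> whomog w a F -> U z -> exists2 M : mpoly n K, whomog w a M & peval M z != 0.
Hypothesis meets : forall (p : mpoly n K) a, prime_elt p -> whomog w a p -> exists2 z, U z & peval p z = 0.
Hypothesis U0 : U !=set0.

Local Notation hom := (whomog (K := K) w).
Local Notation zs := (zset U pi).
Local Notation fprime := (form_prime w U).
Local Notation fr := (form_frac U pi).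
Local Notation ufd := (@ufd_mpoly K n).

Variables (rc : nat) (D : 'I_rc -> set X -> int) (nc : nat) (wc : 'I_nc -> 'rV[int]_rc).
Variable (sec : 'I_nc -> X -> K).
Hypothesis basis : Cl_basis D.
Hypothesis coords : Cox_coordinates D wc sec.

Lemma divisor_comb a : divisor (comb D a).
Proof.
have nz Z : comb D a Z != 0 -> exists j, D j Z != 0.
  move=> h; apply: contrapT => nex; move: h; rewrite /comb big1 ?eqxx // => j _.
  have [->|nj] := eqVneq (D j Z) 0; first by rewrite mulr0.
  by case: nex; exists j.
split=> [|Z /nz[j Dj]]; last by have [_ pj] := basis.1 j; apply: pj.
apply: (@sub_finite_set _ _ (\bigcup_(j in [set: 'I_rc]) [set Z | D j Z != 0])).
  by move=> Z /nz[j Dj]; exists j.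
by apply: bigcup_finite; [exact: finite_finset|move=> j _; case: (basis.1 j)].
Qed.

(* The divisor D_j on X is the divisor of the homogeneous fraction N_j/E_j. *)
Variables (N E : 'I_rc -> mpoly n K) (d e : 'I_rc -> 'rV[int]_r).
Hypotheses (N0 : forall j, N j != 0) (E0 : forall j, E j != 0).
Hypotheses (hN : forall j, hom (d j) (N j)) (hE : forall j, hom (e j) (E j)).
Hypothesis DE : forall j p, fprime p -> D j (zs p) = (vp p (N j))%:Z - (vp p (E j))%:Z.

(** Numerator, and next denominator, of the product of the (N_j / E_j)^(a_j), a fraction whose
    divisor is [comb D a]. *)
Definition comb_num (a : 'rV[int]_rc) := \prod_j (N j ^+ posp (a 0 j) * E j ^+ negp (a 0 j)).
Definition comb_den (a : 'rV[int]_rc) := \prod_j (E j ^+ posp (a 0 j) * N j ^+ negp (a 0 j)).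
Definition num_deg (a : 'rV[int]_rc) := \sum_j (d j *+ posp (a 0 j) + e j *+ negp (a 0 j)).
Definition den_deg (a : 'rV[int]_rc) := \sum_j (e j *+ posp (a 0 j) + d j *+ negp (a 0 j)).
(** The homomorphism from the class group, with basis the D_j, to the group of multidegrees. *)
Definition class_deg (a : 'rV[int]_rc) := \sum_j (d j - e j) *~ (a 0 j).

Lemma comb_num_neq0 a : comb_num a != 0.
Proof. by apply/prodf_neq0 => j _; rewrite mulf_neq0 ?expf_neq0. Qed.

Lemma comb_den_neq0 a : comb_den a != 0.
Proof. by apply/prodf_neq0 => j _; rewrite mulf_neq0 ?expf_neq0. Qed.

Lemma comb_num_hom a : hom (num_deg a) (comb_num a).
Proof. by apply: (whomog_prod hK) => j _; apply: (whomogM hK); apply: (whomogX hK). Qed.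

Lemma comb_den_hom a : hom (den_deg a) (comb_den a).
Proof. by apply: (whomog_prod hK) => j _; apply: (whomogM hK); apply: (whomogX hK). Qed.

Lemma class_degE a : class_deg a = num_deg a - den_deg a.
Proof.
rewrite -sumrB; apply: eq_bigr => j _.
rewrite -{1}(pospB (a 0 j)) mulrzBr -!pmulrn !mulrnBl.
by rewrite !opprD !opprK [RHS]addrACA; congr (_ + _); rewrite addrC.
Qed.

Lemma class_degD a b : class_deg (a + b) = class_deg a + class_deg b.
Proof. by rewrite -big_split; apply: eq_bigr => j _; rewrite mxE mulrzDr. Qed.

Lemma vp_comb a p : fprime p -> comb D a (zs p) = (vp p (comb_num a))%:Z - (vp p (comb_den a))%:Z.
Proof.
move=> fp; have [pp _ _] := fp.
have nz (F G : mpoly n K) x y : F != 0 -> G != 0 -> F ^+ x * G ^+ y != 0.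
  by move=> F0 G0; rewrite mulf_neq0 ?expf_neq0.
have vE F G x y : F != 0 -> G != 0 -> vp p (F ^+ x * G ^+ y) = (x * vp p F + y * vp p G)%N.
  by move=> F0 G0; rewrite (vpM ufd pp) ?expf_neq0 // !(vpX ufd _ pp).
rewrite /comb_num /comb_den (vp_prod ufd _ pp (fun j _ => nz _ _ _ _ (N0 j) (E0 j))).
rewrite (vp_prod ufd _ pp (fun j _ => nz _ _ _ _ (E0 j) (N0 j))).
rewrite !Posz_sum -sumrB; apply: eq_bigr => j _.
rewrite !vE // DE //; rewrite -{1}(pospB (a 0 j)).
by move: (posp _) (negp _) (vp p (N j)) (vp p (E j)) => x y u v; clear; lia.
Qed.

(** The fraction attached to the class a takes at [z] the value of the character of weight a at this
    torus point. *)
Definition ratio_point (z : affine_space K n) : 'rV[K]_rc := \row_j (peval (N j) z / peval (E j) z).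

Lemma ratio_torus z : (forall j, peval (N j) z != 0 /\ peval (E j) z != 0) -> torus (ratio_point z).
Proof. by move=> h j; have [Nz Ez] := h j; rewrite mxE mulf_neq0 ?invr_eq0. Qed.

Lemma comb_ratio a z : (forall j, peval (N j) z != 0 /\ peval (E j) z != 0) ->
  peval (comb_num a) z = tpow (ratio_point z) a * peval (comb_den a) z.
Proof.
move=> h; rewrite !peval_prod -big_split; apply: eq_bigr => j _ /=; have [Nz Ez] := h j.
rewrite mxE !pevalM !pevalX -{3}(pospB (a 0 j)).
rewrite expfzDr ?mulf_neq0 ?invr_eq0 // -exprnN -exprnP !expr_div_n.
move: (expf_neq0 (posp (a 0 j)) Ez) (expf_neq0 (negp (a 0 j)) Ez) (expf_neq0 (negp (a 0 j)) Nz).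
move: (peval (E j) z ^+ _) (peval (E j) z ^+ _) (peval (N j) z ^+ _) (peval (N j) z ^+ _) => x y u v x0 y0 v0.
by field; rewrite x0 y0 v0.
Qed.

Variable (F : 'I_nc -> mpoly n K).
Hypothesis hF : forall i, hom (class_deg (wc i)) (F i).
Hypothesis FE : forall i, rational_eq (sec i) (fr (F i * comb_den (wc i)) (comb_num (wc i))).

Lemma tpow_class (t : 'rV[K]_r) a : torus t -> tpow t (class_deg a) = tpow (\row_j tpow t (d j - e j)) a.
Proof.
move=> ht; rewrite /class_deg tpow_sum //; apply: eq_bigr => j _; rewrite mxE.
case: (a 0 j) => m; first by rewrite -pmulrn tpowMn // exprnP.
by rewrite NegzE mulrNz -pmulrn tpowN // tpowMn // exprnN.
Qed.

Lemma subst_hom a P : whomog wc a P -> hom (class_deg a) (subst F P).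
Proof.
move=> hP; apply: (whomogP hK) => t z ht; rewrite !peval_subst.
rewrite tpow_class //; pose t' : 'rV[K]_rc := \row_j tpow t (d j - e j).
have ht' : torus t' by move=> j; rewrite mxE tpow_neq0.
have := whomog_act (\row_i peval (F i) z) ht' hP; rewrite peval_row => <-.
apply: meval_eq => i; rewrite !mxE (whomog_act _ ht (@hF i)) tpow_class //.
Qed.

(** At a lift z, the value of the section of index i is F_i(z) divided by the character of weight
    [wc i] at [ratio_point z]. The vector of sections is thus a torus translate of that of the F_i,
    and homogeneity of [P] applies. *)
Lemma subst_section a P : whomog wc a P ->
  rational_eq (fun x => meval (sec ^~ x) P) (fr (subst F P * comb_den a) (comb_num a)).
Proof.
move=> hP; have hS := subst_hom hP.
have loc i : exists O, [/\ open O, O !=set0 &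
    forall z, U z -> O (pi z) -> sec i (pi z) = peval (F i * comb_den (wc i)) z / peval (comb_num (wc i)) z].
  have hFi : hom (num_deg (wc i)) (F i * comb_den (wc i)).
    rewrite -(subrK (den_deg (wc i)) (num_deg (wc i))) -class_degE.
    by apply: whomogM => //; exact: comb_den_hom.
  exact: (rational_eq_fracE pr hFi (@comb_num_hom (wc i)) (FE i)).
have /choice[O OP] := loc.
have [oI nI] : open (\big[setI/setT]_i O i) /\ \big[setI/setT]_i O i !=set0.
  elim/big_rec: _ => [|i x _ [ox nx]]; first by split; [exact: openT|have [z Uz] := U0; exists (pi z)].
  by have [oO nO _] := OP i; split; [exact: openI|exact (pr_meet hK pr oO ox nO nx)].
have hprod : exists b, hom b (\prod_j (N j * E j)).
  exists (\sum_j (d j + e j)); apply: (whomog_prod hK) => j _; exact: whomogM.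
have [b hb] := hprod; have oZ := open_zset nX pr hb.
have nP : \prod_j (N j * E j) != 0 by apply/prodf_neq0 => j _; rewrite mulf_neq0.
have oIZ := openI oI oZ; have nIZ := pr_meet hK pr oI oZ nI (compl_zset_nonempty hK pr U0 hb nP).
have hSD : hom (num_deg a) (subst F P * comb_den a).
  by rewrite -(subrK (den_deg a) (num_deg a)) -class_degE; apply: whomogM => //; exact: comb_den_hom.
apply (rational_eq_fracI hK nX pr oIZ nIZ hSD (@comb_num_hom a) (comb_num_neq0 a)) => z Uz [Oz nz] Nz.
have nzj j : peval (N j) z != 0 /\ peval (E j) z != 0.
  have := notin_zset pr hb Uz nz; rewrite peval_prod => /prodf_neq0/(_ j isT).
  by rewrite pevalM mulf_eq0 negb_or => /andP[].
have ht := ratio_torus nzj; have hti := torus_invP ht.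
have DEz c : peval (comb_den c) z != 0.
  rewrite peval_prod; apply/prodf_neq0 => j _; have [? ?] := nzj j.
  by rewrite pevalM !pevalX mulf_neq0 ?expf_neq0.
have tinv c : tpow (torus_inv (ratio_point z)) c = (tpow (ratio_point z) c)^-1.
  by rewrite /tpow -prodfV; apply: eq_bigr => j _; rewrite mxE exprz_inv invr_expz.
have red c G : peval (G * comb_den c) z / peval (comb_num c) z = tpow (torus_inv (ratio_point z)) c * peval G z.
  rewrite pevalM comb_ratio // tinv; have tc := tpow_neq0 c ht; have Dc := DEz c.
  by field; rewrite tc Dc.
rewrite red peval_subst -peval_row -(whomog_act _ hti hP) -peval_row.
congr (peval P _); apply/rowP => i; rewrite !mxE -/(tpow _ _) -red.
have [_ _ ->] := OP i => //.
by move: Oz; rewrite (bigD1 i) //= => -[].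
Qed.

(** Forms of degree [class_deg a] are sections of [comb D a], and these have unique expressions in
    the Cox coordinates. *)
Lemma subst_bijective a G : hom (class_deg a) G -> exists! P, whomog wc a P /\ subst F P = G.
Proof.
move=> hG; rewrite class_degE in hG.
have fs := frac_section hK nX pr mono U0 (comb_num_neq0 a) (comb_den_neq0 a) (@comb_num_hom a) (@comb_den_hom a) (@vp_comb a) hG.
have hSD H : hom (class_deg a) H -> hom (num_deg a) (H * comb_den a).
  by move=> hH; rewrite -(subrK (den_deg a) (num_deg a)) -class_degE; apply: whomogM => //; exact: comb_den_hom.
have [P [[hP eP] uP]] := coords.2 a _ fs; exists P; split=> [|Q [hQ QE]].
  split=> //; have e2 := rational_eq_trans hK pr eP (subst_section hP).
  have hGD : hom (num_deg a) (G * comb_den a) by apply: hSD; rewrite class_degE.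
  have refl : rational_eq (fr (G * comb_den a) (comb_num a)) (fr (G * comb_den a) (comb_num a)).
    by exists setT; split=> //; [exact: openT|have [z Uz] := U0; exists (pi z)].
  have := frac_cross hK pr hGD (@comb_num_hom a) (hSD _ (subst_hom hP)) (@comb_num_hom a)
    (comb_num_neq0 a) (comb_num_neq0 a) refl e2.
  by move/(mulIf (comb_num_neq0 a))/(mulIf (comb_den_neq0 a)).
apply: uP; split=> //; apply: rational_eq_sym.
by have := subst_section hQ; rewrite QE.
Qed.

(** If two classes have the same degree, the quotient of their fractions has degree 0, hence is a
    rational function on [X] that makes the divisors equivalent; [basis] excludes this for distinct
    combinations. *)
Lemma class_deg_inj : injective class_deg.
Proof.
move=> a a' ea; have [x [_ ux]] := basis.2 _ (divisor_comb a).
have [-> //] : x = a /\ x = a'.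
have Xne : [set: X] !=set0 by have [z Uz] := U0; exists (pi z).
have reflr (f : X -> K) : rational_eq f f by exists setT; split=> //; exact: openT.
have key b : class_deg a = class_deg b -> lin_equiv (comb D a) (comb D b).
  move=> eb; have [A AE] : exists A, A = comb_num a * comb_den b by exists (comb_num a * comb_den b).
  have [B BE] : exists B, B = comb_den a * comb_num b by exists (comb_den a * comb_num b).
  have hA : hom (num_deg a + den_deg b) A.
    by rewrite AE; apply: (whomogM hK); [exact: comb_num_hom|exact: comb_den_hom].
  have hB : hom (num_deg a + den_deg b) B.
    have -> : num_deg a + den_deg b = den_deg a + num_deg b.
      move: eb; rewrite !class_degE => /eqP; rewrite subr_eq addrAC => /eqP ->.
      by rewrite subrK addrC.
    by rewrite BE; apply: (whomogM hK); [exact: comb_den_hom|exact: comb_num_hom].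
  have vA p : fprime p -> vp p A = (vp p (comb_num a) + vp p (comb_den b))%N.
    by move=> [pp _ _]; rewrite AE; apply: vpM => //; [exact: ufd|exact: comb_num_neq0|exact: comb_den_neq0].
  have vB p : fprime p -> vp p B = (vp p (comb_den a) + vp p (comb_num b))%N.
    by move=> [pp _ _]; rewrite BE; apply: vpM => //; [exact: ufd|exact: comb_den_neq0|exact: comb_num_neq0].
  have A0 : A != 0 by rewrite AE; apply: mulf_neq0; [exact: comb_num_neq0|exact: comb_den_neq0].
  have B0 : B != 0 by rewrite BE; apply: mulf_neq0; [exact: comb_den_neq0|exact: comb_num_neq0].
  clear AE BE; exists (fr A B); split.
  - exact: (rational_frac hK nX pr U0 hA hB B0).
  - move=> f0; have h1 := whomog1 hK w; have h0 := whomog0 hK w 0.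
    have e0 : rational_eq (fr A B) (fr 0 1).
      apply: (rational_eq_trans hK pr f0); exists setT; split; [exact: openT|exact: Xne|].
      by move=> y _; rewrite /form_frac peval0 mul0r.
    have e1 := frac_cross hK pr hA hB h0 h1 B0 (oner_neq0 _) (reflr _) e0.
    by move: A0; rewrite -(mulr1 A) e1 mul0r eqxx.
  move=> Z pZ; have [p fp ->] := prime_divisorP hK nX pr pZ.
  have rep : represents w U pi (fr A B) A B.
    by split=> //; exists (num_deg a + den_deg b); [exact: hA|exact: hB].
  rewrite (ord_represents hK nX pr mono fp rep) (vp_comb a fp) (vp_comb b fp) vA // vB //.
  by move: (vp _ _) (vp _ _) (vp _ _) (vp _ _) => x1 x2 x3 x4; clear; lia.
by split; apply: ux; apply: key.
Qed.

(** The divisor of the variable is equivalent to some [comb D a]. Clearing denominators gives two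
    forms [L] and [R] with the same valuations; they divide each other, so their degrees agree. *)
Lemma class_deg_var i : exists a, class_deg a = w i.
Proof.
have [Y YE] : exists Y, Y = pvar K i by exists (pvar K i).
have pY : prime_elt Y by rewrite YE; exact: prime_pvar.
have hY : hom (w i) Y by rewrite YE; exact: whomog_var.
have fY : fprime Y by split=> //; [exists (w i)|exact: meets pY hY].
clear YE; pose Ei (Z : set X) : int := (Z == zs Y)%:R.
have dE : divisor Ei.
  split; last by move=> Z; rewrite /Ei; case: (Z =P zs Y) => [-> _|]; [exact: (prime_divisor_zset hK nX pr fY)|rewrite eqxx].
  apply: (@sub_finite_set _ _ [set zs Y]); last exact: finite_set1.
  by move=> Z; rewrite /= /Ei; case: (Z =P zs Y) => // _; rewrite eqxx.
have [a [[f [rf nf fE]] _]] := basis.2 _ dE; exists a.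
have [A [B rep]] := rational_represents hK nX pr rf nf; have [[c hA hB] A0 B0 _] := rep.
have Y0 : Y != 0 by case: pY.
have [L LE] : exists L, L = Y * (comb_den a * B) by exists (Y * (comb_den a * B)).
have [R RE] : exists R, R = comb_num a * A by exists (comb_num a * A).
have dB0 : comb_den a * B != 0 by apply: mulf_neq0 => //; exact: comb_den_neq0.
have L0 : L != 0 by rewrite LE; apply: mulf_neq0.
have R0 : R != 0 by rewrite RE; apply: mulf_neq0 => //; exact: comb_num_neq0.
have hL : hom (w i + (den_deg a + c)) L.
  by rewrite LE; apply: (whomogM hK hY); apply: (whomogM hK) => //; exact: comb_den_hom.
have hR : hom (num_deg a + c) R by rewrite RE; apply: (whomogM hK) => //; exact: comb_num_hom.
have v p : fprime p -> vp p L = vp p R.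
  move=> fp; have [pp _ _] := fp; have := fE _ (prime_divisor_zset hK nX pr fp).
  rewrite (ord_represents hK nX pr mono fp rep) (vp_comb a fp) /Ei natz -(vp_zset hK pr fp fY).
  rewrite LE (vpM ufd pp Y0 dB0) (vpM ufd pp (comb_den_neq0 a) B0) RE (vpM ufd pp (comb_num_neq0 a) A0).
  by move: (vp _ _) (vp _ _) (vp _ _) (vp _ _) (vp _ _) => x1 x2 x3 x4 x5; clear; lia.
clear LE RE.
have [q qE] : divides L R by apply: (divides_vp hK meets R0 L0 hL) => p /v ->.
have [q' q'E] : divides R L by apply: (divides_vp hK meets L0 R0 hR) => p /v ->.
have uq : q \is a GRing.unit.
  apply/divides1_unit; exists q'; apply: (mulIf L0).
  by rewrite mul1r -mulrA -qE -q'E.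
have [x x0 qx] := mpoly_unit_const uq.
have hR' : hom (w i + (den_deg a + c)) R by rewrite qE qx mul_mpolyC; exact: (whomogZ hK).
have := whomog_uniq R0 hR' hR; rewrite addrA => /addIr e1.
by rewrite class_degE -e1 addrK.
Qed.

End CoxComparison.

(** * Isomorphisms of multigraded polynomial rings *)

Section GradedIsomorphism.
Variable K : closedFieldType.
Hypothesis hK : [pchar K] =i pred0.

Lemma wdeg_block_sum n k (blk : 'I_n -> 'I_k) m :
  \sum_b (wdeg (block_weight blk) m) 0 b = (mdeg m)%:Z.
Proof.
rewrite /wdeg mdegE Posz_sum.
under eq_bigr do rewrite summxE; rewrite exchange_big; apply: eq_bigr => i _ /=.
rewrite (bigD1 (blk i)) //= mulmxnE mxE !eqxx big1 ?addr0 => [|b /negbTE bi].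
  by rewrite /= mulr1n natz.
by rewrite mulmxnE mxE bi andbF mul0rn.
Qed.

Lemma peval_at0 n (P : mpoly n K) : mnm0 \notin msupp P -> peval P 0 = 0.
Proof.
move=> nP; rewrite /peval mevalE big_seq big1 // => m mP.
have [i mi] : exists i, m i != 0%N.
  apply: contrapT => h; case/negP: nP; rewrite (_ : mnm0 = m) //.
  by apply/mnmP => i; rewrite mnm0E; apply/esym/eqP; apply: contrapT => /negP mi; apply: h; exists i.
by rewrite (bigD1 i) //= mxE expr0n (negbTE mi) mul0r mulr0.
Qed.

Section LinearPart.
Variables (n : nat) (l : 'I_n).

Definition axis : mpoly n K -> {poly K} := mmap polyC (fun i => if i == l then 'X else 0).

HB.instance Definition _ := GRing.RMorphism.copy axis (mmap polyC (fun i => if i == l then 'X else 0)).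

Lemma axis_at0 P : (axis P).[0] = peval P 0.
Proof.
apply: (mpoly_rmorph_ext (f := horner_eval (0 : K) \o axis) (g := meval ((0 : 'rV[K]_n) 0))) => [c|i] /=.
  by rewrite /horner_eval /axis mmapC hornerC mevalC.
rewrite /horner_eval /axis mmapX mmap1U mevalXU mxE; case: ifP => _; first by rewrite hornerX.
by rewrite horner0.
Qed.

Lemma axis_var : axis (pvar K l) = 'X.
Proof. by rewrite /axis /pvar mmapX mmap1U eqxx. Qed.

Lemma axis_subst m (P : 'I_m -> mpoly n K) G :
  axis (subst P G) = \sum_(u <- msupp G) (mcoeff u G)%:P * \prod_i axis (P i) ^+ u i.
Proof.
rewrite /subst {1}/mmap rmorph_sum; apply: eq_bigr => u _.
rewrite rmorphM; congr (_ * _); first exact: mmapC.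
by rewrite /mmap1 rmorph_prod; apply: eq_bigr => i _; rewrite rmorphXn.
Qed.

End LinearPart.

(** On the l-th axis every [P i] is divisible by X, so the left side is divisible by X^2, whereas
    the variable restricts to X. *)
Lemma variable_not_decomposable n m (l : 'I_n) (P : 'I_m -> mpoly n K) G :
  (forall i, peval (P i) 0 = 0) -> (forall u, u \in msupp G -> (1 < mdeg u)%N) ->
  subst P G != pvar K l.
Proof.
move=> P0 G2; apply/eqP => e.
have /choice[q qE] : forall i, exists q, axis l (P i) = q * 'X.
  move=> i; have : root (axis l (P i)) 0 by rewrite /root axis_at0 P0.
  by move=> /factor_theorem[q ->]; exists q; rewrite subr0.
have : divides ('X^2) (axis l (subst P G)).
  rewrite axis_subst big_seq; apply: divides_sum => u uG; apply: divides_mull.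
  under eq_bigr do rewrite qE exprMn; rewrite big_split /=; apply: divides_mull.
  rewrite -expr_sum -mdegE; have := G2 u uG; case: (mdeg u) => [|[|k]] // _.
  by exists 'X^k; rewrite -exprD addn2.
rewrite e axis_var => -[c /(congr1 (fun p => (p : {poly K})`_1))].
by rewrite coefX coefMXn /= => /eqP; rewrite oner_eq0.
Qed.

Variables (n k nc rc : nat) (blk : 'I_n -> 'I_k) (wc : 'I_nc -> 'rV[int]_rc).
Local Notation w := (block_weight blk).
Variables (delta : 'rV[int]_rc -> 'rV[int]_k) (F : 'I_nc -> mpoly n K).
Hypotheses (dI : injective delta) (dD : forall a b, delta (a + b) = delta a + delta b).
Hypothesis dw : forall i, exists a, delta a = w i.
Hypothesis hF : forall i, whomog w (delta (wc i)) (F i).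
Hypothesis bij : forall a G, whomog w (delta a) G -> exists! P, whomog wc a P /\ subst F P = G.

Lemma delta0 : delta 0 = 0.
Proof. by apply: (addrI (delta 0)); rewrite -dD !addr0. Qed.

Lemma deltaMn a m : delta (a *+ m) = delta a *+ m.
Proof. by elim: m => [|m IH]; rewrite ?mulr0n ?delta0 // !mulrS dD IH. Qed.

Lemma delta_sum I (s : seq I) (f : I -> 'rV[int]_rc) : delta (\sum_(i <- s) f i) = \sum_(i <- s) delta (f i).
Proof. by elim/big_rec2: _ => [|i x y _ <-]; rewrite ?delta0 ?dD. Qed.

Lemma subst_uniq a P Q : whomog wc a P -> whomog wc a Q -> whomog w (delta a) (subst F P) ->
  subst F P = subst F Q -> P = Q.
Proof.
by move=> hP hQ hS e; have [R [_ uR]] := bij hS; rewrite -(uR P) // -(uR Q) // -e.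
Qed.

Lemma subst_var i : subst F (pvar K i) = F i.
Proof. by rewrite /subst /pvar mmapX mmap1U. Qed.

(** The left side is the total degree of [F l]. If it is 0, then [F l] is constant and so would be
    the l-th variable. If it exceeds 1, expressing the block variables through the F_i and
    substituting into [F l] would decompose the l-th variable. *)
Lemma graded_iso_degree l : \sum_b (delta (wc l)) 0 b = 1.
Proof.
have hl : whomog wc (wc l) (pvar K l : mpoly nc K) by exact: whomog_var.
have hSl : whomog w (delta (wc l)) (subst F (pvar K l)) by rewrite subst_var; exact: hF.
have Fl0 : F l != 0.
  apply/eqP => F0; have /negP[] := pvar_neq0 K l; apply/eqP.
  apply: (subst_uniq hl (@whomog0 K hK _ _ wc _) hSl); rewrite subst_var F0.
  by rewrite /subst raddf0.
have tot u : u \in msupp (F l) -> (mdeg u)%:Z = \sum_b (delta (wc l)) 0 b.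
  by move=> uF; rewrite -(wdeg_block_sum blk) (_ : wdeg w u = delta (wc l)) //; exact: hF uF.
have [u uF] : exists u, u \in msupp (F l).
  by case E : (msupp (F l)) => [|u s]; [move/eqP: E; rewrite msupp_eq0 (negbTE Fl0)|exists u; rewrite mem_head].
rewrite -(tot u uF); have [u0|] := eqVneq (mdeg u) 0%N; last first.
  rewrite -lt0n leq_eqVlt => /orP[/eqP <- //|u2]; exfalso.
  have /choice[a aE] := dw.
  (* The preimages of the block variables. Substituted into [F l] they give back the l-th variable,
     because [subst F] is injective in its degree. *)
  have /choice[P PE] : forall i, exists P, whomog wc (a i) P /\ subst F P = pvar K i.
    move=> i; have hi : whomog w (delta (a i)) (pvar K i) by rewrite aE; exact: whomog_var.
    by have [P [hP _]] := bij hi; exists P.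
  have wE v : v \in msupp (F l) -> \sum_i a i *+ v i = wc l.
    move=> vF; apply: dI; rewrite delta_sum; under eq_bigr do rewrite deltaMn aE.
    exact: hF vF.
  have hPhi : whomog wc (wc l) (subst P (F l)).
    apply: (whomogP hK) => t z ht; rewrite !peval_subst !mevalE big_distrr /=.
    rewrite big_seq [RHS]big_seq; apply: eq_bigr => v vF; rewrite mulrCA; congr (_ * _).
    rewrite -(wE v vF) tpow_sum // -big_split; apply: eq_bigr => i _ /=.
    by rewrite (whomog_act _ ht (PE i).1) exprMn tpowMn.
  have FPhi : subst F (subst P (F l)) = F l.
    apply: (mpoly_eq_open hK openT); first by exists 0.
    move=> z _; rewrite peval_subst -peval_row peval_subst; apply: meval_eq => i.
    by rewrite peval_row -peval_subst (PE i).2 peval_var.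
  have hSPhi : whomog w (delta (wc l)) (subst F (subst P (F l))) by rewrite FPhi; exact: hF.
  have e := subst_uniq hPhi hl hSPhi (etrans FPhi (esym (subst_var l))).
  have : subst P (F l) != pvar K l.
    apply: variable_not_decomposable => [i|v vF]; last first.
      by rewrite -ltz_nat (tot v vF) -(tot u uF) ltz_nat.
    apply: peval_at0; apply/negP => m0; have a0 : a i = 0.
      by rewrite -((PE i).1 _ m0); apply: big1 => j _; rewrite mnm0E mulr0n.
    have /rowP/(_ (blk i)) := aE i; rewrite a0 delta0 /block_weight !mxE !eqxx => /eqP.
    by rewrite eq_sym oner_eq0.
  by rewrite e eqxx.
have l0 : wc l = 0.
  apply: dI; rewrite delta0 -(hF uF); apply: big1 => i _.
  by move: u0; rewrite mdegE => /eqP; rewrite sum_nat_eq0 => /forallP/(_ i) /= /eqP ->.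
have FC : F l = mpolyC n (mcoeff mnm0 (F l)).
  apply/mpolyP => v; rewrite mcoeffC; case: eqP => [->|nv]; first by rewrite mulr1.
  rewrite mulr0; apply: memN_msupp_eq0; apply/negP => vF; apply: nv.
  apply/eqP; rewrite -mdeg_eq0; apply/eqP; have := tot v vF.
  by rewrite -(tot u uF) u0 => -[].
have hC : whomog wc (wc l) (mpolyC nc (mcoeff mnm0 (F l))) by rewrite l0; exact: whomogC.
have e : pvar K l = mpolyC nc (mcoeff mnm0 (F l)).
  by apply: (subst_uniq hl hC hSl); rewrite subst_var /subst mmapC.
have := congr1 (fun P => peval P (const_mx 1)) e; have := congr1 (fun P => peval P 0) e.
by rewrite !peval_var !pevalC !mxE => <- /eqP; rewrite oner_eq0.
Qed.

(** Each Cox variable has total degree 1, so the total degree of a monomial is its ordinary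
    degree. *)
Lemma graded_iso_monomial l m : wdeg wc m = wc l -> mdeg m = 1%N.
Proof.
move=> e; have := graded_iso_degree l; rewrite -e /wdeg delta_sum.
under eq_bigr do rewrite summxE; rewrite exchange_big /=.
rewrite (eq_bigr (fun i => (m i)%:Z)) => [|i _].
  by rewrite -Posz_sum -mdegE => -[].
under eq_bigr do rewrite deltaMn mulmxnE.
by rewrite sumrMnl graded_iso_degree natz.
Qed.

End GradedIsomorphism.

(** * Open subsets of products of projective spaces *)

Section Backward.
Variable K : closedFieldType.
Hypothesis hK : [pchar K] =i pred0.

(** Both statements restrict the regular map on the product to a slice. *)
Lemma vector_action_polynomial m n (beta : 'rV[K]_m -> affine_space K n -> affine_space K n) :
  vector_group_action beta ->
  (forall v l, exists P, forall z : affine_space K n, beta v z 0 l = peval P z) /\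
  (forall z l, exists P, forall v : affine_space K m, beta v z 0 l = peval P v).
Proof.
move=> [_ [_ rb]]; have nA d := nice_affine K d.
pose f l (z : product (affine_space K m) (affine_space K n)) := (beta z.1 z.2 : affine_space K n) 0 l.
have rf l : regular setT (f l).
  have h := rb setT (fun z => (z : affine_space K n) 0 l) openT.
  apply: h; have h' := @regular_peval K n setT (pvar K l).
  by apply: (regular_eq (nA n) openT _ h') => z _; rewrite peval_var.
have idc d (O : set (affine_space K d)) : open O -> open (setT `&` id @^-1` O) by rewrite setTI.
have idr d (O : set (affine_space K d)) g : open O -> regular O g -> regular (setT `&` id @^-1` O) (g \o id).
  by rewrite setTI.
have cc d d' (v : affine_space K d) (O : set (affine_space K d)) : open O ->
    open (setT `&` (fun _ : affine_space K d' => v) @^-1` O).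
  move=> oO; rewrite setTI; have [Ov|nOv] := pselect (O v).
    by rewrite (_ : _ @^-1` _ = setT); [exact: openT|apply/seteqP; split].
  by rewrite (_ : _ @^-1` _ = set0); [exact: open0|apply/seteqP; split].
have cr d d' (v : affine_space K d) (O : set (affine_space K d)) g : open O -> regular O g ->
    regular (setT `&` (fun _ : affine_space K d' => v) @^-1` O) (g \o fun=> v).
  by move=> oO _; apply: (nice_cst (nA d')); apply: cc.
split=> [v l|z l].
  have h := pull_product_regular (nA m) (nA n) (cc m n v) (cr m n v) (idc n) (idr n) openT (rf l).
  by have [|P PE] := @regular_polynomial K hK n (fun z => beta v z 0 l); [move: h; rewrite !setTI|exists P].
have h := pull_product_regular (nA m) (nA n) (idc m) (idr m) (cc n m z) (cr n m z) openT (rf l).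
by have [|P PE] := @regular_polynomial K hK m (fun v => beta v z 0 l); [move: h; rewrite !setTI|exists P].
Qed.

Section OpenSubset.
Variables (P X : kspace K) (nP : nice P) (n r : nat) (w : 'I_n -> 'rV[int]_r).
Variables (U : set (affine_space K n)) (q : affine_space K n -> P).
Hypothesis pr : presentation w U q.
Variables (W : set P) (oW : open W) (x0 : X).
Variables (f : X -> restrict W) (g : restrict W -> X).
Hypotheses (mf : morphism f) (mg : morphism g) (fK : cancel f g) (gK : cancel g f).

(** The point [x0] is an arbitrary default outside the preimage of [W]. *)
Definition open_subset_proj (z : affine_space K n) : X :=
  if pselect (W (q z)) is left h then g (SigSub (mem_set h)) else x0.

Lemma open_subset_projE z (h : W (q z)) : open_subset_proj z = g (SigSub (mem_set h)).
Proof.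
rewrite /open_subset_proj; case: pselect => // h'; congr g; exact: val_inj.
Qed.

Lemma open_subset_presentation : presentation w (U `&` q @^-1` W) open_subset_proj.
Proof.
have [/continuousP cf rf] := mf; have [/continuousP cg rg] := mg; have nA := nice_affine K n.
have pull O : open O -> exists2 V, open V & forall z, W (q z) -> O (open_subset_proj z) <-> V (q z).
  move=> /cg[V oV VE]; exists V => // z Wz; rewrite open_subset_projE.
  by have -> : V (q z) = (set_val @^-1` V) (SigSub (mem_set Wz) : restrict W) by []; rewrite VE.
have pullE O V : (forall z, W (q z) -> O (open_subset_proj z) <-> V (q z)) ->
    (U `&` q @^-1` W) `&` open_subset_proj @^-1` O = U `&` q @^-1` (W `&` V).
  move=> OV; apply/seteqP; split=> z /=.
    by move=> [[Uz Wz]] /(OV z Wz).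
  by move=> [Uz [Wz /(OV z Wz)]].
split.
- exact: (pr_cont pr oW).
- exact: (pr_pullback_inv pr).
- move=> O oO; have [V oV OV] := pull O oO; rewrite (pullE _ _ OV).
  exact: (pr_cont pr (openI oW oV)).
- move=> O h oO rh; have := rg _ _ oO rh; have [V oV VE] := cg _ oO.
  have OV z : W (q z) -> O (open_subset_proj z) <-> V (q z).
    move=> Wz; rewrite open_subset_projE.
    by have -> : V (q z) = (set_val @^-1` V) (SigSub (mem_set Wz) : restrict W) by []; rewrite VE.
  rewrite -VE => /(regular_extend _ nP oW oV) rh'; rewrite (pullE _ _ OV).
  have oWV := openI oW oV; apply: (regular_eq nA (pr_cont pr oWV) _ (pr_reg pr oWV rh')).
  move=> z [Uz [Wz Vz]] /=; rewrite open_subset_projE.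
  by rewrite -[q z]/(set_val (SigSub (mem_set Wz) : restrict W)) extendE.
- move=> x; have [V [s [oV Vx rs sE]]] := pr_sec pr (set_val (f x)).
  exists (f @^-1` (set_val @^-1` V)), (fun y => s (set_val (f y))); split=> //.
  + by apply: cf; apply: (open_restrict W oV).
  + move=> i; have h := restrict_regular (A := W) nP oV (rs i).
    have oV2 := open_restrict W oV; have h2 := rf _ _ oV2 h; exact: h2.
  move=> y Vy; have [Us se] := sE _ Vy; have Wy : W (q (s (set_val (f y)))) by rewrite se; exact: set_valP.
  split; first by split.
  rewrite open_subset_projE -[RHS]fK; congr g; apply: val_inj.
  exact: se.
move=> z z' [Uz Wz] [Uz' Wz']; rewrite !open_subset_projE; apply: iff_trans (pr_fib pr Uz Uz').
split=> [/(can_inj gK)/(congr1 val)//|e]; congr g; exact: val_inj.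
Qed.

End OpenSubset.

(** In a monomial of [F], each variable is replaced by one of the same block that is nonzero at
    [z]. *)
Lemma Uhat_mono n k (blk : 'I_n -> 'I_k) a (F : mpoly n K) z : F != 0 ->
  whomog (block_weight blk) a F -> Uhat blk z ->
  exists2 M : mpoly n K, whomog (block_weight blk) a M & peval M z != 0.
Proof.
move=> F0 hF Uz; have /choice[c cP] : forall b, exists i, blk i = b /\ z 0 i != 0.
  by move=> b; have [i] := Uz b; exists i.
have [u uF] : exists u, u \in msupp F.
  by case E : (msupp F) => [|u s]; [move/eqP: E; rewrite msupp_eq0 (negbTE F0)|exists u; rewrite mem_head].
exists (\prod_i pvar K (c (blk i)) ^+ u i).
  rewrite -(hF u uF); apply: (whomog_prod hK) => i _; apply: (whomogX hK).
  have -> : block_weight blk i = block_weight blk (c (blk i)) by rewrite /block_weight; case: (cP (blk i)) => ->.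
  exact: whomog_var.
rewrite peval_prod; apply/prodf_neq0 => i _; rewrite pevalX expf_neq0 // peval_var.
by case: (cP (blk i)).
Qed.

(** Without a zero in [Uhat], [p] divides the product of any choice of one variable per block, hence
    one of its variables. Two disjoint choices make [p] associated to two distinct variables. *)
Lemma Uhat_meets n k (blk : 'I_n -> 'I_k) (p : mpoly n K) : (forall b, 1 < block_size blk b)%N ->
  prime_elt p -> exists2 z, Uhat blk z & peval p z = 0.
Proof.
move=> bs pp; apply: contrapT => nex.
have /choice[c cP] : forall b, exists ij : 'I_n * 'I_n, [/\ blk ij.1 = b, blk ij.2 = b & ij.1 != ij.2].
  move=> b; have /card_gt1P[i [j [ib jb ij]]] := bs b.
  by exists (i, j); rewrite !inE in ib jb; split=> //; apply/eqP.
have sel (s : 'I_k -> 'I_n) : (forall b, blk (s b) = b) -> exists b, divides p (pvar K (s b)).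
  move=> sb; have : divides p (\prod_b pvar K (s b)).
    apply: (peval_nullstellensatz hK pp) => z pz; rewrite peval_prod.
    have [b nb] : exists b, forall i, blk i = b -> z 0 i = 0.
      apply: contrapT => h; apply: nex; exists z => // b; apply: contrapT => h'; apply: h; exists b => i ib.
      by apply/eqP; apply: contrapT => /negP zi; apply: h'; exists i.
    by rewrite (bigD1 b) //= peval_var (nb _ (sb b)) mul0r.
  rewrite -(big_map (fun j => pvar K (s j)) xpredT idfun) => /(prime_divides_prod pp)[x].
  by move=> /mapP[b _ ->] h; exists b.
have [b1 d1] := sel (fun b => (c b).1) (fun b => let: And3 h _ _ := cP b in h).
have [b2 d2] := sel (fun b => (c b).2) (fun b => let: And3 _ h _ := cP b in h).
have ne : (c b1).1 != (c b2).2.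
  have [e1 _ ne1] := cP b1; have [_ e2 _] := cP b2.
  by have [e|ne] := eqVneq b1 b2; [rewrite -e|apply: contraNneq ne => e; rewrite -e1 -e2 e].
have [u /mpoly_unit_const[x x0 ->] e1] := prime_assoc pp (prime_pvar K _) d1.
have [v /mpoly_unit_const[y y0 ->] e2] := prime_assoc pp (prime_pvar K _) d2.
have /(congr1 (fun P => peval P (delta_mx 0 (c b1).1))) := e1.
have /(congr1 (fun P => peval P (delta_mx 0 (c b1).1))) := e2.
rewrite !pevalM !peval_var !mxE !eqxx !pevalC eq_sym (negbTE ne) /= => /esym/eqP.
rewrite mulf_eq0 (negbTE y0) => /eqP -> /eqP.
by rewrite mulr0 oner_eq0.
Qed.

End Backward.

Section BackwardFinal.
Variable K : closedFieldType.
Hypothesis hK : [pchar K] =i pred0.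

(** Otherwise the locus of [p] in [P] would lie in the complement of [W] and have codimension at
    least 2, contrary to [not_chain2_zset]. *)
Lemma codim2_meets (P : kspace K) (nP : nice P) n k (blk : 'I_n -> 'I_k) (q : affine_space K n -> P)
    (pr : presentation (block_weight blk) (Uhat blk) q) (W : set P) :
  (forall b, 1 < block_size blk b)%N -> codim_ge 2 (~` W) ->
  forall p a, prime_elt p -> whomog (block_weight blk) a p ->
  exists2 z, (Uhat blk `&` q @^-1` W) z & peval p z = 0.
Proof.
move=> bs cW p a pp hp.
have fp : form_prime (block_weight blk) (Uhat blk) p.
  by split=> //; [exists a|apply: Uhat_meets].
apply: contrapT => nex.
have ZW : zset (Uhat blk) q p `<=` ~` W.
  move=> x Zx Wx; have [Ul le] := liftP pr x; apply: nex.
  by eexists; last exact: Zx; split=> //=; rewrite le.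
exact: (not_chain2_zset hK nP pr fp (cW _ (zset_irreducible hK nP pr fp) ZW)).
Qed.

Lemma cox_monomial_degree (X : kspace K) (nX : nice X) n k (blk : 'I_n -> 'I_k)
    (U : set (affine_space K n)) (pi : affine_space K n -> X)
    (pr : presentation (block_weight blk) U pi) (C : Cox_construction X) :
  (forall a (F : mpoly n K) z, F != 0 -> whomog (block_weight blk) a F -> U z ->
     exists2 M : mpoly n K, whomog (block_weight blk) a M & peval M z != 0) ->
  (forall (p : mpoly n K) a, prime_elt p -> whomog (block_weight blk) a p ->
     exists2 z, U z & peval p z = 0) ->
  U !=set0 -> forall l mu, wdeg (@cox_deg _ _ C) mu = @cox_deg _ _ C l -> mdeg mu = 1%N.
Proof.
move=> mono meets U0 l mu.
have basis := cox_basis C; have coords := cox_ring C.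
have /choice[N /choice[E /choice[d /choice[e NE]]]] := fun j => divisor_pair hK nX pr (basis.1 j).
have N0 j : N j != 0 by case: (NE j).
have E0 j : E j != 0 by case: (NE j).
have hN j : whomog (block_weight blk) (d j) (N j) by case: (NE j).
have hE j : whomog (block_weight blk) (e j) (E j) by case: (NE j).
have DE j p : form_prime (block_weight blk) U p -> cox_div j (zset U pi p) = (vp p (N j))%:Z - (vp p (E j))%:Z.
  by case: (NE j) => _ _ _ _; apply.
have hnum a := @comb_num_hom K hK _ _ _ _ _ _ _ _ hN hE a.
have hden a := @comb_den_hom K hK _ _ _ _ _ _ _ _ hN hE a.
have /choice[F FP] : forall i, exists F, whomog (block_weight blk) (class_deg d e (@cox_deg _ _ C i)) F /\
    rational_eq (cox_sec (c := C) i) (form_frac U pi (F * comb_den N E (@cox_deg _ _ C i)) (comb_num N E (@cox_deg _ _ C i))).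
  move=> i; have [F hF FE] := section_frac hK nX pr mono meets U0
    (comb_num_neq0 N0 E0 (@cox_deg _ _ C i)) (comb_den_neq0 N0 E0 (@cox_deg _ _ C i))
    (hnum (@cox_deg _ _ C i)) (hden (@cox_deg _ _ C i))
    (vp_comb N0 E0 DE (@cox_deg _ _ C i)) (coords.1 i).
  by exists F; split=> //; rewrite class_degE.
have hF i := (FP i).1; have FE i := (FP i).2.
apply: (graded_iso_monomial hK (blk := blk) (delta := class_deg d e) (F := F)).
- exact: (class_deg_inj hK nX pr mono U0 basis N0 E0 hN hE DE).
- exact: class_degD.
- exact: (class_deg_var hK nX pr mono meets basis N0 E0 hN hE DE).
- exact: hF.
- move=> a G hG; have h := @subst_bijective K hK _ nX _ _ _ _ _ pr mono U0 _ _ _ _ _ coords _ _ _ _ N0 E0 hN hE DE _ hF FE a G.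
  apply: h. exact: hG.
Qed.

Lemma big_open_monomial_degree (X : kspace K) (hX : toric_variety X) (C : Cox_construction X) dims :
  big_open_subset X (product_of_projective_spaces K dims) ->
  forall l mu, wdeg (@cox_deg _ _ C) mu = @cox_deg _ _ C l -> mdeg mu = 1%N.
Proof.
move=> [d [tau [_ _ [W [oW _ cW [f [g [mf mg fK gK]]]]]]]].
have [k [n [blk [q [pr kE bs]]]]] := dims_presentation hK dims.
have bs1 b : (1 < block_size blk b)%N.
  rewrite bs ltnS; have /(mem_nth 0%N) : (b < size [seq d <- dims | (0 < d)%N])%N by rewrite -kE.
  by rewrite mem_filter => /andP[].
have [vX [[x0 _] _] _ _] := hX.
have nP := nice_dims hK dims.
have pr' := open_subset_presentation nP pr oW x0 mf mg fK gK.
apply: (cox_monomial_degree (nice_variety vX) pr').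
- by move=> a F z F0 hF [Uz _]; exact: (Uhat_mono hK F0 hF Uz).
- exact: (codim2_meets nP pr bs1 cW).
by have [z Uz _] := pr_surj pr' x0; exists z.
Qed.

Lemma degree1_linear n (P : mpoly n K) : (forall mu, mu \in msupp P -> mdeg mu = 1%N) ->
  forall z, peval P z = \sum_i z 0 i * mcoeff (mnm1 i) P.
Proof.
move=> hP z; have PE : P = \sum_i mcoeff (mnm1 i) P *: pvar K i; last first.
  rewrite {1}PE peval_sum; apply: eq_bigr => i _.
  by rewrite -mul_mpolyC pevalM pevalC peval_var mulrC.
apply/mpolyP => mu; rewrite raddf_sum /=.
have [muP|nmuP] := boolP (mu \in msupp P).
  have mu1 := hP mu muP.
  have [i /eqP ie] := mdeg1P mu (introT eqP mu1).
  rewrite ie.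
  rewrite (bigD1 i) //= mcoeffZ /pvar mcoeffX eqxx mulr1 big1 ?addr0 //.
  by move=> j ji; rewrite mcoeffZ mcoeffX eq_mnm1 (negbTE ji) mulr0.
rewrite (memN_msupp_eq0 nmuP) big1 // => i _; rewrite mcoeffZ mcoeffX.
by case: eqP => [e|]; [rewrite e (memN_msupp_eq0 nmuP) mul0r|rewrite mulr0].
Qed.

Lemma morphism_id (X : kspace K) : morphism (@idfun X).
Proof. by split=> [x|V g]. Qed.

(** The action is linear in the Cox coordinates themselves: commuting with the torus, the l-th
    component of [beta v] has the degree of the l-th variable, so all its monomials have degree
    1. *)
Theorem linearizable_of_big_open (X : kspace K) (hX : toric_variety X) (C : Cox_construction X) m
    (beta : 'rV[K]_m -> affine_space K (cox_dim C) -> affine_space K (cox_dim C)) dims :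
  vector_group_action beta ->
  (forall g t z, torus t -> beta g (grading_action (@cox_deg _ _ C) t z) =
                            grading_action (@cox_deg _ _ C) t (beta g z)) ->
  big_open_subset X (product_of_projective_spaces K dims) ->
  linearizable (torus (d := cox_rank C) `*` [set: 'rV[K]_m]) (associated_action beta).
Proof.
move=> hb comm hP.
have deg1 := big_open_monomial_degree hX (C := C) hP.
have [bpoly _] := vector_action_polynomial hK hb; have [[[b0 bD] _] _] := (hb, tt).
have lin t v : torus t -> exists M : 'M[K]_(cox_dim C), forall z : 'rV[K]_(cox_dim C),
    associated_action beta (t, v) z = z *m M.
  move=> tt; have /choice[B BE] := bpoly v.
  exists (\matrix_(i, l) (tpow t (@cox_deg _ _ C l) * mcoeff (mnm1 i) (B l))) => z.
  apply/rowP => l; rewrite !mxE BE degree1_linear; last first.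
    have hB : whomog (@cox_deg _ _ C) (@cox_deg _ _ C l) (B l).
      apply: (whomogP hK) => s y ts; rewrite -!BE comm // mxE //.
    by move=> mu /hB; exact: deg1.
  by rewrite mulr_sumr; apply: eq_bigr => i _; rewrite mxE mulrCA.
exists id, id; split=> //; [exact: morphism_id|exact: morphism_id|].
move=> [t v] [/= tt _]; have [M ME] := lin t v tt.
(* The inverse group element provides the inverse matrix. *)
have [M' ME'] := lin (torus_inv t) (- v) (torus_invP tt).
have MM : M *m M' = 1%:M; last by exists M; split=> //; case: (mulmx1_unit MM).
apply/row_matrixP => i; rewrite !rowE mulmxA -ME -ME' mulmx1 /associated_action /=.
by rewrite comm // actK // -bD // addNr b0.
Qed.

End BackwardFinal.

(** * Linearized actions *)

Section CurveDerivative.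
Variable K : closedFieldType.
Hypothesis hK : [pchar K] =i pred0.
Variable n : nat.

Definition along (g : 'I_n -> {poly K}) : mpoly n K -> {poly K} := mmap polyC g.

Definition speed (f : {poly K}) : K := (f^`()).[0].

Lemma horner_along g P e : (along g P).[e] = meval (fun i => (g i).[e]) P.
Proof.
rewrite /along /mmap horner_sum mevalE; apply: eq_bigr => m _.
by rewrite hornerM hornerC /mmap1 horner_prod; congr (_ * _); apply: eq_bigr => i _; rewrite horner_exp.
Qed.

Lemma poly_eq_fun (f g : {poly K}) : (forall e, f.[e] = g.[e]) -> f = g.
Proof.
move=> fg; apply/eqP; rewrite -subr_eq0; apply: contraT => /(poly_nonroot hK)[e].
by rewrite hornerD hornerN fg subrr eqxx.
Qed.

Lemma speedM f g : speed (f * g) = speed f * g.[0] + f.[0] * speed g.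
Proof. by rewrite /speed derivM hornerD !hornerM. Qed.

Lemma speedD f g : speed (f + g) = speed f + speed g.
Proof. by rewrite /speed derivD hornerD. Qed.

Lemma speedC c : speed c%:P = 0.
Proof. by rewrite /speed derivC horner0. Qed.

Lemma speed_sum I (s : seq I) (F : I -> {poly K}) : speed (\sum_(i <- s) F i) = \sum_(i <- s) speed (F i).
Proof. by rewrite /speed raddf_sum horner_sum. Qed.

(** [d] is the gradient of [P] at [c]. Derivatives along polynomial curves are formal ones in one
    variable, and the property passes to sums and products. *)
Lemma chain_rule (P : mpoly n K) (c : 'rV[K]_n) : exists d : 'cV[K]_n, forall g, (forall i, (g i).[0] = c 0 i) ->
  speed (along g P) = ((\row_i speed (g i)) *m d) 0 0.
Proof.
pose diff (F : mpoly n K) := exists d : 'cV[K]_n, forall g, (forall i, (g i).[0] = c 0 i) ->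
  speed (along g F) = ((\row_i speed (g i)) *m d) 0 0.
have diff_sum (I : Type) (s : seq I) (F : I -> mpoly n K) : (forall i, diff (F i)) -> diff (\sum_(i <- s) F i).
  move=> /choice[d dP]; exists (\sum_(i <- s) d i) => g gc.
  rewrite /along raddf_sum speed_sum mulmx_sumr summxE; apply: eq_bigr => i _; exact: dP.
have diffM (F G : mpoly n K) : diff F -> diff G -> diff (F * G).
  move=> [d dP] [e eP]; exists (peval G c *: d + peval F c *: e) => g gc.
  have -> : along g (F * G) = along g F * along g G by exact: rmorphM.
  rewrite speedM dP // eP // !horner_along mulmxDr mxE -!scalemxAr !mxE.
  rewrite (_ : (fun i => (g i).[0]) = c 0); last by apply/funext.
  by rewrite [_ * meval _ G]mulrC.
have diff1 : diff 1 by exists 0 => g gc; rewrite mulmx0 mxE /along rmorph1 -polyC1 speedC.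
rewrite -/(diff P) [P]mpolyE; apply: diff_sum => m; rewrite -mul_mpolyC.
apply: (diffM); first by exists 0 => g gc; rewrite mulmx0 mxE /along mmapC speedC.
rewrite mpolyXE_id; apply: (big_ind diff diff1 diffM) => i _; elim: (m i) => [|k IH] //.
rewrite exprS; apply: (diffM) => //; exists (delta_mx i 0) => g gc.
rewrite /along mmapX mmap1U !mxE (bigD1 i) //= !mxE !eqxx mulr1 big1 ?addr0 // => j ji.
by rewrite !mxE (negbTE ji) mulr0.
Qed.

Definition ray (c u : 'rV[K]_n) (i : 'I_n) : {poly K} := (c 0 i)%:P + (u 0 i)%:P * 'X.

Lemma ray0 c u i : (ray c u i).[0] = c 0 i.
Proof. by rewrite /ray !hornerE. Qed.

Lemma speed_ray c u i : speed (ray c u i) = u 0 i.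
Proof. by rewrite /ray speedD speedC speedM speedC /speed derivX !hornerE. Qed.

End CurveDerivative.

Section PolynomialMaps.
Variable K : closedFieldType.
Hypothesis hK : [pchar K] =i pred0.
Variable n : nat.

Lemma morphism_polynomial d (f : affine_space K n -> affine_space K d) : morphism f ->
  exists P : 'I_d -> mpoly n K, forall z l, f z 0 l = peval (P l) z.
Proof.
move=> [_ rf]; have /choice[P PE] : forall l, exists P, forall z, f z 0 l = peval P z.
  move=> l; apply: (regular_polynomial hK).
  have h := rf setT (fun z => (z : affine_space K d) 0 l) openT; apply: h.
  have h' := @regular_peval K d setT (pvar K l).
  by apply: (regular_eq (nice_affine K d) openT _ h') => z _; rewrite peval_var.
by exists P => z l; rewrite PE.
Qed.

Lemma jacobian d (P : 'I_d -> mpoly n K) (c : 'rV[K]_n) : exists J : 'M[K]_(n, d), forall g l,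
  (forall i, (g i).[0] = c 0 i) -> speed (along g (P l)) = ((\row_i speed (g i)) *m J) 0 l.
Proof.
have /choice[d' dP] := fun l => chain_rule (P l) c.
exists (\matrix_(i, l) d' l i 0) => g l gc; rewrite dP // !mxE.
by apply: eq_bigr => i _; rewrite !mxE.
Qed.

End PolynomialMaps.

Section Linearized.
Variable K : closedFieldType.
Hypothesis hK : [pchar K] =i pred0.
Variables (n r m : nat) (w : 'I_n -> 'rV[int]_r) (beta : 'rV[K]_m -> affine_space K n -> affine_space K n).
Local Notation act := (grading_action (K := K) w).

(* The point [psi' 0] is fixed by the group; composing [psi] with the inverse of
   its Jacobian matrix there makes it equivariant for the torus. *)
Theorem linearized_coordinates (b0 : forall z, beta 0 z = z) :
  linearizable (torus (d := r) `*` [set: 'rV[K]_m]) (fun g z => act g.1 (beta g.2 z)) ->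
  exists (psi psi' : affine_space K n -> affine_space K n) (B : 'I_n -> mpoly n K) (N : 'rV[K]_m -> 'M[K]_n),
  [/\ cancel psi psi', cancel psi' psi, forall z l, psi z 0 l = peval (B l) z,
      forall t z, torus t -> psi (act t z) = act t (psi z) &
      forall v (z : 'rV[K]_n), psi (beta v z) = (psi z : 'rV[K]_n) *m N v].
Proof.
move=> [psi [psi' [mp mp' pK pK' lin]]].
have [P PE] := morphism_polynomial hK mp; have [P' PE'] := morphism_polynomial hK mp'.
have /choice[Mt MtP] : forall t, exists M : 'M[K]_n, torus t -> forall z, psi (act t z) = (psi z : 'rV_n) *m M.
  move=> t; have [tt|nt] := pselect (torus t); last by exists 0.
  have [M [_ ME]] := lin (t, 0) (conj tt I); exists M => _ z.
  by have := ME (psi z); rewrite pK /= b0.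
have /choice[Mv MvP] : forall v, exists M : 'M[K]_n, forall z, psi (beta v z) = (psi z : 'rV_n) *m M.
  move=> v; have [M [_ ME]] := lin (const_mx 1, v) (conj (@torus1 K r) I); exists M => z.
  by have := ME (psi z); rewrite pK /= act1.
pose c := psi' 0.
have fixc t : torus t -> act t c = c.
  by move=> tt; rewrite -[LHS]pK MtP // pK' mul0mx.
have [J JE] := jacobian P c; have [J' JE'] := jacobian P' (psi c).
have dir u : \row_i speed (ray c u i) = u by apply/rowP => i; rewrite mxE speed_ray.
have evray u e F : (along (ray c u) F).[e] = peval F (\row_i (ray c u i).[e]).
  by rewrite horner_along; congr (meval _ F); apply: funext => i; rewrite mxE.
(* The identity of [psi'] after [psi] is differentiated along the rays through [c]. *)
have JJ : J *m J' = 1%:M.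
  apply/row_matrixP => k; rewrite !rowE mulmx1; set u : 'rV[K]_n := delta_mx 0 k.
  have h l : along (fun j => along (ray c u) (P j)) (P' l) = ray c u l.
    apply: (poly_eq_fun hK) => e; rewrite horner_along.
    rewrite (_ : (fun i => (along (ray c u) (P i)).[e]) = psi (\row_i (ray c u i).[e]) 0).
      by rewrite -[meval _ _]/(peval (P' l) _) -PE' pK mxE.
    by apply: funext => j; rewrite evray PE.
  apply/rowP => l; rewrite -[u in RHS]dir [RHS]mxE -h JE'; last first.
    by move=> j; rewrite evray PE; congr (peval _ _); apply/rowP => i; rewrite mxE ray0.
  rewrite mulmxA; congr ((_ *m _) 0 _); apply/rowP => j.
  by rewrite [RHS]mxE (JE _ _ (ray0 c u)) dir.
have [uJ uJ'] := mulmx1_unit JJ.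
(* The relation between [psi] and the matrix of [t] is differentiated at [c] along rays. As [t]
   fixes [c], it carries rays through [c] to curves [g] through [c]. *)
have JM t : torus t -> forall u : 'rV[K]_n, (act t u : 'rV[K]_n) *m J = u *m J *m Mt t.
  move=> tt u; apply/rowP => l.
  pose g i := (tpow t (w i))%:P * ray c u i.
  have gc i : (g i).[0] = c 0 i.
    rewrite hornerM hornerC ray0 -{2}(fixc t tt) mxE //.
  have h : along g (P l) = \sum_j along (ray c u) (P j) * (Mt t j l)%:P.
    apply: (poly_eq_fun hK) => e; rewrite horner_along horner_sum.
    rewrite (_ : (fun i => (g i).[e]) = act t (\row_i (ray c u i).[e]) 0).
      rewrite -[meval _ _]/(peval (P l) _) -PE MtP // mxE; apply: eq_bigr => j _.
      by rewrite hornerM hornerC evray PE.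
    by apply: funext => i; rewrite hornerM hornerC !mxE.
  have := JE g l gc; rewrite h speed_sum.
  rewrite (_ : \row_i _ = act t u) => [<-|]; last first.
    by apply/rowP => i; rewrite !mxE speedM speedC speed_ray mul0r add0r hornerC.
  rewrite [RHS]mxE; apply: eq_bigr => j _.
  by rewrite speedM speedC mulr0 addr0 hornerC (JE _ _ (ray0 c u)) dir.
exists (fun z => (psi z : 'rV_n) *m invmx J), (fun z => psi' (z *m J)).
exists (fun l => \sum_j P j * mpolyC n (invmx J j l)), (fun v => J *m Mv v *m invmx J).
split.
- by move=> z; rewrite mulmxKV // pK.
- by move=> z; rewrite pK' mulmxK.
- move=> z l; rewrite peval_sum mxE; apply: eq_bigr => j _.
  by rewrite pevalM pevalC PE.
- move=> t z tt; rewrite MtP //; apply: (can_inj (mulmxK uJ)).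
  by rewrite mulmxKV // JM // mulmxKV.
by move=> v z; rewrite MvP !mulmxA mulmxKV.
Qed.

End Linearized.

Section TopCoefficient.
Variable K : closedFieldType.
Hypothesis hK : [pchar K] =i pred0.

Lemma coef_shift (p : {poly K}) d c : (size p <= d.+1)%N -> (p \Po ('X + c%:P))`_d = p`_d.
Proof.
move=> sp; rewrite -[c]opprK polyCN comp_polyE coef_sum.
have [sd|ds] := leqP (size p) d.
  rewrite nth_default // big1 // => i _; rewrite coefZ [X in _ * X]nth_default ?mulr0 //.
  by rewrite size_exp_XsubC; apply: leq_trans (ltn_ord i) _.
have sz : size p = d.+1 by apply/eqP; rewrite eqn_leq sp.
rewrite sz big_ord_recr /= big1 => [|i _]; last first.
  by rewrite coefZ [X in _ * X]nth_default ?mulr0 // size_exp_XsubC.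
rewrite add0r coefZ [X in _ * X](_ : _ = 1) ?mulr1 //.
by have /monicP := monic_exp d (monicXsubC (- c)); rewrite /lead_coef size_exp_XsubC.
Qed.

(* [y'] is the coefficient of highest degree in [e] of the polynomial vector
   [y *m A e]; translating [e] does not change it. *)
Lemma top_coefficient n (A : K -> 'M[K]_n) (T : 'I_n -> 'I_n -> {poly K}) (y : 'rV[K]_n) :
  (forall e i l, A e i l = (T i l).[e]) -> (forall e e', A (e + e') = A e *m A e') -> A 0 = 1%:M ->
  y != 0 -> exists y' : 'rV[K]_n, [/\ y' != 0, forall e, y' *m A e = y' &
    forall q (Z : 'M[K]_(n, q)), (forall e, y *m A e *m Z = 0) -> y' *m Z = 0].
Proof.
move=> AT AD A0 y0; pose p j := \sum_i y 0 i *: T i j.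
have pE j e : (p j).[e] = (y *m A e) 0 j.
  by rewrite horner_sum mxE; apply: eq_bigr => i _; rewrite hornerZ AT.
have [j0 pj0] : exists j, p j != 0.
  apply: contrapT => h; case/eqP: y0; apply/rowP => j; rewrite -[y]mulmx1 -A0 -pE [RHS]mxE.
  by have [->|pj] := eqVneq (p j) 0; [rewrite horner0|case: h; exists j].
pose jm := [arg max_(j > j0) size (p j)].
have jmP j : (size (p j) <= size (p jm))%N.
  by rewrite /jm; case: arg_maxnP => // i _ h; apply: h.
have pm : p jm != 0.
  by rewrite -size_poly_gt0; apply: leq_trans (jmP j0); rewrite size_poly_gt0.
have sz j : (size (p j) <= (size (p jm)).-1.+1)%N by rewrite prednK ?size_poly_gt0.
exists (\row_j (p j)`_(size (p jm)).-1); split.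
- apply/eqP => /rowP/(_ jm); rewrite !mxE => /eqP.
  by rewrite -lead_coefE lead_coef_eq0 (negbTE pm).
- move=> e; apply/rowP => l; rewrite !mxE -(coef_shift e (sz l)).
  have -> : p l \Po ('X + e%:P) = \sum_j p j * (A e j l)%:P.
    apply: (poly_eq_fun hK) => x; rewrite horner_comp hornerD hornerX hornerC pE AD mulmxA mxE horner_sum.
    by apply: eq_bigr => j _; rewrite hornerM hornerC pE.
  by rewrite coef_sum; apply: eq_bigr => j _; rewrite coefMC mxE.
move=> q Z h; apply/rowP => l; rewrite !mxE.
have : \sum_j p j * (Z j l)%:P = 0.
  apply: (poly_eq_fun hK) => x; rewrite horner0; have /rowP/(_ l) := h x; rewrite !mxE => <-.
  by rewrite horner_sum; apply: eq_bigr => j _; rewrite hornerM hornerC pE.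
move=> /(congr1 (fun P : {poly K} => P`_(size (p jm)).-1)); rewrite coef0 coef_sum => h0; rewrite -[RHS]h0.
by apply: eq_bigr => j _; rewrite coefMC mxE.
Qed.

End TopCoefficient.

Lemma weight_blocks n r (w : 'I_n -> 'rV[int]_r) : exists k (blk : 'I_n -> 'I_k) (chi : 'I_k -> 'rV[int]_r),
  [/\ injective chi, forall i, w i = chi (blk i) & forall b, exists i, blk i = b].
Proof.
pose S := undup [seq w i | i <- enum 'I_n].
have wS i : w i \in S by rewrite mem_undup map_f // mem_enum.
have idx i : (index (w i) S < size S)%N by rewrite index_mem.
exists (size S), (fun i => Ordinal (idx i)), (fun b => nth 0 S b); split.
- move=> b b' /eqP; rewrite nth_uniq ?undup_uniq ?ltn_ord // => /eqP; exact: val_inj.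
- by move=> i /=; rewrite nth_index.
move=> b; have : nth 0 S b \in S by apply: mem_nth.
rewrite mem_undup => /mapP[i _ bi]; exists i; apply: val_inj => /=.
by rewrite -bi index_uniq ?undup_uniq ?ltn_ord.
Qed.

Lemma mulmx_row_ext (F : fieldType) n p (A B : 'M[F]_(n, p)) : (forall y : 'rV[F]_n, y *m A = y *m B) -> A = B.
Proof. by move=> h; apply/row_matrixP => i; rewrite !rowE. Qed.

(** * Linear forms invariant under the additive group *)

Section InvariantForms.
Variable K : closedFieldType.
Hypothesis hK : [pchar K] =i pred0.
Variables (n r m : nat) (w : 'I_n -> 'rV[int]_r) (beta : 'rV[K]_m -> affine_space K n -> affine_space K n).
Hypothesis beta_action : vector_group_action beta.
Hypothesis beta_comm : forall g t z, torus t ->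
  beta g (grading_action w t z) = grading_action w t (beta g z).
Local Notation act := (grading_action (K := K) w).

Lemma tpow_inj (a b : 'rV[int]_r) : (forall t : 'rV[K]_r, torus t -> tpow t a = tpow t b) -> a = b.
Proof.
move=> h; apply: contrapT => /eqP ab.
have u : uniq [:: a; b] by rewrite /= inE ab.
pose c (x : 'rV[int]_r) : K := if x == a then 1 else -1.
have /eqP : c a = 0; last by rewrite /c eqxx oner_eq0.
apply: (laurent_independent hK u) (mem_head _ _) => t tt.
by rewrite !big_cons big_nil addr0 /c eqxx eq_sym (negbTE ab) h // mul1r mulN1r subrr.
Qed.

Variables (psi psi' : affine_space K n -> affine_space K n) (B : 'I_n -> mpoly n K) (N : 'rV[K]_m -> 'M[K]_n).
Hypotheses (pK : cancel psi psi') (pK' : cancel psi' psi).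
Hypothesis BE : forall z l, psi z 0 l = peval (B l) z.
Hypothesis psi_act : forall t z, torus t -> psi (act t z) = act t (psi z).
Hypothesis psi_beta : forall v (z : 'rV[K]_n), psi (beta v z) = (psi z : 'rV[K]_n) *m N v.

Lemma lin_mat_beta v (y : 'rV[K]_n) : y *m N v = psi (beta v (psi' y)).
Proof. by rewrite psi_beta pK'. Qed.

Lemma lin_matD u v : N (u + v) = N v *m N u.
Proof.
apply: mulmx_row_ext => y; rewrite mulmxA !lin_mat_beta pK.
by have [[_ bD] _] := beta_action; rewrite bD.
Qed.

Lemma lin_mat0 : N 0 = 1%:M.
Proof. by apply: mulmx_row_ext => y; rewrite lin_mat_beta mulmx1; have [[-> _] _] := beta_action. Qed.

Lemma lin_mat_comm u v : N u *m N v = N v *m N u.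
Proof. by rewrite -!lin_matD addrC. Qed.

Lemma act_mulmx t (y : 'rV[K]_n) : act t y = y *m diag_mx (\row_i tpow t (w i)).
Proof. by apply/rowP => i; rewrite mul_mx_diag !mxE mulrC. Qed.

(** [N v] commutes with the diagonal matrices of the torus, hence preserves their common
    eigenspaces. *)
Lemma lin_mat_block v i l : w i != w l -> N v i l = 0.
Proof.
move=> wil; apply: contrapT => /eqP Nil; case/eqP: wil; apply: tpow_inj => t tt.
have /(congr1 (fun A : 'M[K]_n => A i l)) :
    diag_mx (\row_i tpow t (w i)) *m N v = N v *m diag_mx (\row_i tpow t (w i)).
  apply: mulmx_row_ext => y; rewrite !mulmxA -!act_mulmx !lin_mat_beta -psi_act // -beta_comm //.
  congr (psi (beta v _)); apply: (can_inj pK); rewrite pK' psi_act // pK'.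
  by [].
by rewrite mul_diag_mx mul_mx_diag !mxE mulrC => /(mulfI Nil).
Qed.

(** On a line the matrix entries are polynomials in one variable, as [top_coefficient] demands. *)
Lemma lin_mat_line (d : 'rV[K]_m) : exists T : 'I_n -> 'I_n -> {poly K}, forall e i l, N (e *: d) i l = (T i l).[e].
Proof.
have [_ bp] := vector_action_polynomial hK beta_action.
have /choice[R RE] : forall i, exists R : 'I_n -> mpoly m K, forall q v, beta v (psi' (delta_mx 0 i)) 0 q = peval (R q) v.
  by move=> i; have /choice[R RE] := bp (psi' (delta_mx 0 i)); exists R.
exists (fun i l => along (ray 0 d) (subst (R i) (B l))) => e i l.
have -> : N (e *: d) i l = (row i (N (e *: d))) 0 l by rewrite mxE.
rewrite rowE lin_mat_beta BE horner_along.
rewrite (_ : (fun q => (ray 0 d q).[e]) = (e *: d) 0); last first.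
  by apply/funext => q; rewrite /ray !hornerE !mxE add0r mulrC.
rewrite -[meval _ _]/(peval (subst (R i) (B l)) (e *: d)) peval_subst.
by congr (meval _ _); apply: funext => q; rewrite RE.
Qed.

(** Starting from a coordinate vector, [y] is replaced by a top coefficient for each coordinate
    direction in turn. Each replacement is invariant in the new direction and keeps the linear
    conditions already obtained. Transposes occur because [y] stands for a linear form. *)
Lemma invariant_vector i0 : exists y : 'rV[K]_n,
  [/\ y != 0, forall i, w i != w i0 -> y 0 i = 0 & forall v, y *m (N v)^T = y].
Proof.
have : exists y : 'rV[K]_n, [/\ y != 0, forall i, w i != w i0 -> y 0 i = 0 &
    forall j e, j \in enum 'I_m -> y *m (N (e *: delta_mx 0 j))^T = y].
  elim: (enum _) => [|j s [y [y0 ys yf]]].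
    exists (delta_mx 0 i0); split=> //.
      by apply/eqP => /rowP/(_ i0)/eqP; rewrite !mxE !eqxx oner_eq0.
    by move=> i wi; rewrite mxE; case: (i =P i0) => [e|]; rewrite ?andbF //; move: wi; rewrite e eqxx.
  have [T TE] := lin_mat_line (delta_mx 0 j).
  have [|||y' [y'0 y'f y'Z]] := @top_coefficient K hK n (fun e => (N (e *: delta_mx 0 j))^T) (fun i l => T l i) y _ _ _ y0.
  - by move=> e i l; rewrite mxE TE.
  - by move=> e e'; rewrite scalerDl lin_matD trmx_mul.
  - by rewrite scale0r lin_mat0 trmx1.
  exists y'; split=> //.
    (* The column [delta_mx i 0] extracts the i-th coordinate, so the support condition passes to
       [y']. *)
    move=> i wi; have := y'Z 1%N (delta_mx i 0); rewrite -!colE => h.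
    have := congr1 (fun Z : 'cV[K]_1 => Z 0 0) (h _); rewrite !mxE; apply => e; rewrite -colE.
    apply/colP => c; rewrite (ord1 c) !mxE big1 // => l _; rewrite mxE.
    have [il|il] := eqVneq (w i) (w l); last by rewrite lin_mat_block ?mulr0.
    by rewrite ys ?mul0r // -il.
  move=> j' e; rewrite inE => /orP[/eqP ->|js]; first exact: y'f.
  (* Invariance in an earlier direction is the condition for the matrix minus the identity; it holds
     along the new line because the matrices commute. *)
  apply/eqP; rewrite -subr_eq0 -{2}[y']mulmx1 -mulmxBr; apply/eqP; apply: y'Z => e'.
  by rewrite /= mulmxBr mulmx1 -mulmxA -trmx_mul lin_mat_comm trmx_mul mulmxA (yf _ _ js) subrr.
move=> [y [y0 ys yf]]; exists y; split=> // v.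
rewrite [v]row_sum_delta; apply: (big_ind (fun v => y *m (N v)^T = y)).
- by rewrite lin_mat0 trmx1 mulmx1.
- by move=> u u' hu hu'; rewrite lin_matD trmx_mul mulmxA hu hu'.
by move=> j _; apply: yf; rewrite mem_enum.
Qed.

(** [phi b] is an invariant linear form in the coordinates [psi] of block b. Distinct blocks involve
    disjoint coordinates, so all values can be prescribed at once. *)
Theorem invariant_forms k (blk : 'I_n -> 'I_k) (chi : 'I_k -> 'rV[int]_r) :
  injective chi -> (forall i, w i = chi (blk i)) -> (forall b, exists i, blk i = b) ->
  exists phi : 'I_k -> mpoly n K,
  [/\ forall b, whomog w (chi b) (phi b), forall b v z, peval (phi b) (beta v z) = peval (phi b) z &
      forall y : 'I_k -> K, exists z, forall b, peval (phi b) z = y b].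
Proof.
move=> chiI wE blkS.
have /choice[y yP] : forall b, exists y : 'rV[K]_n,
    [/\ y != 0, forall i, blk i != b -> y 0 i = 0 & forall v, y *m (N v)^T = y].
  move=> b; have [i0 i0b] := blkS b; have [y [y0 ys yf]] := invariant_vector i0.
  exists y; split=> // i ib; apply: ys; rewrite !wE i0b; apply: contra_neq ib; exact: chiI.
have phiE b z : peval (\sum_i mpolyC n (y b 0 i) * B i) z = ((psi z : 'rV[K]_n) *m (y b)^T) 0 0.
  by rewrite peval_sum mxE; apply: eq_bigr => i _; rewrite pevalM pevalC mxE BE mulrC.
exists (fun b => \sum_i mpolyC n (y b 0 i) * B i); split.
- move=> b; apply: (whomogP hK) => t z tt; rewrite !phiE psi_act // !mxE mulr_sumr.
  apply: eq_bigr => i _; rewrite !mxE; have [ib|ib] := eqVneq (blk i) b; first by rewrite wE ib mulrA.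
  by have [_ -> //] := yP b; rewrite !mulr0.
- move=> b v z; rewrite !phiE psi_beta -mulmxA.
  by have [_ _ h] := yP b; rewrite -{2}(h v) trmx_mul trmxK.
move=> c; have /choice[s sP] : forall b, exists i, y b 0 i != 0.
  move=> b; apply: contrapT => h; have [/eqP []] := yP b; apply/rowP => i; rewrite mxE; apply/eqP.
  by apply: contrapT => /negP yi; apply: h; exists i.
have sb b : blk (s b) = b.
  by apply/eqP; apply: contraT => h; have [_ /(_ _ h) y0 _] := yP b; move: (sP b); rewrite y0 eqxx.
exists (psi' (\row_i (if i == s (blk i) then c (blk i) / y (blk i) 0 i else 0))) => b.
rewrite phiE pK' mxE (bigD1 (s b)) //= !mxE sb eqxx mulfVK // big1 ?addr0 // => i ib.
rewrite !mxE; have [bi|bi] := eqVneq (blk i) b; first by rewrite bi (negbTE ib) mul0r.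
by have [_ -> //] := yP b; rewrite mulr0.
Qed.

End InvariantForms.

(** * Weights of the characteristic torus *)

Section IrreducibleSpaces.
Variable K : closedFieldType.
Variables (X : kspace K) (nX : nice X) (iX : irreducible [set: X]).

Lemma irreducible_meet (O1 O2 : set X) : open O1 -> open O2 -> O1 !=set0 -> O2 !=set0 -> O1 `&` O2 !=set0.
Proof.
move=> o1 o2 [x1 h1] [x2 h2]; apply: contrapT => h.
have [_ /(_ (~` O1) (~` O2))] := iX; case; [exact: open_closedC|exact: open_closedC| | |].
- by move=> x _; have [Ox|] := pselect (O1 x); [right=> Ox2; apply: h; exists x|left].
- by move=> /(_ x1 I).
by move=> /(_ x2 I).
Qed.

Lemma irreducible_meetn N (O : 'I_N -> set X) : (forall i, open (O i)) -> (forall i, O i !=set0) ->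
  exists V, [/\ open V, V !=set0 & forall x i, V x -> O i x].
Proof.
move=> oO neO; suff [V [oV neV VO]] : exists V, [/\ open V, V !=set0 & forall x i, i \in enum 'I_N -> V x -> O i x].
  by exists V; split=> // x i Vx; apply: VO Vx; rewrite mem_enum.
elim: (enum _) => [|i s [V [oV neV VO]]].
  by exists setT; split=> //; [exact: openT|have [[x _] _] := iX; exists x].
exists (O i `&` V); split; [exact: openI|exact: irreducible_meet|].
by move=> x j; rewrite inE => /orP[/eqP ->|js] [Ox Vx] //; exact: VO js Vx.
Qed.

Lemma irreducible_eq_trans (f g h : X -> K) : rational_eq f g -> rational_eq g h -> rational_eq f h.
Proof.
move=> [V [oV neV fg]] [W [oW neW gh]]; exists (V `&` W); split; [exact: openI|exact: irreducible_meet|].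
by move=> x [Vx Wx]; rewrite fg // gh.
Qed.

Lemma irreducible_eq_sym (f g : X -> K) : rational_eq f g -> rational_eq g f.
Proof. by move=> [V [oV neV fg]]; exists V; split=> // x Vx; rewrite fg. Qed.

Lemma open_neq (W : set X) f g : open W -> regular W f -> regular W g -> open (W `&` [set x | f x != g x]).
Proof.
move=> oW rf rg; rewrite (_ : _ `&` _ = W `&` [set x | f x - g x != 0]).
  by apply: (nice_open nX oW); apply: (regular_sub_fun nX oW).
by apply/seteqP; split=> x /= [Wx h]; split=> //; move: h; rewrite subr_eq0.
Qed.

(** A negative order means that f t^(m+1) equals a unit [u] generically, with [t] a uniformizer.
    Near a point of [Z] both sides are regular, yet the left one vanishes there and [u] does not. *)
Lemma regular_ord_ge0 (V Z : set X) f : open V -> regular V f ->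
  (forall x, V x -> f x != 0) -> prime_divisor Z -> Z `&` V !=set0 -> 0 <= ord Z f.
Proof.
move=> oV rf f0 [[_ iZ] _ _] neZV; rewrite /ord; case: xgetP => [k _ [V1 [t [u [un ru u0 fE]]]]|] //.
(* [Negz m] is -(m + 1), whence the exponent [m.+1] below. *)
case: k fE => [//|m] [V2 [oV2 [x2 Vx2] fE]]; exfalso.
have [oV1 [x1 [Zx1 V1x1]] rt tZ _] := un.
have [x [Zx [Vx V1x]]] : exists x, Z x /\ V x /\ V1 x.
  apply: contrapT => h; have [y [Zy Vy]] := neZV.
  have [_ /(_ (~` V) (~` V1))] := iZ; case; [exact: open_closedC|exact: open_closedC| | |].
  - by move=> z Zz; have [Vz|] := pselect (V z); [right=> V1z; apply: h; exists z|left].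
  - by move=> /(_ y Zy).
  by move=> /(_ x1 Zx1).
have oW := openI oV oV1.
have rf' := regular_sub nX oW oV (@subIsetl _ _ _) rf.
have rt' := regular_sub nX oW oV1 (@subIsetr _ _ _) rt.
have ru' := regular_sub nX oW oV1 (@subIsetr _ _ _) ru.
have rg := nice_mul nX oW rf' (regular_exp nX m.+1 oW rt').
have xW : ((V `&` V1) `&` [set x | f x * t x ^+ m.+1 != u x]) x.
  by split=> //=; rewrite (tZ x Zx V1x) expr0n mulr0 eq_sym u0.
have [y [[[Vy V1y] /eqP ny] V2y]] := irreducible_meet (open_neq oW rg ru') oV2 (ex_intro _ _ xW) (ex_intro _ _ Vx2).
have fy := fE y V2y; apply: ny.
have ty : t y != 0.
  by apply: contraNneq (f0 y Vy) => ty; rewrite fy ty NegzE -exprnN expr0n invr0 mulr0.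
by rewrite fy NegzE -exprnN mulfVK // expf_neq0.
Qed.

End IrreducibleSpaces.

(** * Functions and sections on the characteristic space *)

Section CoxForward.
Variable K : closedFieldType.
Hypothesis hK : [pchar K] =i pred0.
Variables (X : kspace K) (nX : nice X) (iX : irreducible [set: X]) (C : Cox_construction X).
Local Notation n := (cox_dim C).
Local Notation r := (cox_rank C).
Local Notation w := (@cox_deg K X C).
Local Notation s := (@cox_sec K X C).
Local Notation D := (@cox_div K X C).
Local Notation U := (@cox_space K X C).
Local Notation p := (@cox_proj K X C).
Local Notation act := (grading_action (K := K) w).

Lemma cox_eval_zero F a : whomog w a F -> rational_eq (fun x => meval (s ^~ x) F) (fun=> 0) -> F = 0.
Proof.
move=> hF F0; have [x0 _] : [set: X] !=set0 by case: iX.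
have [_ h] := cox_ring C.
have s0 : sections setT (comb D a) (fun=> 0).
  split; first by exists setT; split; [exact: openT|exists x0|exact: nice_cst openT].
  by left; exists setT; split; [exact: openT|exists x0|].
have [P [[hP PE] uP]] := h a _ s0.
rewrite -(uP F); last by split=> //; exact: irreducible_eq_sym.
apply: uP; split; first exact: whomog0.
by exists setT; split; [exact: openT|exists x0|move=> x _; rewrite meval0].
Qed.

Lemma cox_sec_regular : exists V, [/\ open V, V !=set0 & forall i, regular V (s i)].
Proof.
have /choice[O OP] := fun i => ((cox_ring C).1 i).1.
have [V [oV neV VO]] := irreducible_meetn iX (fun i => let: And3 h _ _ := OP i in h) (fun i => let: And3 _ h _ := OP i in h).
exists V; split=> // i; have [oO _ rO] := OP i.
by apply: (regular_sub nX oV oO _ rO) => x; exact: VO.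
Qed.

Lemma cox_eval_neq0 F a : whomog w a F -> F != 0 -> exists V,
  [/\ open V, V !=set0, forall i, regular V (s i), regular V (fun x => meval (s ^~ x) F) &
      forall x, V x -> meval (s ^~ x) F != 0].
Proof.
move=> hF F0; have [V [oV neV rV]] := cox_sec_regular.
have rF := regular_meval nX F oV rV.
have oVF := nice_open nX oV rF.
exists (V `&` [set x | meval (s ^~ x) F != 0]); split=> //.
- apply: contrapT => h; case/eqP: F0; apply: (cox_eval_zero hF); exists V; split=> // x Vx.
  by apply/eqP; apply: contrapT => /negP Fx; apply: h; exists x.
- by move=> i; exact: (regular_sub nX oVF oV (@subIsetl _ _ _) (rV i)).
- exact: (regular_sub nX oVF oV (@subIsetl _ _ _) rF).
by move=> x [].
Qed.

Lemma cox_fraction_cross a c f (A B P Q : mpoly n K) b : whomog w (a + b) P -> whomog w b Q -> Q != 0 ->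
  whomog w (a + c) A -> whomog w c B -> B != 0 ->
  rational_eq f (fun x => meval (s ^~ x) P / meval (s ^~ x) Q) ->
  rational_eq f (fun x => meval (s ^~ x) A / meval (s ^~ x) B) -> P * B = A * Q.
Proof.
move=> hP hQ Q0 hA hB B0 fP fA; apply/eqP; rewrite -subr_eq0; apply/eqP.
have hPB : whomog w (a + b + c) (P * B) by exact: (whomogM hK hP hB).
have hAQ : whomog w (a + b + c) (A * Q) by rewrite addrAC; exact: (whomogM hK hA hQ).
apply: (@cox_eval_zero _ (a + b + c)).
  by rewrite -mulN1r -mpolyC1 -mpolyCN mul_mpolyC; apply: (whomogD hK hPB); exact: (whomogZ hK).
have [V1 [oV1 neV1 _ _ Q1]] := cox_eval_neq0 hQ Q0.
have [V2 [oV2 neV2 _ _ B2]] := cox_eval_neq0 hB B0.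
have [V3 [oV3 neV3 E3]] := irreducible_eq_trans iX (irreducible_eq_sym fP) fA.
have ne12 := irreducible_meet iX oV1 oV2 neV1 neV2.
exists (V1 `&` V2 `&` V3); split; [by apply: openI => //; exact: openI| |].
  by apply: (irreducible_meet iX _ oV3 ne12 neV3); exact: openI.
move=> x [[V1x V2x] V3x]; rewrite mevalB !mevalM; apply/eqP; rewrite subr_eq0.
by have /eqP := E3 x V3x; rewrite eqr_div ?Q1 ?B2.
Qed.

(** [Cox_fraction] relates [f] and [h] only generically and through unspecified forms; cross
    multiplication replaces these by [A] and [B], and regularity of [h] extends the equality to all
    of [O]. *)
Lemma cox_fraction_value a c f h (A B : mpoly n K) (O : set (affine_space K n)) :
  Cox_fraction w s a h f -> whomog w (a + c) A -> whomog w c B -> B != 0 ->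
  rational_eq f (fun x => meval (s ^~ x) A / meval (s ^~ x) B) ->
  open O -> O !=set0 -> regular O h -> forall z, O z -> h z * peval B z = peval A z.
Proof.
move=> [b [P [Q [hP hQ Q0 hE fE]]]] hA hB B0 fA oO neO rh.
have PB := cox_fraction_cross hP hQ Q0 hA hB B0 fE fA.
have [E [oE neE hPQ]] := hE.
have nA := nice_affine K n.
have oQ := open_basic (K := K) Q.
have neQ : [set z : affine_space K n | peval Q z != 0] !=set0.
  by have [z Qz] := peval_nonzero hK Q0; exists z.
have oEQ := openI oE oQ; have neEQ := affine_meet hK oE oQ neE neQ.
have rB := @regular_peval K n O B.
apply: (regular_agree hK oO oEQ _ (nice_mul nA oO rh rB) (@regular_peval K n O A)).
  exact: (affine_meet hK oO oEQ neO neEQ).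
move=> z _ [Ez Qz]; rewrite hPQ // mulrAC -pevalM PB pevalM mulfK //.
Qed.

Lemma cox_pull_open O : open O -> open (U `&` p @^-1` O).
Proof.
move=> oO; have [[/continuousP cp _] _ _ _ _] := cox_quot C.
have /open_restrictP[V oV VE] := cp _ oO.
rewrite (_ : _ `&` _ = U `&` V); first exact: (openI (cox_open C) oV).
apply/seteqP; split=> z [Uz h]; split=> //.
  by rewrite -[z]/(set_val (SigSub (mem_set Uz) : restrict U)) -[V _]/((set_val @^-1` V) (SigSub (mem_set Uz) : restrict U)) VE.
by move: h; rewrite -{1}[z]/(set_val (SigSub (mem_set Uz) : restrict U)) -[V _]/((set_val @^-1` V) (SigSub (mem_set Uz) : restrict U)) VE.
Qed.

Lemma cox_pull_regular O f : open O -> regular O f -> regular (U `&` p @^-1` O) (f \o p).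
Proof.
move=> oO rf; have [[/continuousP cp rp] _ _ _ _] := cox_quot C.
have := rp _ _ oO rf; have /open_restrictP[V oV VE] := cp _ oO.
have nA := nice_affine K n.
rewrite -VE => /(regular_extend _ nA (cox_open C) oV) h.
have UV : U `&` V = U `&` p @^-1` O.
  apply/seteqP; split=> z [Uz h']; split=> //.
    by move: h'; rewrite -{1}[z]/(set_val (SigSub (mem_set Uz) : restrict U)) -[V _]/((set_val @^-1` V) (SigSub (mem_set Uz) : restrict U)) VE.
  by rewrite -[z]/(set_val (SigSub (mem_set Uz) : restrict U)) -[V _]/((set_val @^-1` V) (SigSub (mem_set Uz) : restrict U)) VE.
rewrite -UV; apply: (regular_eq nA _ _ h); first exact: (openI (cox_open C) oV).
move=> z [Uz _]; by rewrite -[z]/(set_val (SigSub (mem_set Uz) : restrict U)) extendE.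
Qed.

Lemma cox_surj x : exists2 z, U z & p z = x.
Proof. by have [_ _ /(_ x)[z [Uz pz]] _ _] := cox_quot C; exists z. Qed.

Lemma cox_pull_nonempty O : O !=set0 -> U `&` p @^-1` O !=set0.
Proof. by move=> [x Ox]; have [z Uz pz] := cox_surj x; exists z; split=> //=; rewrite pz. Qed.

Lemma cox_act t z : torus t -> U z -> U (act t z) /\ p (act t z) = p z.
Proof. by move=> tt Uz; have [_ h _ _ _] := cox_quot C; exact: h. Qed.

(** [V] is the complement of finitely many prime divisors; over it all the divisors [comb D a] are
    trivial. *)
Lemma cox_div_avoid : exists V, [/\ open V, V !=set0 &
  forall Z, prime_divisor Z -> Z `&` V !=set0 -> forall j, D j Z = 0].
Proof.
have [dD _] := cox_basis C.
suff [V [oV neV VP]] : exists V, [/\ open V, V !=set0 &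
    forall Z, prime_divisor Z -> Z `&` V !=set0 -> forall j, j \in enum 'I_r -> D j Z = 0].
  by exists V; split=> // Z pZ ZV j; apply: VP => //; rewrite mem_enum.
elim: (enum _) => [|j t [V [oV neV VP]]].
  by exists setT; split=> //; [exact: openT|have [[x _] _] := iX; exists x].
have [fj pj] := dD j.
have /finite_seqP[S SE] := fj.
suff [O [oO neO OP]] : exists O, [/\ open O, O !=set0 & forall Z, Z \in S -> Z `&` O = set0].
  exists (V `&` O); split; [exact: openI|exact: irreducible_meet|].
  move=> Z pZ [x [Zx [Vx Ox]]] j'; rewrite inE => /orP[/eqP ->|jt]; last first.
    by apply: VP jt => //; exists x.
  apply/eqP; apply: contrapT => /negP DZ.
  have ZS : Z \in S by have : [set Z | D j Z != 0] Z by []; rewrite SE.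
  by have := OP Z ZS => /seteqP[/(_ x (conj Zx Ox))].
have : forall Z, Z \in S -> prime_divisor Z.
  by move=> Z ZS; apply: pj; have : [set Z | Z \in S] Z by []; rewrite -SE.
elim: S {SE} => [_|Z S IH pS].
  by exists setT; split=> //; [exact: openT|have [[x _] _] := iX; exists x].
have [|O [oO neO OP]] := IH; first by move=> Z' ZS; apply: pS; rewrite inE ZS orbT.
have [[cZ _] cA _] : prime_divisor Z by apply: pS; rewrite mem_head.
have [x nZx] := chain_above_top cA.
exists (~` Z `&` O); split; [by apply: openI => //; exact: closed_openC| |].
  by apply: irreducible_meet => //; [exact: closed_openC|exists x].
move=> Z'; rewrite inE => /orP[/eqP ->|ZS]; first by apply/seteqP; split=> // y [Zy []].
by apply/seteqP; split=> // y [Zy [_ Oy]]; have /seteqP[/(_ y (conj Zy Oy))] := OP Z' ZS.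
Qed.

Lemma unit_section V f a : open V -> V !=set0 -> regular V f -> (forall x, V x -> f x != 0) ->
  exists V', [/\ open V', V' !=set0, V' `<=` V & sections V' (comb D a) f].
Proof.
move=> oV neV rf f0; have [O [oO neO OP]] := cox_div_avoid.
have neVO := irreducible_meet iX oV oO neV neO.
exists (V `&` O); split; [exact: openI| |by move=> x []|] => //.
split; first by exists V.
right=> Z pZ [x [Zx [Vx Ox]]].
rewrite /comb big1 => [|j _]; last by rewrite (OP Z) ?mulr0 //; exists x.
rewrite addr0; apply: (regular_ord_ge0 nX iX oV rf f0 pZ); by exists x.
Qed.

(* Away from the supports of the [D j], the function 1 is a section of every
   degree, so that every degree is a difference of degrees of monomials. *)
Lemma cox_weights_span (a : 'rV[int]_r) : exists c : 'I_n -> int, a = \sum_i w i *~ c i.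
Proof.
have [x0 _] : [set: X] !=set0 by case: iX.
have r1 := nice_cst nX (1 : K) (@openT X).
have [|V [oV neV _ s1]] := @unit_section setT (fun=> 1) a openT (ex_intro _ x0 I) r1.
  by move=> x _; exact: oner_neq0.
have [h [_ [b [P [Q [hP hQ Q0 _ fE]]]]]] := (cox_sheaf a (fun=> 1) oV neV).1 s1.
have P0 : P != 0.
  apply/eqP => P0; have [V' [_ [x Vx] /(_ x Vx)/eqP]] := fE.
  by rewrite P0 meval0 mul0r oner_eq0.
have [mu muP] : exists mu, mu \in msupp P.
  by case E : (msupp P) => [|u S]; [move/eqP: E; rewrite msupp_eq0 (negbTE P0)|exists u; rewrite mem_head].
have [nu nuQ] : exists nu, nu \in msupp Q.
  by case E : (msupp Q) => [|u S]; [move/eqP: E; rewrite msupp_eq0 (negbTE Q0)|exists u; rewrite mem_head].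
exists (fun i => (mu i)%:Z - (nu i)%:Z).
under eq_bigr do rewrite mulrzBr -!pmulrn.
by rewrite sumrB (hP _ muP) (hQ _ nuQ) addrK.
Qed.

(** On a small open set the inverse of the j-th Cox section is a section of degree [- w j]. The
    sheaf condition turns it into a regular function upstairs whose product with the j-th coordinate
    is 1. *)
Lemma cox_nonvanishing : exists V, [/\ open V, V !=set0 & forall z, U z -> V (p z) -> forall i, z 0 i != 0].
Proof.
suff /choice[O OP] : forall j, exists O, [/\ open O, O !=set0 & forall z, U z -> O (p z) -> z 0 j != 0].
  have [V [oV neV VO]] := irreducible_meetn iX (fun i => let: And3 h _ _ := OP i in h) (fun i => let: And3 _ h _ := OP i in h).
  by exists V; split=> // z Uz Vz i; have [_ _ h] := OP i; apply: h => //; exact: VO.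
move=> j; have hX : whomog w (w j) (pvar K j) by exact: whomog_var.
have [V [oV neV rs rX X0]] := cox_eval_neq0 hX (pvar_neq0 K j).
have rV := nice_inv nX oV rX X0.
have [|V' [oV' neV' V'V sV]] := @unit_section V (fun x => (meval (s ^~ x) (pvar K j))^-1) (- w j) oV neV rV.
  by move=> x Vx; rewrite invr_eq0 X0.
have [h [rh hf]] := (cox_sheaf _ _ oV' neV').1 sV.
exists V'; split=> // z Uz Vz.
have h1 : whomog (K := K) w (- w j + w j) 1 by rewrite addNr; have h1 := @whomog1 K hK n r w; exact: h1.
have := cox_fraction_value hf h1 hX (pvar_neq0 K j) _ (cox_pull_open oV') (cox_pull_nonempty neV') rh.
move=> /(_ _ z (conj Uz Vz)); rewrite peval_var peval1 => hz.
apply: contra_eq_neq (hz _) => [->|]; first by rewrite mulr0 eq_sym oner_eq0.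
by exists V; split=> // x _; rewrite meval1 mul1r.
Qed.

End CoxForward.

Section TorusComparison.
Variable K : closedFieldType.

Lemma tpow_mulmx k r (u : 'rV[K]_k) (L : 'M[int]_(r, k)) (a : 'rV[int]_r) : torus u ->
  tpow (\row_j tpow u (row j L)) a = tpow u (a *m L).
Proof.
move=> tu; rewrite mulmx_sum_row tpow_sum //; apply: eq_bigr => j _; rewrite mxE.
have e : {morph (fun x : K => x ^ a 0 j) : x y / x * y} by move=> x y; rewrite expfzMl.
rewrite /tpow (big_morph _ e (@exp1rz K _)); apply: eq_bigr => b _.
by rewrite exprz_exp !mxE mulrC.
Qed.

Variables (n k r : nat) (blk : 'I_n -> 'I_k) (chi : 'I_k -> 'rV[int]_r) (L : 'M[int]_(r, k)).
(** [L] lifts each scaling of the blocks to an element of the given torus, so the two tori have the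
    same orbits. *)
Hypothesis chiL : forall b, chi b *m L = delta_mx 0 b.
Local Notation w := (fun i => chi (blk i)).

Lemma chi_act_block (t : 'rV[K]_r) (z : affine_space K n) :
  grading_action w t z = grading_action (block_weight blk) (\row_b tpow t (chi b)) z.
Proof. by rewrite block_act; apply/rowP => i; rewrite !mxE. Qed.

Lemma chi_torus (t : 'rV[K]_r) : torus t -> torus (\row_b tpow t (chi b)).
Proof. by move=> tt b; rewrite mxE tpow_neq0. Qed.

Lemma block_act_chi (u : 'rV[K]_k) (z : affine_space K n) : torus u ->
  grading_action (block_weight blk) u z = grading_action w (\row_j tpow u (row j L)) z.
Proof.
move=> tu; rewrite block_act; apply/rowP => i; rewrite !mxE; congr (_ * _).
rewrite -[RHS]/(tpow _ (chi (blk i))) tpow_mulmx // chiL /tpow (bigD1 (blk i)) //= !mxE !eqxx expr1z.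
by rewrite big1 ?mulr1 // => b bi; rewrite mxE (negbTE bi) expr0z.
Qed.

Lemma row_torus (u : 'rV[K]_k) : torus u -> torus (\row_j tpow u (row j L)).
Proof. by move=> tu j; rewrite mxE tpow_neq0. Qed.

End TorusComparison.

Section Independence.
Variable K : closedFieldType.
Hypothesis hK : [pchar K] =i pred0.
Variables (X : kspace K) (nX : nice X) (iX : irreducible [set: X]) (C : Cox_construction X).
Variables (m : nat) (alpha : 'rV[K]_m -> X -> X).
Variable beta : 'rV[K]_m -> affine_space K (cox_dim C) -> affine_space K (cox_dim C).
Hypotheses (halpha : additive_action alpha) (hbeta : lifted_action alpha beta).
Local Notation n := (cox_dim C).
Local Notation r := (cox_rank C).
Local Notation w := (@cox_deg K X C).
Local Notation s := (@cox_sec K X C).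
Local Notation U := (@cox_space K X C).
Local Notation p := (@cox_proj K X C).

(* [A / B] is the pullback of a rational function on [X], which is constant on
   the open orbit of [alpha]. *)
Lemma invariant_forms_proportional d (A B : mpoly n K) : whomog w d A -> whomog w d B -> B != 0 ->
  (forall v z, peval A (beta v z) = peval A z) -> (forall v z, peval B (beta v z) = peval B z) ->
  exists c, A = mpolyC n c * B.
Proof.
move=> hA hB B0 iA iB.
have [V [oV neV rs rB sB]] := cox_eval_neq0 hK nX iX hB B0.
have rA := regular_meval nX A oV rs.
have rf := regular_div nX oV rA rB sB.
have [_ _ bU bp] := hbeta; have [[[_ aD] _] _ [x0 oO]] := halpha.
have neO : [set alpha g x0 | g in setT] !=set0 by exists (alpha 0 x0); exists 0.
have neVO := irreducible_meet iX oV oO neV neO; have oVO := openI oV oO.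
have hA0 : whomog w (0 + d) A by rewrite add0r.
have fval z : U z -> V (p z) -> meval (s ^~ (p z)) A / meval (s ^~ (p z)) B * peval B z = peval A z.
  move=> Uz Vz; apply: (cox_fraction_value hK nX iX (cox_proj_compat C oV neV rf) hA0 hB B0 _
    (cox_pull_open C oV) (cox_pull_nonempty C neV) (cox_pull_regular oV rf)) (conj Uz Vz).
  by exists V; split.
have oE := cox_pull_open C oVO; have neE := cox_pull_nonempty C neVO.
have neB : [set z : affine_space K n | peval B z != 0] !=set0.
  by have [z Bz] := peval_nonzero hK B0; exists z.
have [z1 [[Uz1 [Vz1 [g1 _ gz1]]] Bz1]] := affine_meet hK oE (open_basic (K := K) B) neE neB.
exists (peval A z1 / peval B z1); apply: (mpoly_eq_open hK oE neE) => z [Uz [Vz [g _ gz]]].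
(* A translate of [z1] lies in the fibre of [z], and the invariant forms keep their values at [z1]
   on it. *)
have pz : p (beta (g - g1) z1) = p z by rewrite bp // -gz1 -aD // subrK gz.
have := fval _ (bU (g - g1) z1 Uz1); rewrite pz iA iB => /(_ Vz) h.
by rewrite pevalM pevalC -(fval z Uz Vz) -h mulfK.
Qed.

Variables (k : nat) (chi : 'I_k -> 'rV[int]_r) (phi : 'I_k -> mpoly n K).
Hypothesis hphi : forall b, whomog w (chi b) (phi b).
Hypothesis iphi : forall b v z, peval (phi b) (beta v z) = peval (phi b) z.
Hypothesis sphi : forall y : 'I_k -> K, exists z, forall b, peval (phi b) z = y b.

(** The positive and negative parts of a relation give two invariant monomials in the [phi b] of
    equal degree, hence proportional. Where all [phi b] equal 1 the factor is seen to be 1; where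
    only [phi b0] vanishes the values differ unless [a b0] is 0. *)
Lemma weights_independent (a : 'I_k -> int) : \sum_b chi b *~ a b = 0 -> forall b, a b = 0.
Proof.
move=> a0 b0.
have hpow (e : 'I_k -> nat) : whomog w (\sum_b chi b *+ e b) (\prod_b phi b ^+ e b).
  by apply: (whomog_prod hK) => b _; exact: (whomogX hK).
have epow (e : 'I_k -> nat) z : peval (\prod_b phi b ^+ e b) z = \prod_b peval (phi b) z ^+ e b.
  by rewrite peval_prod; apply: eq_bigr => b _; rewrite pevalX.
have ipow (e : 'I_k -> nat) v z : peval (\prod_b phi b ^+ e b) (beta v z) = peval (\prod_b phi b ^+ e b) z.
  by rewrite !epow; apply: eq_bigr => b _; rewrite iphi.
have [z1 z1E] := sphi (fun=> 1).
have one (e : 'I_k -> nat) : peval (\prod_b phi b ^+ e b) z1 = 1.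
  by rewrite epow big1 // => b _; rewrite z1E expr1n.
have pow0 (e : 'I_k -> nat) : \prod_b phi b ^+ e b != 0.
  by apply/eqP => h; have := one e; rewrite h peval0 => /esym/eqP; rewrite oner_eq0.
have deg : \sum_b chi b *+ posp (a b) = \sum_b chi b *+ negp (a b).
  apply/eqP; rewrite -subr_eq0 -sumrB; apply/eqP; rewrite -[RHS]a0; apply: eq_bigr => b _.
  by rewrite -[in RHS](pospB (a b)) mulrzBr -!pmulrn.
have hp := hpow (fun b => posp (a b)); rewrite deg in hp.
have [c cE] := invariant_forms_proportional hp (hpow (fun b => negp (a b))) (pow0 _) (ipow _) (ipow _).
have c1 : c = 1.
  by have := congr1 (fun P => peval P z1) cE; rewrite pevalM pevalC !one mulr1 => ->.
have [z0 z0E] := sphi (fun b => (b != b0)%:R).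
have zero (e : 'I_k -> nat) : peval (\prod_b phi b ^+ e b) z0 = (e b0 == 0)%N%:R.
  rewrite epow (bigD1 b0) //= z0E eqxx /= expr0n big1 ?mulr1 // => b bb0.
  by rewrite z0E bb0 expr1n.
have /eqP := congr1 (fun P => peval P z0) cE; rewrite pevalM pevalC c1 mul1r !zero /posp /negp.
case: ifP => a0'; first by case: (a b0) a0' => [[|l]|l] //= _; rewrite eq_sym oner_eq0.
by case: (a b0) a0' => [l|l] //= _; rewrite oner_eq0.
Qed.

Variable blk : 'I_n -> 'I_k.
Hypothesis wE : forall i, w i = chi (blk i).

(** Spanning gives L' A = 1 for the matrix A with rows the weights. Then (A L' - 1) A = 0, and
    independence of the rows of A yields A L' = 1. *)
Lemma weights_basis : exists L : 'M[int]_(r, k), forall b, chi b *m L = delta_mx 0 b.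
Proof.
have /choice[L LE] : forall j : 'I_r, exists l : 'rV[int]_k, delta_mx 0 j = \sum_b chi b *~ l 0 b.
  move=> j; have [c cE] := cox_weights_span nX iX (delta_mx 0 j).
  exists (\row_b \sum_(i | blk i == b) c i); rewrite cE (partition_big blk xpredT) //=.
  apply: eq_bigr => b _; rewrite mxE raddf_sum; apply: eq_bigr => i /eqP ib.
  by rewrite wE ib.
pose A : 'M[int]_(k, r) := \matrix_b chi b; pose L' : 'M[int]_(r, k) := \matrix_j L j.
have LA : L' *m A = 1%:M.
  apply/row_matrixP => j; rewrite row_mul rowK row1 LE mulmx_sum_row.
  by apply: eq_bigr => b _; rewrite rowK -scaler_int intz.
have AL : A *m L' = 1%:M.
  apply/row_matrixP => b; apply/rowP => b'; apply/eqP; rewrite -subr_eq0; apply/eqP.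
  have /weights_independent/(_ b') : \sum_b' chi b' *~ ((row b (A *m L') - row b 1%:M) 0 b') = 0.
    have : (row b (A *m L') - row b 1%:M) *m A = 0 by rewrite mulmxBl -!row_mul -mulmxA LA mulmx1 mul1mx subrr.
    rewrite mulmx_sum_row => h; rewrite -[RHS]h.
    by apply: eq_bigr => b1 _; rewrite rowK -scaler_int intz.
  by rewrite !mxE.
by exists L' => b; have := congr1 (row b) AL; rewrite row_mul rowK row1.
Qed.

End Independence.

(** * Comparison with a product of projective spaces *)

Section BlockScaling.
Variables (K : closedFieldType) (n k : nat) (blk : 'I_n -> 'I_k).
Hypothesis hK : [pchar K] =i pred0.

(** Unlike the torus action this admits c = 0, the limit in which a block disappears. *)
Definition block_scale b (c : K) (z : affine_space K n) : affine_space K n :=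
  \row_i (if blk i == b then c * z 0 i else z 0 i).

Lemma block_scale_act b c z : c != 0 ->
  exists2 u : 'rV[K]_k, torus u & block_scale b c z = grading_action (block_weight blk) u z.
Proof.
move=> c0; exists (\row_b' (if b' == b then c else 1)).
  by move=> b'; rewrite mxE; case: (b' == b); rewrite ?oner_neq0.
by rewrite block_act; apply/rowP => i; rewrite !mxE; case: eqP; rewrite ?mul1r.
Qed.

Lemma block_scale_poly b z (F : mpoly n K) : exists f : {poly K}, forall c, f.[c] = peval F (block_scale b c z).
Proof.
exists (along (fun i => if blk i == b then 'X * (z 0 i)%:P else (z 0 i)%:P) F) => c.
rewrite horner_along; congr (meval _ F); apply: funext => i; rewrite mxE.
by case: ifP => _; rewrite ?hornerM ?hornerX hornerC.
Qed.

Lemma wdeg_block_ge0 (mu : multinom n) b : 0 <= (wdeg (block_weight blk) mu) 0 b.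
Proof.
rewrite summxE sumr_ge0 // => i _.
by rewrite /block_weight -scaler_nat mxE mxE eqxx /=; case: (b == _); rewrite ?mulr1 ?mulr0.
Qed.

Lemma whomog_ge0 a (F : mpoly n K) b : F != 0 -> whomog (block_weight blk) a F -> 0 <= a 0 b.
Proof.
move=> F0 hF; case E : (msupp F) => [|mu S]; first by move/eqP: E; rewrite msupp_eq0 (negbTE F0).
by rewrite -(hF mu) ?wdeg_block_ge0 // E mem_head.
Qed.

Lemma whomog_block0 a (F : mpoly n K) b z : whomog (block_weight blk) a F -> a 0 b = 0 ->
  peval F (block_scale b 0 z) = peval F z.
Proof.
move=> hF ab; have [f fE] := block_scale_poly b z F; rewrite -fE.
have -> : f = (peval F z)%:P; last by rewrite hornerC.
have X0 : 'X != 0 :> {poly K} by rewrite polyX_eq0.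
(* The factor X disposes of the comparison at c = 0; for other c the scaling comes from the
   torus. *)
apply: (mulIf X0); apply: (poly_eq_fun hK) => c; rewrite !hornerM hornerC hornerX.
have [->|c0] := eqVneq c 0; first by rewrite !mulr0.
congr (_ * _); rewrite fE; pose u : 'rV[K]_k := \row_b' (if b' == b then c else 1).
have tu : torus u by move=> b'; rewrite mxE; case: (b' == b); rewrite ?oner_neq0.
have -> : block_scale b c z = grading_action (block_weight blk) u z.
  by rewrite block_act; apply/rowP => i; rewrite !mxE; case: eqP; rewrite ?mul1r.
rewrite (whomog_act _ tu hF) /tpow (bigD1 b) //= ab expr0z mul1r big1 ?mul1r // => b' bb.
by rewrite mxE (negbTE bb) exp1rz.
Qed.

Lemma block_scale0_notin b z : ~ Uhat blk (block_scale b 0 z).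
Proof. by move=> /(_ b)[i ib]; rewrite mxE ib eqxx mul0r eqxx. Qed.

End BlockScaling.

Section CoxBlocks.
Variable K : closedFieldType.
Hypothesis hK : [pchar K] =i pred0.
Variables (X : kspace K) (vX : variety X) (iX : irreducible [set: X]) (C : Cox_construction X).
Local Notation n := (cox_dim C).
Local Notation r := (cox_rank C).
Local Notation w := (@cox_deg K X C).
Local Notation U := (@cox_space K X C).
Local Notation p := (@cox_proj K X C).
Let nX := nice_variety vX.

(** The complement of [U] is a union of coordinate subspaces, so membership depends only on which
    coordinates vanish. *)
Lemma cox_support (z z' : 'rV[K]_n) : U z -> (forall i, z' 0 i = 0 -> z 0 i = 0) -> U z'.
Proof.
move=> Uz h; have [F [_ UF]] := cox_compl C; apply: contrapT => nU.
have : (~` U) z' by []; rewrite UF => -[I IF Iz].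
have : (~` U) z by rewrite UF; exists I => // i iI; exact: h (Iz i iI).
by [].
Qed.

Variables (k : nat) (blk : 'I_n -> 'I_k) (chi : 'I_k -> 'rV[int]_r) (L : 'M[int]_(r, k)).
Hypotheses (chiL : forall b, chi b *m L = delta_mx 0 b) (wE : w = fun i => chi (blk i)).
Hypothesis blkS : forall b, exists i, blk i = b.
Local Notation bact := (grading_action (K := K) (block_weight blk)).

Lemma cox_block_act u (z : affine_space K n) : torus u -> U z -> U (bact u z) /\ p (bact u z) = p z.
Proof.
move=> tu Uz; rewrite (block_act_chi blk chiL z tu) -wE; apply: cox_act Uz; exact: row_torus.
Qed.

Lemma cox_block_invariant O : invariant_set (block_weight blk) (U `&` p @^-1` O).
Proof. by move=> u z tu [Uz Oz]; have [U' pE] := cox_block_act tu Uz; split=> //=; rewrite pE. Qed.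

(* The closure of the orbit of a point over [cox_nonvanishing] would contain a
   point of [U] whose block [b] vanishes, in the same closed fibre of [p]. *)
Lemma cox_in_Uhat : U `<=` Uhat blk.
Proof.
move=> z Uz b; apply: contrapT => nb.
have zb i : blk i = b -> z 0 i = 0.
  by move=> ib; apply/eqP; apply: contrapT => /negP zi; apply: nb; exists i.
have [V [oV neV VP]] := cox_nonvanishing hK nX iX C.
have [z' [Uz' Vz']] := cox_pull_nonempty C neV.
have U'' : U (block_scale blk b 0 z').
  apply: (cox_support Uz) => i; rewrite mxE; case: eqP => [ib _|_ z0]; first exact: zb.
  by have := VP z' Uz' Vz' i; rewrite z0 eqxx.
have [i0 i0b] := blkS b.
have [e|ne] := pselect (p (block_scale blk b 0 z') = p z').
  have := VP _ U'' _ i0; rewrite e mxE i0b eqxx mul0r eqxx => h.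
  by have := h Vz'.
have [_ _ dX] := vX.
have cP : closed [set p z'] by exact: (@closed_point _ X nX dX (p z')).
have oN := cox_pull_open C (closed_openC cP).
have /affine_openP/(_ (block_scale blk b 0 z') (conj U'' ne))[F F0 FN] := oN.
have [f fE] := block_scale_poly blk b z' F; rewrite -fE in F0.
have f0 : f != 0 by apply: contraNneq F0 => ->; rewrite horner0.
have [c c0 fc] := poly_nonroot_neq0 hK f0; rewrite fE in fc.
have [u tu uE] := block_scale_act blk b z' c0.
have [_ /=] := FN _ fc; apply.
by rewrite uE; case: (cox_block_act tu Uz').
Qed.

(** Killing block [b] of the all-ones vector leaves [U], so the point lies in a removed coordinate
    subspace. All of that subspace's equations come from the block, and there are at least two. *)
Lemma cox_block_size b : (1 < block_size blk b)%N.
Proof.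
have [i0 i0b] := blkS b; rewrite ltnNge; apply/negP => sz.
have /card_le1P/(_ i0) h := sz; have i0in : i0 \in [pred i | blk i == b] by rewrite inE i0b.
have only i : blk i = b -> i = i0.
  by move=> ib; have := h i0in i; rewrite !inE ib eqxx => /esym/eqP.
have [F [F2 UF]] := cox_compl C.
have : (~` U) (block_scale blk b 0 (const_mx 1)) by move/cox_in_Uhat; exact: block_scale0_notin.
rewrite UF => -[I IF Iz]; have := F2 I IF; apply/negP; rewrite -leqNgt.
apply/card_le1P => i iI i'; have is0 j : j \in I -> j = i0.
  move=> jI; apply: only; have := Iz j jI; rewrite !mxE; case: eqP => // _ /eqP.
  by rewrite oner_eq0.
apply/idP/eqP => [i'I|->//]; by rewrite (is0 _ i'I) (is0 _ iI).
Qed.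

Lemma block_monomial (z : affine_space K n) (e : 'I_k -> nat) : Uhat blk z ->
  exists2 M : mpoly n K, whomog (block_weight blk) (\row_b (e b)%:Z) M & peval M z != 0.
Proof.
move=> Uz; have /choice[i iP] : forall b, exists i, blk i = b /\ z 0 i != 0.
  by move=> b; have [i] := Uz b; exists i.
exists (\prod_b pvar K (i b) ^+ e b).
  rewrite (_ : \row_b _ = \sum_b (block_weight blk (i b)) *+ e b).
    by apply: (whomog_prod hK) => b _; apply: (whomogX hK); exact: whomog_var.
  apply/rowP => b; rewrite mxE summxE (bigD1 b) //= big1 => [|b' bb].
    rewrite addr0 /block_weight (iP b).1 -scaler_nat !mxE !eqxx mulr1 //.
    by rewrite natz.
  by rewrite /block_weight (iP b').1 -scaler_nat !mxE eqxx eq_sym (negbTE bb) mulr0.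
rewrite peval_prod; apply/prodf_neq0 => b _; rewrite pevalX expf_neq0 // peval_var.
by case: (iP b).
Qed.

(* Over an affine [V], the preimage of [V] is the locus [Q != 0] of a form [Q]
   of positive degree in each block; a suitable [F * M / Q ^+ m] is invariant,
   hence descends to [V], and its nonvanishing locus is the set required. *)
Lemma cox_saturated (O : set (affine_space K n)) z : open O -> invariant_set (block_weight blk) O ->
  O `<=` U -> O z -> exists V, [/\ open V, V (p z) & U `&` p @^-1` V `<=` O].
Proof.
move=> oO iO OU Oz; have Uz := OU z Oz.
have [_ [N [Va [aV cV]]] _] := vX; have [i0 Vz] := cV (p z).
have affV := aV i0; have oV : open (Va i0) := affV.1; move: (Va i0) affV oV Vz => V affV oV Vz.
have [_ _ _ affB desc] := cox_quot C.
have Bz : (U `&` p @^-1` V) z by [].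
have [Q BQ] := affine_open_principal hK (ex_intro _ z Bz) (affB V affV).
have oB := cox_pull_open C oV.
have BQ' y : (U `&` p @^-1` V) y <-> peval Q y != 0 by have /seteqP[h1 h2] := BQ; split=> [/h1|/h2].
have [a hQ] := nonvanishing_whomog hK oB (ex_intro _ z Bz) (@cox_block_invariant V) (fun y By => (BQ' y).1 By).
have Qz : peval Q z != 0 by exact/BQ'.
have Q0 : Q != 0 by apply: contraNneq Qz => ->; rewrite peval0.
(* If [Q] had degree 0 in block [b], sending that block to 0 would keep [Q] nonzero and lead to a
   point of [U] outside [Uhat]. *)
have a0 b : (0 < absz (a 0%R b))%N.
  rewrite absz_gt0; apply: contra_notN (@block_scale0_notin K n k blk b z) => /eqP ab.
  by apply: cox_in_Uhat; have [|//] := (BQ' (block_scale blk b 0 z)).2; rewrite (whomog_block0 hK _ hQ ab).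
have [c [F [hF Fz FO]]] := invariant_open_basic hK oO iO Oz.
have F0 : F != 0 by apply: contraNneq Fz => ->; rewrite peval0.
(* All degrees of [Q] being at least 1, this power of [Q] has degree at least that of [F] in every
   block, and the monomial [M] makes up the difference. *)
pose m := (\sum_b absz (c 0%R b))%N.
have mP b : (absz (c 0%R b) <= m * absz (a 0%R b))%N.
  apply: (@leq_trans m); first by rewrite /m (bigD1 b) //= leq_addr.
  by rewrite leq_pmulr.
have [M hM Mz] := block_monomial (fun b => (m * absz (a 0%R b) - absz (c 0%R b))%N) (cox_in_Uhat Uz).
have degE : c + \row_b ((m * absz (a 0%R b) - absz (c 0%R b))%N)%:Z = a *+ m.
  apply/rowP => b; rewrite -scaler_nat !mxE -subzn // PoszM !gez0_abs ?(whomog_ge0 b F0 hF) ?(whomog_ge0 b Q0 hQ) //.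
  by rewrite addrC subrK natz.
pose g (y : affine_space K n) := peval F y * peval M y / peval Q y ^+ m.
have nA := nice_affine K n.
have rg : regular (U `&` p @^-1` V) g.
  apply: (regular_div nA oB); first by apply: (nice_mul nA oB); exact: regular_peval.
    apply: (regular_exp nA m oB); exact: regular_peval.
  by move=> y By; rewrite expf_neq0 //; exact/BQ'.
have [f [rf fE]] : exists f, regular V f /\ forall y, U y -> V (p y) -> g y = f (p y).
  apply: (desc V g oV rg) => t y tt Uy Vy; rewrite wE chi_act_block.
  have tu := chi_torus chi tt; set u := \row_b _ in tu *.
  rewrite /g (whomog_act y tu hF) (whomog_act y tu hM) (whomog_act y tu hQ).
  have := tpowMn a m tu; rewrite -degE tpowD // => e.
  rewrite exprMn -e; have := tpow_neq0 c tu; have := tpow_neq0 (\row_b ((m * absz (a 0%R b) - absz (c 0%R b))%N)%:Z) tu.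
  move: (tpow u _) (tpow u _) => x x' x0 x0'.
  by rewrite mulrACA -mulf_div divff ?mul1r // mulf_neq0.
exists (V `&` [set x | f x != 0]); split.
- exact: (nice_open nX oV rf).
- by split=> //=; rewrite -fE // /g mulf_neq0 ?invr_eq0 ?expf_neq0 // mulf_neq0.
move=> y [Uy [Vy /=]]; rewrite -fE // /g => h; apply: FO.
by apply: contraNneq h => ->; rewrite !mul0r.
Qed.

End CoxBlocks.

(** The fibre of [z'] is cut out in [Uhat] by the 2 x 2 minors pairing [z] with [z'] inside each
    block. *)
Lemma block_point_closed (K : closedFieldType) (P : kspace K) (nP : nice P) n k (blk : 'I_n -> 'I_k)
    (q : affine_space K n -> P) :
  presentation (block_weight blk) (Uhat blk) q -> forall y : P, open (~` [set y]).
Proof.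
move=> pr y; have [z' Uz' <-] := pr_surj pr y; apply: (pr_quotient_open nP pr).
have oU := @open_Uhat K n k blk.
apply: open_local => z [Uz nz].
have [i [j [ij zij]]] : exists i j, blk i = blk j /\ z 0 i * z' 0 j - z 0 j * z' 0 i != 0.
  apply: contrapT => h; apply: nz => /=; apply/esym; apply/(pr_fib pr Uz' Uz).
  have minor i j : blk i = blk j -> z 0 i * z' 0 j = z 0 j * z' 0 i.
    move=> ij; apply/eqP; rewrite -subr_eq0; apply: contrapT => /negP h'; apply: h.
    by exists i, j.
  have /choice[s sP] : forall b, exists i, blk i = b /\ z' 0 i != 0.
    by move=> b; have [i] := Uz' b; exists i.
  have zs b : z 0 (s b) != 0.
    have [j jb zj] := Uz b; apply: contraNneq zj => z0.
    have := minor j (s b); rewrite (sP b).1 => /(_ jb); rewrite z0 mul0r => /eqP.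
    by rewrite mulf_eq0 (negbTE (sP b).2) orbF.
  exists (\row_b (z 0 (s b) / z' 0 (s b))).
    by move=> b; rewrite mxE mulf_neq0 ?invr_eq0 // (sP b).2.
  rewrite block_act; apply/rowP => j; rewrite !mxE mulrAC minor ?(sP _).1 //.
  by rewrite mulfK // (sP _).2.
have oM := open_basic (pvar K i * mpolyC n (z' 0 j) - pvar K j * mpolyC n (z' 0 i)).
have ME y' : peval (pvar K i * mpolyC n (z' 0 j) - pvar K j * mpolyC n (z' 0 i)) y' =
    y' 0 i * z' 0 j - y' 0 j * z' 0 i.
  by rewrite pevalD pevalN !pevalM !pevalC !peval_var.
exists (Uhat blk `&` [set y' | peval (pvar K i * mpolyC n (z' 0 j) - pvar K j * mpolyC n (z' 0 i)) y' != 0]).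
split; [exact: (openI oU oM)|by split=> //=; rewrite ME|].
move=> y' [Uy' /=]; rewrite ME => h; split=> //= e; case/eqP: h.
have [t tt ->] := (pr_fib pr Uz' Uy').1 (esym e).
by rewrite block_act !mxE ij mulrAC subrr.
Qed.

Section Comparison.
Variable K : closedFieldType.
Hypothesis hK : [pchar K] =i pred0.
Variables (X : kspace K) (vX : variety X) (iX : irreducible [set: X]) (C : Cox_construction X).
Local Notation n := (cox_dim C).
Local Notation r := (cox_rank C).
Local Notation w := (@cox_deg K X C).
Local Notation U := (@cox_space K X C).
Local Notation p := (@cox_proj K X C).
Let nX := nice_variety vX.
Variables (k : nat) (blk : 'I_n -> 'I_k) (chi : 'I_k -> 'rV[int]_r) (L : 'M[int]_(r, k)).
Hypotheses (chiL : forall b, chi b *m L = delta_mx 0 b) (wE : w = fun i => chi (blk i)).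
Hypothesis blkS : forall b, exists i, blk i = b.
Variables (P : kspace K) (nP : nice P) (q : affine_space K n -> P).
Hypothesis pr : presentation (block_weight blk) (Uhat blk) q.
Let UU := cox_in_Uhat hK vX iX chiL wE blkS.
Let sat := cox_saturated hK vX iX chiL wE blkS.

(** If q z and q z' differ, the points of [U] outside the fibre of [q] through [z'] form an
    invariant open set containing [z]; by [cox_saturated] it contains the whole fibre of [p] through
    [z]. *)
Lemma cox_fibres z z' : U z -> U z' -> p z = p z' <-> q z = q z'.
Proof.
move=> Uz Uz'; split=> [e|/(pr_fib pr (UU Uz) (UU Uz'))[t tt ->]]; last first.
  by apply/esym; case: (cox_block_act chiL wE tt Uz).
apply: contrapT => ne.
have oO := openI (cox_open C) (pr_cont pr (block_point_closed nP pr (q z'))).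
have [|y|V [_ Vz VO]] := sat oO _ _ (conj Uz (conj (UU Uz) ne)).
- move=> t y tt [Uy [Uhy qy]]; have [Uty _] := cox_block_act chiL wE tt Uy.
  by split=> //; split; [exact: UU|rewrite /= (pr_act pr tt Uhy)].
- by case.
by have [|_ [_ /=]] := VO z'; [split=> //=; rewrite -e|apply].
Qed.

Lemma cox_image_open O : open O -> open (q @` (U `&` p @^-1` O)).
Proof.
move=> oO; apply: (pr_image_open nP pr (cox_pull_open C oO)).
  exact: (cox_block_invariant chiL wE).
by move=> z [Uz _]; exact: UU.
Qed.

Definition cox_image : set P := q @` U.

Lemma open_cox_image : open cox_image.
Proof.
have := cox_image_open (@openT X); congr open; rewrite /cox_image; congr (q @` _).
by apply/seteqP; split=> z //; case.
Qed.

Lemma cox_theta_exists : exists theta : X -> restrict cox_image, forall z, U z -> set_val (theta (p z)) = q z.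
Proof.
have /choice[f fP] : forall x, exists y : restrict cox_image, exists z, [/\ U z, p z = x & set_val y = q z].
  move=> x; have [z Uz pz] := cox_surj C x.
  have h : cox_image (q z) by exists z.
  by exists (SigSub (mem_set h)), z.
exists f => z Uz; have [z' [Uz' pz ->]] := fP (p z).
exact/(cox_fibres Uz' Uz).
Qed.

Lemma cox_eta_exists : exists eta : restrict cox_image -> X, forall z y, U z -> set_val y = q z -> eta y = p z.
Proof.
have /choice[f fP] : forall y : restrict cox_image, exists x, exists z, [/\ U z, p z = x & set_val y = q z].
  move=> y; have [z Uz qz] : cox_image (set_val y) := set_valP y.
  by exists (p z), z.
exists f => z y Uz yz; have [z' [Uz' <- e]] := fP y.
by apply/(cox_fibres Uz' Uz); rewrite -e.
Qed.

(** Both quotients have the same fibres. Continuity towards [P] comes from [cox_saturated], and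
    functions descend to [X] because [p] is a good quotient; in the other direction the local
    sections of [q] do both. *)
Theorem cox_isomorphic : isomorphic X (restrict cox_image).
Proof.
have [th thE] := cox_theta_exists; have [et etE] := cox_eta_exists.
have nA := nice_affine K n; have oI := open_cox_image.
have [_ _ _ _ desc] := cox_quot C.
have pull (O : set P) z : U z -> (set_val @^-1` O) (th (p z)) <-> O (q z).
  by move=> Uz; rewrite /= thE.
have thO (O : set P) : open O -> open (th @^-1` (set_val @^-1` O)).
  move=> oO; apply: open_local => x; have [z Uz <-] := cox_surj C x => Ox.
  have qz : O (q z) by exact/(pull O z Uz).
  have oV := openI (cox_open C) (pr_cont pr oO).
  have [|y|V [oV' Vz VO]] := sat oV _ _ (conj Uz (conj (UU Uz) qz)).
  - move=> t y tt [Uy [Uhy qy]]; have [Uty _] := cox_block_act chiL wE tt Uy.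
    by split=> //; split; [exact: UU|rewrite /= (pr_act pr tt Uhy)].
  - by case.
  exists V; split=> // x'; have [y Uy <-] := cox_surj C x' => Vy.
  by apply/(pull O y Uy); have [_ []] := VO y (conj Uy Vy).
exists th, et; split.
- split.
    apply/continuousP => O /open_restrictP[O' oO' <-]; exact: thO.
  move=> O g oO rg; have /open_restrictP[O' oO' OE] := oO.
  have oV := thO O' oO'; rewrite OE in oV.
  have rg' : regular (cox_image `&` O') (extend g) by apply/(regular_extend _ nP oI oO'); rewrite OE.
  have rq := pr_reg pr (openI oI oO') rg'.
  have oB := cox_pull_open C oV.
  have sub : U `&` p @^-1` (th @^-1` O) `<=` Uhat blk `&` q @^-1` (cox_image `&` O').
    move=> z [Uz Oz]; split; first exact: UU.
    split; first by exists z.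
    by apply/(pull O' z Uz); rewrite OE.
  have rh := regular_sub nA oB (pr_cont pr (openI oI oO')) sub rq.
  have [|f [rf fE]] := desc (th @^-1` O) _ oV rh.
    move=> t z tt Uz _; rewrite wE chi_act_block.
    by rewrite /= (pr_act pr (chi_torus chi tt) (UU Uz)).
  apply: (regular_eq nX oV _ rf) => x; have [z Uz <-] := cox_surj C x => Vz.
  by rewrite -fE //= -thE // extendE.
- split.
    apply/continuousP => O oO; apply/open_restrictP; exists (q @` (U `&` p @^-1` O)); first exact: cox_image_open.
    apply/seteqP; split=> y /=.
      by move=> [z [Uz Oz] qz]; rewrite (etE z y).
    move=> Oy; have [z Uz qz] : cox_image (set_val y) := set_valP y.
    by exists z => //; split=> //=; rewrite -(etE z y).
  move=> O f oO rf; have oQ := cox_image_open oO.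
  (* The inverse map, extended arbitrarily outside the image so that its composite with [f] is a
     total function on [P]. *)
  have /choice[e eP] : forall y : P, exists x, forall z, U z -> q z = y -> p z = x.
    move=> y; have [[z Uz qz]|ny] := pselect (cox_image y).
      by exists (p z) => z' Uz' qz'; apply/(cox_fibres Uz' Uz); rewrite qz.
    have [[x0 _] _] := iX; exists x0 => z Uz qz; case: ny; by exists z.
  have rF : regular (q @` (U `&` p @^-1` O)) (f \o e).
    have satE : Uhat blk `&` q @^-1` (q @` (U `&` p @^-1` O)) = U `&` p @^-1` O.
      apply: (pr_saturated pr); first exact: (cox_block_invariant chiL wE).
      by move=> z [Uz _]; exact: UU.
    apply: (pr_quotient_regular nP pr oQ); rewrite satE.
    apply: (regular_eq nA (cox_pull_open C oO) _ (cox_pull_regular oO rf)).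
    by move=> z [Uz Oz] /=; rewrite -(eP (q z) z).
  have h := restrict_regular (A := cox_image) nP oQ rF.
  have preE : set_val @^-1` (q @` (U `&` p @^-1` O)) = et @^-1` O :> set (restrict cox_image).
    apply/seteqP; split=> y /=.
      by move=> [z [Uz Oz] qz]; rewrite (etE z y).
    move=> Oy; have [z Uz qz] : cox_image (set_val y) := set_valP y.
    by exists z => //; split=> //=; rewrite -(etE z y).
  rewrite preE in h.
  have oE : open (et @^-1` O) by rewrite -preE; exact: open_restrict.
  apply: (regular_eq (nice_restrict cox_image nP) oE _ h) => y _ /=.
  have [z Uz qz] : cox_image (set_val y) := set_valP y.
  by rewrite (etE z y) // -(eP _ z Uz qz).
- by move=> x; have [z Uz <-] := cox_surj C x; apply: etE => //; exact: thE.
move=> y; have [z Uz qz] : cox_image (set_val y) := set_valP y.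
by apply: val_inj; rewrite (etE z y) //; rewrite -[RHS]qz; exact: thE.
Qed.

End Comparison.

Section CoordinateTorus.
Variable K : closedFieldType.
Hypothesis hK : [pchar K] =i pred0.
Variables (P : kspace K) (nP : nice P) (n k : nat) (blk : 'I_n -> 'I_k) (q : affine_space K n -> P).
Hypothesis pr : presentation (block_weight blk) (Uhat blk) q.
Hypothesis blkS : forall b, exists i, blk i = b.

Lemma Uhat_torus_mul t z : torus t -> Uhat blk z -> Uhat (K := K) blk (torus_mul t z).
Proof. by move=> tt Uz b; have [i ib zi] := Uz b; exists i => //; rewrite mxE mulf_neq0. Qed.

Lemma open_torus : open (@torus K n : set (affine_space K n)).
Proof.
have := open_basic (\prod_j pvar K j : mpoly n K); congr open; apply/seteqP; split=> z /=.
  by rewrite peval_prod => /prodf_neq0 h j; have := h j isT; rewrite peval_var.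
by move=> h; rewrite peval_prod; apply/prodf_neq0 => j _; rewrite peval_var.
Qed.

(** Multiplication of all coordinates commutes with the scaling of blocks and so descends along
    [q]. *)
Lemma coordinate_torus : exists tau : 'rV[K]_n -> P -> P,
  [/\ torus_action tau, open_orbit (@torus K n) tau &
      forall t z, torus t -> Uhat blk z -> tau t (q z) = q (torus_mul t z)].
Proof.
have /choice[l lP] : forall y, exists z, Uhat blk z /\ q z = y.
  by move=> y; have [z] := pr_surj pr y; exists z.
pose tau t y := q (torus_mul t (l y)).
have tauE t z : torus t -> Uhat blk z -> tau t (q z) = q (torus_mul t z).
  move=> tt Uz; have [Ul le] := lP (q z).
  have [u tu zE] := (pr_fib pr Ul Uz).1 le.
  have e : torus_mul t z = grading_action (block_weight blk) u (torus_mul t (l (q z))).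
    by rewrite {1}zE !block_act; apply/rowP => i; rewrite !mxE mulrCA.
  by rewrite e (pr_act pr tu (Uhat_torus_mul tt Ul)).
exists tau; split=> //; first split; first split.
- move=> y; have [Ul {2}<-] := lP y; rewrite -{1}(lP y).2 tauE //; last exact: torus1.
  by congr q; apply/rowP => i; rewrite !mxE mul1r.
- move=> g h y tg th; have [Ul <-] := lP y; rewrite !tauE //; try exact: Uhat_torus_mul; last exact: torus_mulP.
  by congr q; apply/rowP => i; rewrite !mxE mulrA.
- have nT := nice_restrict (@torus K n : set (affine_space K n)) (nice_affine K n).
  have nTP := nice_product nT nP.
  (* Local lifts of the action: a point is lifted by a local section before its coordinates are
     multiplied. *)
  have local (z : product (restrict (@torus K n : set (affine_space K n))) P) : exists W (G : _ -> affine_space K n),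
      [/\ open W, W z, forall i, regular W (fun y => G y 0 i) &
          forall y, W y -> Uhat blk (G y) /\ tau (set_val y.1) y.2 = q (G y)].
    have [V [s [oV Vz rs sE]]] := pr_sec pr z.2.
    have oT : open (setT : set (restrict (@torus K n : set (affine_space K n)))) by exact: openT.
    exists [set y | setT y.1 /\ V y.2], (fun y => torus_mul (set_val y.1) (s y.2)); split.
    + exact: (open_product nT nP oT oV).
    + by split.
    + move=> i; have rT := @regular_peval K n setT (pvar K i).
      have rT' := restrict_regular (A := (@torus K n : set (affine_space K n))) (nice_affine K n) openT rT.
      have h1 := tensor_fst nP oT oV rT'.
      have h2 := tensor_snd nT oT oV (rs i).
      have h3 := regular_tensor nT nP oT oV (tensor_mul nT nP oT oV h1 h2).
      apply: (regular_eq nTP (open_product nT nP oT oV) _ h3) => y _ /=.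
      by rewrite mxE peval_var.
    move=> y [_ Vy]; have [Us sy] := sE _ Vy; have ty := set_valP y.1.
    split; first exact: Uhat_torus_mul.
    by rewrite -{1}sy tauE.
  have cont (O : set P) : open O -> open ((fun z : product (restrict (@torus K n : set (affine_space K n))) P => tau (set_val z.1) z.2) @^-1` O).
    move=> oO; apply: open_local => z Oz; have [W [G [oW Wz rG GE]]] := local z.
    exists (W `&` G @^-1` (Uhat blk `&` q @^-1` O)); split.
    + exact: (preimage_affine_open nTP oW rG (pr_cont pr oO)).
    + by have [UG GEz] := GE z Wz; split=> //; split=> //=; rewrite -GEz.
    by move=> y [Wy [_ /= Oy]]; rewrite /= (GE y Wy).2.
  split; first exact/continuousP.
  move=> O g oO rg; apply: (regular_local nTP (cont O oO)) => z Oz.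
  have [W [G [oW Wz rG GE]]] := local z.
  exists (W `&` G @^-1` (Uhat blk `&` q @^-1` O)), ((g \o q) \o G); split.
  + exact: (preimage_affine_open nTP oW rG (pr_cont pr oO)).
  + by have [UG GEz] := GE z Wz; split=> //; split=> //=; rewrite -GEz.
  + exact: (preimage_affine_regular nTP oW rG (pr_cont pr oO) (pr_reg pr oO rg)).
  by move=> y [Wy _] _; rewrite /= (GE y Wy).2.
exists (q (const_mx 1)).
have U1 : Uhat blk (const_mx 1 : affine_space K n).
  by move=> b; have [i ib] := blkS b; exists i => //; rewrite mxE oner_neq0.
have TU : (@torus K n : set (affine_space K n)) `<=` Uhat blk.
  by move=> z tz b; have [i ib] := blkS b; exists i.
have iT : invariant_set (block_weight blk) (@torus K n : set (affine_space K n)).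
  by move=> u z tu tz i; rewrite block_act mxE mulf_neq0.
have := pr_image_open nP pr open_torus iT TU; congr open.
have t1 (z : 'rV[K]_n) : torus_mul z (const_mx 1) = z by apply/rowP => i; rewrite !mxE mulr1.
by apply/seteqP; split=> y [z tz <-]; exists z => //; rewrite tauE // t1.
Qed.

Hypothesis size2 : forall b, (1 < block_size blk b)%N.

Lemma coordinate_form_prime i : form_prime (block_weight blk) (Uhat blk) (pvar K i).
Proof.
split; [exact: prime_pvar|exists (block_weight blk i); exact: whomog_var|].
exact: (Uhat_meets hK size2 (prime_pvar K i)).
Qed.

Lemma irreducible_finite_union (T : topologicalType) (I : eqType) (E : I -> set T) (S : seq I) (A : set T) :
  irreducible A -> (forall i, closed (E i)) -> (forall y, A y -> exists2 i, i \in S & E i y) ->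
  exists2 i, i \in S & A `<=` E i.
Proof.
move=> [[a Aa] irr] cE; elim: S => [|i S IH] h; first by have [j] := h a Aa.
have cS : closed (\bigcup_(j in [set` S]) E j).
  elim: S {IH h} => [|j S IH].
    by rewrite (_ : bigcup _ _ = set0); [exact: closed0|apply/seteqP; split=> // y []].
  rewrite (_ : bigcup _ _ = E j `|` \bigcup_(j in [set` S]) E j); first exact: (closedU (cE j) IH).
  apply/seteqP; split=> [y [j' /=]|y [Ey|[j' jS Ey]]].
  - by rewrite inE => /orP[/eqP ->|jS] Ey; [left|right; exists j'].
  - by exists j => //=; rewrite inE eqxx.
  by exists j' => //=; rewrite inE; apply/orP; right.
have [|AE|AE] := irr _ _ (cE i) cS.
- move=> y Ay; have [j] := h y Ay; rewrite inE => /orP[/eqP ->|jS] Ej; [by left|by right; exists j].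
- by exists i => //; rewrite mem_head.
have [|j jS AEj] := IH; last by exists j => //; rewrite inE jS orbT.
by move=> y /AE[j jS Ej]; exists j.
Qed.

(** An irreducible closed set in the complement lies in the loci of two distinct variables. It is
    strictly smaller than the first locus, since neither variable divides the other, and that locus
    lies strictly below the whole space. *)
Lemma coordinate_codim (U : set (affine_space K n)) (F : {set {set 'I_n}}) :
  (forall I, I \in F -> (2 <= #|I|)%N) -> ~` U = \bigcup_(I in [set` F]) @coordinate_subspace K n I ->
  codim_ge 2 (~` (q @` U)).
Proof.
move=> F2 UF A irrA AU; have [cA iA] := irrA.
pose E (I : {set 'I_n}) := \bigcap_(i in [set` I]) zset (Uhat blk) q (pvar K i).
have hv i : whomog (block_weight blk) (block_weight blk i) (pvar K i) by exact: whomog_var.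
have cZ i : closed (zset (Uhat blk) q (pvar K i)) by exact: (closed_zset nP pr (hv i)).
have [|y Ay|I] := @irreducible_finite_union _ _ E (enum F) A iA.
- by move=> I; apply: closed_bigI => i _; exact: cZ.
- have [z Uz qz] := pr_surj pr y.
  have nUz : (~` U) z by move=> Uz'; apply: (AU y Ay); exists z.
  rewrite UF in nUz; have [I IF Iz] := nUz; exists I; first by rewrite mem_enum.
  by move=> i iI; rewrite -qz; apply/(zset_pi pr (hv i) Uz); rewrite peval_var; exact: Iz.
rewrite mem_enum => /F2 /card_gt1P[i [j [iI jI ij]]] AE.
have fi := coordinate_form_prime i; have fj := coordinate_form_prime j.
have U0 : Uhat (K := K) blk !=set0.
  by exists (const_mx 1 : affine_space K n) => b; have [l lb] := blkS b; exists l => //; rewrite mxE oner_neq0.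
exists (zset (Uhat blk) q (pvar K i)); split.
- exact: (zset_irreducible hK nP pr fi).
- split=> [y /AE h|ZA]; first exact: h.
  have sub : zset (Uhat blk) q (pvar K i) `<=` zset (Uhat blk) q (pvar K j).
    by move=> y /ZA /AE h; exact: h.
  have [c /(congr1 (fun Q => peval Q (delta_mx 0 j)))] := zset_divides hK pr fi (hv j) sub.
  rewrite pevalM !peval_var !mxE !eqxx /= (negbTE ij).
  by rewrite mulr0 => /eqP; rewrite oner_eq0.
exists setT; split=> //; first (have h := setT_irreducible_closed hK pr U0; exact: h).
have h := zset_proper hK pr fi U0; exact: h.
Qed.

End CoordinateTorus.

Theorem big_open_of_linearizable (K : closedFieldType) (hK : [pchar K] =i pred0)
  (X : kspace K) (hX : toric_variety X)
  (m : nat) (alpha : 'rV[K]_m -> X -> X) (halpha : additive_action alpha)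
  (C : Cox_construction X)
  (beta : 'rV[K]_m -> affine_space K (cox_dim C) -> affine_space K (cox_dim C))
  (hbeta : lifted_action alpha beta) :
  linearizable (torus (d := cox_rank C) `*` [set: 'rV[K]_m]) (associated_action beta) ->
  exists dims : seq nat, big_open_subset X (product_of_projective_spaces K dims).
Proof.
move=> lin; have [vX iX _ _] := hX; have nX := nice_variety vX.
have [vb comm _ _] := hbeta; have [[b0 _] _] := vb.
have [psi [psi' [B [N [pK pK' BE pact pbeta]]]]] := linearized_coordinates hK b0 lin.
have [k [blk [chi [chiI wE blkS]]]] := weight_blocks (@cox_deg K X C).
have [phi [hphi iphi sphi]] := invariant_forms hK vb comm pK pK' BE pact pbeta chiI wE blkS.
have [L chiL] := weights_basis hK nX iX halpha hbeta hphi iphi sphi wE.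
have wE' : @cox_deg K X C = fun i => chi (blk i) by apply/funext.
have size2 := cox_block_size hK vX iX chiL wE' blkS.
have [dims [q pr]] := blocks_presentation hK size2.
have nP := nice_dims hK dims.
have [tau [tact torb tauE]] := coordinate_torus nP pr blkS.
have UU := cox_in_Uhat hK vX iX chiL wE' blkS.
exists dims, (cox_dim C), tau; split=> //; exists (cox_image q); split.
- exact: (open_cox_image hK vX iX chiL wE' blkS nP pr).
- move=> t y tt [z Uz <-]; rewrite tauE //; last exact: UU.
  exists (torus_mul t z) => //; apply: (cox_support Uz) => i; rewrite mxE => /eqP.
  by rewrite mulf_eq0 (negbTE (tt i)) => /eqP.
- have [F [F2 UF]] := cox_compl C.
  exact: (coordinate_codim hK nP pr blkS size2 F2 UF).
exact: (cox_isomorphic hK vX iX chiL wE' blkS nP pr).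
Qed.

Theorem proposition7 (K : closedFieldType) (hK : [pchar K] =i pred0)
  (X : kspace K) (hX : toric_variety X)
  (m : nat) (alpha : 'rV[K]_m -> X -> X) (halpha : additive_action alpha)
  (C : Cox_construction X)
  (beta : 'rV[K]_m -> affine_space K (cox_dim C) -> affine_space K (cox_dim C))
  (hbeta : lifted_action alpha beta) :
  linearizable (torus (d := cox_rank C) `*` [set: 'rV[K]_m])
    (associated_action beta)
  <-> exists dims : seq nat,
        big_open_subset X (product_of_projective_spaces K dims).
Proof.
split; first exact: (big_open_of_linearizable hK hX halpha hbeta).
move=> [dims hP]; have [vb comm _ _] := hbeta.
exact: (linearizable_of_big_open hK hX vb comm hP).
Qed.
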